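(* Let $T>0$ and let $U\in BV_{LR}[0,T]$ be such that $$\int_{0+}^{\varepsilon\wedge t}\frac{1}{\sqrt r}\,d_r\,|||U|||_{[t-r,t]}\to 0\quad\text{uniformly for } t\in(0,T]\text{ as }\varepsilon\to0,$$ where the integral is with respect to the nondecreasing function $r\mapsto |||U|||_{[t-r,t]}$. Let $\gamma:[0,T]\to\overline{\mathbb H}$ be the trace of the Loewner chain driven by $U$. Then the curve $t\mapsto\gamma_{t^2}$ (on $[0,\sqrt T]$) is continuously differentiable.
   Context: $\mathbb H=\{z\in\mathbb C:\Im z>0\}$. $C_0[0,T]$ is the set of continuous functions $U:[0,T]\to\mathbb R$ with $U_0=0$. For a function $U$ and a closed interval $I$, $|||U|||_I$ denotes the total variation of $U$ on $I$, and $|||U|||_t:=|||U|||_{[0,t]}$. $BV_{LR}[0,T]$ is the set of all $U\in C_0[0,T]$ with $|||U|||_T<\infty$ and such that for all $t\in(0,T]$, $\limsup_{s\to0+}\frac{|||U|||_{[t-s,t]}}{\sqrt s}<2$. Loewner chain: for $U\in C_0[0,T]$ and $z\in\overline{\mathbb H}\setminus\{0\}$, let $g_t(z)$ be the solution of $\partial_t g_t(z)=\frac{2}{g_t(z)-U_t}$, $g_0(z)=z$, on its maximal interval of existence $[0,T_z)$ ($T_z\in(0,\infty]$, with $T_z=\infty$ if the solution exists on all of $[0,T]$), and put $T_0=0$. Let $K_t=\{z\in\overline{\mathbb H}:T_z\le t\}$. The family $(K_t)_{t\in[0,T]}$ is the Loewner chain driven by $U$; $H_t:=\mathbb H\setminus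 K_t$ is simply connected and $g_t$ is a conformal map from $H_t$ onto $\mathbb H$. The chain admits a trace if there is a continuous curve $\gamma:[0,T]\to\overline{\mathbb H}$ with $\gamma_0=0$ such that for all $t\in[0,T]$, $H_t$ is the unbounded component of $\mathbb H\setminus\gamma[0,t]$; $\gamma$ is then called the trace of the chain. For every $U\in BV_{LR}[0,T]$ the Loewner chain driven by $U$ admits a simple trace $\gamma$, given by $\gamma_t=\lim_{y\to0+}g_t^{-1}(iy+U_t)$. *)

(* Defs.v *)
From HB Require Import structures.
From mathcomp Require Import all_boot all_order all_algebra.
From mathcomp Require Import complex.
From mathcomp Require Import all_classical all_reals all_analysis.

Set Implicit Arguments.
Unset Strict Implicit.
Unset Printing Implicit Defensive.
Import Order.TTheory GRing.Theory Num.Theory.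
Import numFieldNormedType.Exports.

Local Open Scope classical_set_scope.
Local Open Scope ring_scope.
Local Open Scope complex_scope.

(* The norm topology of R[i]; the library only attaches it to R[i]^o. *)
#[warnings="-redundant-canonical-projection"]
HB.instance Definition _ (R : rcfType) := NormedModule.copy R[i] R[i]^o.

Section BVLR.
Context {R : realType}.
Implicit Types (T t : R) (U : R -> R).

(* Functions on [0, T] are represented by functions on R whose values outside
   [0, T] are irrelevant. *)
Definition BV_LR T U :=
  [/\ {within `[0, T], continuous U},
      U 0 = 0,
      (total_variation 0 T U < +oo)%E
    & forall t, 0 < t <= T ->
        (limf_esup (fun s => total_variation (t - s) t U * ((Num.sqrt s)^-1)%:E)
                   0^'+ < 2%:E)%E].

(* r |-> |||U|||_[t - r, t] for 0 <= r <= t, extended by constants to R *)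
Definition backward_variation U t (r : R) : R :=
  fine (total_variation (t - Num.max 0 (Num.min r t)) t U).

End BVLR.

Section cumulative_of.
Context {R : realType} (F : R -> R).

(* The library's Stieltjes measures take bundled nondecreasing right-continuous
   functions; idfun is a junk value, never reached in the situation of
   backward_variation_cumulative below. *)
Definition cumulative_of : cumulative R R :=
  match pselect (nondecreasing F /\ right_continuous F) with
  | left H => HB.pack_for (cumulative R R) F
                (isCumulative.Build R _ R F (proj1 H) (proj2 H))
  | right _ => idfun
  end.

Lemma cumulative_ofE : nondecreasing F -> right_continuous F ->
  cumulative_of = F :> (R -> R).
Proof.
by move=> ndF rcF; rewrite /cumulative_of; case: pselect => // -[].
Qed.

End cumulative_of.

Section backward_variation_cumulative.
Context {R : realType} (T : R) (U : R -> R).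
Hypotheses (T0 : 0 < T) (bvU : BV_LR T U).
Variable t : R.
Hypothesis tT : 0 <= t <= T.

Let clamp (r : R) : R := t - Num.max 0 (Num.min r t).

Let clamp_itv r : 0 <= clamp r <= t.
Proof.
have /andP[t0 _] := tT; rewrite /clamp subr_ge0 ge_max t0 /= ge_min lexx orbT /=.
by rewrite gerBl le_max lexx.
Qed.

Let bv0T : bounded_variation 0 T U.
Proof.
case: bvU => _ _ tv _; apply/(bounded_variationP _ (ltW T0)).
by rewrite ge0_fin_numE // total_variation_ge0 // ltW.
Qed.

Let tv_fin a b : 0 <= a -> a <= b -> b <= T ->
  total_variation a b U \is a fin_num.
Proof.
move=> a0 ab bT; apply/bounded_variationP => //.
apply: (@bounded_variationl _ _ _ T) => //.
apply: (@bounded_variationr _ 0) => //; exact: le_trans ab bT.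
Qed.

Let backward_variationE r : backward_variation U t r =
  fine (total_variation 0 t U) - fine (total_variation 0 (clamp r) U).
Proof.
have /andP[t0 lT] := tT; have /andP[c0 ct] := clamp_itv r.
rewrite (total_variationD U c0 ct) fineD ?tv_fin // ?(le_trans ct lT) //.
by rewrite addrC addKr.
Qed.

Lemma backward_variation_cumulative :
  cumulative_of (backward_variation U t) = backward_variation U t :> (R -> R).
Proof.
have /andP[t0 lT] := tT.
apply: cumulative_ofE.
  move=> r s rs; rewrite !backward_variationE lerD2l lerN2.
  have /andP[c0 ct] := clamp_itv r; have /andP[d0 dt] := clamp_itv s.
  have dc : clamp s <= clamp r.
    by rewrite /clamp lerD2l lerN2 le_max2 // le_min2.
  rewrite fine_le ?tv_fin // ?(le_trans _ lT) //.
  by rewrite (total_variationD U d0 dc) leeDl // total_variation_ge0.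
apply: right_continuousW => r.
have -> : backward_variation U t = fun r =>
    fine (total_variation 0 t U) - fine (total_variation 0 (clamp r) U).
  by apply/funext => s; exact: backward_variationE.
apply: (@cvgB _ R^o); first exact: cvg_cst.
case: bvU => cU _ _ _.
have /subspace_continuousP/(_ (clamp r)) := total_variation_continuous T0 cU bv0T.
have in0T s : `[0, T]%classic (clamp s).
  by have /andP[c0 ct] := clamp_itv s; rewrite /= in_itv /= c0 (le_trans ct lT).
move=> /(_ (in0T r)); apply: cvg_comp.
have clampC : {for r, continuous clamp}.
  apply: (@continuousB _ R^o); first exact: cvg_cst.
  apply: continuous_max; first exact: cvg_cst.
  by apply: continuous_min; [exact: cvg_id|exact: cvg_cst].
move=> P wP.
have nP : nbhs r (clamp @^-1` [set x | `[0, T]%classic x -> P x]) := clampC _ wP.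
by apply: filterS nP => s wPs; apply: wPs; exact: in0T.
Qed.

End backward_variation_cumulative.

Section stieltjes_condition.
Context {R : realType}.
Implicit Types (T t : R) (U : R -> R).

(* The integral over ]0, eps /\ t] with respect to the nondecreasing function
   r |-> |||U|||_[t - r, t]. *)
Definition sqrt_variation_integral U t (eps : R) : \bar R :=
  (\int[lebesgue_stieltjes_measure (cumulative_of (backward_variation U t))]_(r
     in `]0%R, Num.min eps t]) ((Num.sqrt r)^-1)%:E)%E.

Definition uniformly_small_integral T U :=
  forall eta : R, 0 < eta -> \forall eps \near 0^'+,
    forall t, 0 < t <= T -> (sqrt_variation_integral U t eps < eta%:E)%E.

End stieltjes_condition.

Section loewner.
Context {R : realType}.
Implicit Types (T t : R) (U : R -> R) (z : R[i]) (D : set R).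

(* Derivative of a complex-valued function of a real variable in D, one-sided
   at the endpoints of an interval. *)
Definition derivative_within D (f : R -> R[i]) t (l : R[i]) :=
  ((s - t)^-1)%:C * (f s - f t) @[s --> within D t^'] --> l.

Definition C1_within D (f : R -> R[i]) :=
  exists df : R -> R[i],
    (forall t, D t -> derivative_within D f t (df t)) /\
    {within D, continuous df}.

Definition upper_half_plane : set R[i] := [set z | 0 < complex.Im z].

Definition loewner_solution U z (b : R) (g : R -> R[i]) :=
  g 0 = z /\
  forall t, 0 <= t <= b ->
    g t <> (U t)%:C /\
    derivative_within `[0, b] g t (2 / (g t - (U t)%:C)).

(* The time T_z, i.e., the right end of the maximal interval of existence *)
Definition lifetime T U z : \bar R :=
  if z == 0 then 0%E
  else if `[< exists g, loewner_solution U z T g >] then +oo%E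
  else ereal_sup [set b%:E | b in
         [set b | 0 <= b <= T /\ exists g, loewner_solution U z b g]].

Definition loewner_hull T U t : set R[i] :=
  [set z | 0 <= complex.Im z /\ (lifetime T U z <= t%:E)%E].

Definition loewner_domain T U t : set R[i] :=
  upper_half_plane `\` loewner_hull T U t.

(* C is the unbounded connected component of A. *)
Definition is_unbounded_component (A C : set R[i]) :=
  [/\ exists2 z, A z & C = connected_component A z,
      ~ bounded_set C
    & forall z, A z -> ~ bounded_set (connected_component A z) ->
        connected_component A z = C].

Definition is_loewner_trace T U (gamma : R -> R[i]) :=
  [/\ {within `[0, T], continuous gamma},
      (forall t, 0 <= t <= T -> 0 <= complex.Im (gamma t)),
      gamma 0 = 0
    & forall t, 0 <= t <= T ->
        is_unbounded_component (upper_half_plane `\` gamma @` `[0, t])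
          (loewner_domain T U t)].

End loewner.

(* Main.v *)
(* For b in (0, T] let g = g^b be the orbit r |-> g_r(gamma_b), 0 <= r <= b.  It
   hits U at time b, so it is obtained as a limit of backward flows started at
   U_b + iy, y -> 0+.  For the zero driver g^b_r = F^b_r := 2i sqrt(b - r); in
   general the small variation of U on short intervals keeps g^b - U near F^b
   while b - r is small.  The difference quotient of t |-> gamma_(t^2), divided
   by 2i, is the value at r = 0 of q_r = (g^b'_r - g^b_r) / (F^b'_r - F^b_r).
   The logarithmic derivative of q is
     2 / (F^b F^b') - 2 / ((g^b - U)(g^b' - U)),
   and near the tips its integral is bounded by the integral of r^(-1/2) against
   the variation of U, plus a scale-invariant term: hence q is uniformly close to
   1 there.  Away from the tips the logarithmic derivative depends continuously
   on (b, b'), hence two nearby pairs (b, b') have nearby q_0.  Thus the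
   difference quotients of t |-> gamma_(t^2) are Cauchy at every point of
   [0, sqrt T], which makes this curve continuously differentiable. *)

Require Import Defs.
From HB Require Import structures.
From mathcomp Require Import all_boot all_order all_algebra.
From mathcomp Require Import complex.
From mathcomp Require Import all_classical all_reals all_analysis.
From mathcomp Require Import measurable_realfun.
From mathcomp Require Import ring lra.

Import Order.TTheory GRing.Theory Num.Theory.
Import numFieldNormedType.Exports.
Local Open Scope classical_set_scope.
Local Open Scope ring_scope.
Local Open Scope complex_scope.

Set Implicit Arguments.
Unset Strict Implicit.
Unset Printing Implicit Defensive.

(* Real-valued modulus: the library's norm on R[i] takes its values in R[i]. *)
Notation nm := (@ComplexField.Normc.normc _).

(** The field 2 / (z - U) is singular at the tip, so Gronwall cannot reach it. A sign replaces it: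
    once the variation of U is small at the scale sqrt(b - r), Z = g - U stays in the cone |Re Z| <=
    Im Z; for Z and W in the cone, Re (- 2 / (Z W)) >= 0, and orbits contract in backward time. U is
    never differentiated: it enters through |dU| <= dv, with v its variation function, and integrals
    against dv become increments of nondecreasing potentials, compared by continuous induction.
    Dividing by F^b' - F^b makes the slope nearly 1 at r = b, and estimates are propagated backward
    from there. Away from the tips only a relative bound comes out, so the slopes must first be
    shown to be bounded near the given time. The trace is given topologically, not as a limit of
    inverse maps. It is identified with b |-> g^b_0 because that point is swallowed exactly at time
    b: it lies in H_r for r < b, but not in H_b. *)

Section modulus.
Context {R : realType}.
Implicit Types (z w : R[i]) (x : R).

Lemma nmE z : nm z = Num.sqrt (complex.Re z ^+ 2 + complex.Im z ^+ 2).
Proof. by case: z. Qed.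

Lemma nm_ge0 z : 0 <= nm z.
Proof. by rewrite nmE sqrtr_ge0. Qed.

Lemma sqr_nm z : nm z ^+ 2 = complex.Re z ^+ 2 + complex.Im z ^+ 2.
Proof. by rewrite nmE sqr_sqrtr // addr_ge0 // sqr_ge0. Qed.

Lemma nm_real x : nm x%:C = `|x|.
Proof. by rewrite nmE /= expr0n addr0 sqrtr_sqr. Qed.

Lemma nmM z w : nm (z * w) = nm z * nm w.
Proof. exact: ComplexField.Normc.normcM. Qed.

Lemma nmV z : nm z^-1 = (nm z)^-1.
Proof. exact: ComplexField.Normc.normcV. Qed.

Lemma nmf_div z w : nm (z / w) = nm z / nm w.
Proof. by rewrite nmM nmV. Qed.

Lemma nmX2 z : nm (z ^+ 2) = nm z ^+ 2.
Proof. by rewrite !expr2 nmM. Qed.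

Lemma nmD z w : nm (z + w) <= nm z + nm w.
Proof. exact: le_normcD. Qed.

Lemma nmN z : nm (- z) = nm z.
Proof. exact: normcN. Qed.

Lemma nmB z w : nm (z - w) <= nm z + nm w.
Proof. by rewrite -(nmN w) nmD. Qed.

Lemma nmC z w : nm (z - w) = nm (w - z).
Proof. by rewrite -nmN opprB. Qed.

Lemma nm_tri u z w : nm (z - w) <= nm (z - u) + nm (u - w).
Proof. by apply: le_trans (nmD _ _); rewrite addrA subrK. Qed.

Lemma nmB_ge z w : nm z - nm w <= nm (z - w).
Proof. by rewrite lerBlDr; apply: le_trans (nmD _ _); rewrite subrK. Qed.

Lemma nm_dist z w : `|nm z - nm w| <= nm (z - w).
Proof.
rewrite ler_norml; have := nmB_ge z w; have := nmB_ge w z; rewrite (nmC w).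
by move=> ? ?; apply/andP; split; lra.
Qed.

Lemma nm0 : nm (0 : R[i]) = 0.
Proof. exact: ComplexField.Normc.normc0. Qed.

Lemma nm1 : nm (1 : R[i]) = 1.
Proof. exact: ComplexField.Normc.normc1. Qed.

Lemma nm_nat n : nm (n%:R : R[i]) = n%:R.
Proof. by rewrite -(rmorph_nat (real_complex R)) nm_real ger0_norm. Qed.

Lemma nm_i : nm ('i : R[i]) = 1.
Proof. by rewrite nmE /= expr0n expr1n add0r sqrtr1. Qed.

Lemma nm_gt0 z : (0 < nm z) = (z != 0).
Proof.
rewrite lt_neqAle nm_ge0 andbT eq_sym; congr (~~ _).
by apply/eqP/eqP => [/ComplexField.Normc.eq0_normc//|->]; rewrite nm0.
Qed.

Lemma le_Re_nm z : `|complex.Re z| <= nm z.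
Proof.
by rewrite nmE -[leLHS]sqrtr_sqr ler_sqrt ?addr_ge0 ?sqr_ge0// lerDl sqr_ge0.
Qed.

Lemma le_Im_nm z : `|complex.Im z| <= nm z.
Proof.
by rewrite nmE -[leLHS]sqrtr_sqr ler_sqrt ?addr_ge0 ?sqr_ge0// lerDr sqr_ge0.
Qed.

Lemma nm_le_ReIm z : nm z <= `|complex.Re z| + `|complex.Im z|.
Proof.
have := sqr_nm z; have := nm_ge0 z.
rewrite -[complex.Re z ^+ 2]real_normK ?num_real //.
rewrite -[complex.Im z ^+ 2]real_normK ?num_real //.
have := normr_ge0 (complex.Re z); have := normr_ge0 (complex.Im z).
by move: (nm z) `|_| `|_| => a b c; nra.
Qed.

End modulus.

(** * Epsilon-delta calculus on an interval and one-sided mean value inequalities *)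

Section one_sided_calculus.
Context {R : realType}.
Implicit Types (a b x y e : R) (f g : R -> R[i]).

(* Continuous induction; only one-sided information on F is used, and Phi may
   be discontinuous. *)
Lemma local_le_increment a b (F Phi : R -> R) : a <= b ->
  (forall x, a < x <= b -> forall e, 0 < e -> exists2 d, 0 < d &
     forall y, a <= y < x -> x - d < y -> F x - F y <= e) ->
  (forall x y, a <= x -> x <= y -> y <= b -> Phi x <= Phi y) ->
  (forall x, a <= x < b -> forall e, 0 < e -> exists2 d, 0 < d &
     forall y, x < y < x + d -> y <= b ->
       F y - F x <= Phi y - Phi x + e * (y - x)) ->
  F b - F a <= Phi b - Phi a.
Proof.
move=> ab Fl ndPhi loc; apply/ler_addgt0Pr => e0 e0_gt0.
pose e := e0 / (b - a + 1).
have e_gt0 : 0 < e by apply: divr_gt0 => //; lra.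
have eab : e * (b - a) <= e0.
  by rewrite /e mulrAC ler_pdivrMr; nra.
pose S := [set x | a <= x <= b /\ F x - F a <= Phi x - Phi a + e * (x - a)].
have Sa : S a by rewrite /S /= lexx ab; split=> //; lra.
have ubS : ubound S b by move=> x [/andP[]].
have supS : has_sup S by split; [exists a | exists b].
have Sle x : S x -> x <= sup S by move=> Sx; exact: sup_upper_bound.
pose c := sup S.
have ac : a <= c by exact: Sle.
have cb : c <= b by apply: ge_sup => //; exists a.
(* The supremum belongs to [S] even if [Phi] jumps: [Phi] can only increase up to c, and F rises by
   at most e1 just to the left of c. *)
have Sc : S c.
  rewrite /S /= ac cb; split=> //.
  have [->|nac] := eqVneq c a; first by lra.
  have {nac}ac' : a < c by rewrite lt_neqAle eq_sym nac.
  apply/ler_addgt0Pr => e1 e1_gt0.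
  have [d d_gt0 Hd] := Fl c (introT andP (conj ac' cb)) e1 e1_gt0.
  have [y Sy yd] := sup_adherent d_gt0 supS.
  have := Sle _ Sy; rewrite le_eqVlt => /orP[/eqP yc|yc].
    by case: Sy; rewrite yc -/c => _; lra.
  case: Sy => /andP[ay yb] Hy.
  have := Hd y; rewrite ay yc yd => /(_ isT isT) H1.
  have := ndPhi y c ay (ltW yc) cb.
  have : e * (y - a) <= e * (c - a) by rewrite ler_pM2l // lerD2r ltW.
  lra.
move: cb; rewrite le_eqVlt => /orP[/eqP cb|cb].
  by case: Sc; rewrite cb => _; lra.
have [d d_gt0 Hd] := loc c (introT andP (conj ac cb)) e e_gt0.
pose y := Num.min (c + d / 2) b.
have cy : c < y by rewrite /y lt_min cb andbT; lra.
have yb : y <= b by rewrite /y ge_min lexx orbT.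
have ycd : y < c + d.
  by apply: (@le_lt_trans _ _ (c + d / 2)); [rewrite /y ge_min lexx|lra].
have Sy : S y.
  rewrite /S /= yb (le_trans ac (ltW cy)); split=> //.
  have := Hd y; rewrite cy ycd => /(_ isT yb).
  case: Sc => _; lra.
have := Sle _ Sy; rewrite -/c; lra.
Qed.

Definition cts a b f := forall x, a <= x <= b -> forall e, 0 < e ->
  exists2 d, 0 < d &
    forall y, a <= y <= b -> `|y - x| < d -> nm (f y - f x) <= e.

(** Multiplied out, so that y = x needs no exclusion; restricting y to [a, b] makes it one-sided at
    the end points. *)
Definition der a b f x (l : R[i]) := forall e, 0 < e -> exists2 d, 0 < d &
  forall y, a <= y <= b -> `|y - x| < d ->
    nm (f y - f x - (y - x)%:C * l) <= e * `|y - x|.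

(** A right derivative is all that continuous induction consumes. It carries no interval, so orbits
    with different end times can be combined. *)
Definition rder f x (l : R[i]) := forall e, 0 < e -> exists2 d, 0 < d &
  forall y, x < y < x + d -> nm (f y - f x - (y - x)%:C * l) <= e * (y - x).

(* Right logarithmic derivative, also meaningful where f vanishes. *)
Definition logder f x k := rder f x (k * f x).

Lemma cts_sub a b a' b' f : a <= a' -> b' <= b -> cts a b f -> cts a' b' f.
Proof.
move=> aa bb cf x /andP[ax xb] e e0.
have [|d d0 Hd] := cf x _ e e0; first by rewrite (le_trans aa) // (le_trans xb).
by exists d => // y /andP[ay yb]; apply: Hd; rewrite (le_trans aa) // (le_trans yb).
Qed.

Lemma der_eq a b f g x l : (forall y, a <= y <= b -> f y = g y) ->
  a <= x <= b -> der a b f x l -> der a b g x l.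
Proof.
move=> fg xab df e e0; have [d d0 Hd] := df e e0.
by exists d => // y yab; rewrite -!fg //; exact: Hd.
Qed.

Lemma der_cts_at a b f x l : der a b f x l -> forall e, 0 < e ->
  exists2 d, 0 < d &
    forall y, a <= y <= b -> `|y - x| < d -> nm (f y - f x) <= e.
Proof.
move=> df e e0; have [d d0 Hd] := df 1 ltr01.
have N0 := nm_ge0 l.
exists (Num.min d (e / (1 + nm l))).
  by rewrite lt_min d0 /= divr_gt0 //; lra.
move=> y yab; rewrite lt_min => /andP[yd ye].
have := Hd y yab yd; rewrite mul1r => H.
have -> : f y - f x = (f y - f x - (y - x)%:C * l) + (y - x)%:C * l by ring.
apply: le_trans (nmD _ _) _; rewrite nmM nm_real.
move: ye; rewrite ltr_pdivlMr; last lra.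
by nra.
Qed.

Lemma der_cts a b f (l : R -> R[i]) :
  (forall x, a <= x <= b -> der a b f x (l x)) -> cts a b f.
Proof. by move=> df x /df/der_cts_at. Qed.

(** Continuous induction applied to x |-> nm (f x - f a); the triangle inequality moves the base
    point from a to x. *)
Lemma nm_le_increment a b f (Phi : R -> R) : a <= b -> cts a b f ->
  (forall x y, a <= x -> x <= y -> y <= b -> Phi x <= Phi y) ->
  (forall x, a <= x < b -> forall e, 0 < e -> exists2 d, 0 < d &
     forall y, x < y < x + d -> y <= b ->
       nm (f y - f x) <= Phi y - Phi x + e * (y - x)) ->
  nm (f b - f a) <= Phi b - Phi a.
Proof.
move=> ab cf ndPhi loc.
have := @local_le_increment a b (fun x => nm (f x - f a)) Phi ab.
rewrite subrr nm0 subr0; apply=> //.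
- move=> x /andP[ax xb] e e0.
  have [|d d0 Hd] := cf x _ e e0; first by rewrite (ltW ax).
  exists d => // y /andP[ay yx] xdy.
  have := Hd y; rewrite ay (le_trans (ltW yx)) // => /(_ isT).
  rewrite nmC ltr0_norm ?subr_lt0 // opprB => /(_ _).
  have := nm_tri (f y) (f x) (f a); have : x - y < d by lra.
  by move=> h1 h2 /(_ h1); lra.
- move=> x xab e e0; have [d d0 Hd] := loc x xab e e0.
  exists d => // y yx yb; have := Hd y yx yb.
  by have := nm_tri (f x) (f y) (f a); lra.
Qed.

Lemma cts_within_nm a b f : cts a b f ->
  {within `[a, b], continuous (fun x => nm (f x))}.
Proof.
move=> cf; apply/subspace_continuousP => x /=; rewrite in_itv /= => xab.
apply/cvgrPdist_le => e e0; have [d d0 Hd] := cf x xab e e0.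
exists d => //= y; rewrite /ball /= distrC in_itv /= => yd yab.
by apply: le_trans (nm_dist _ _) _; rewrite nmC; exact: Hd.
Qed.

Lemma cts_nm_max a b f : a <= b -> cts a b f ->
  exists2 c, a <= c <= b & forall x, a <= x <= b -> nm (f x) <= nm (f c).
Proof.
move=> ab /cts_within_nm /(EVT_max ab)[c]; rewrite in_itv /= => cab Hc.
by exists c.
Qed.

Lemma cts_nm_min a b f : a <= b -> cts a b f ->
  exists2 c, a <= c <= b & forall x, a <= x <= b -> nm (f c) <= nm (f x).
Proof.
move=> ab /cts_within_nm /(EVT_min ab)[c]; rewrite in_itv /= => cab Hc.
by exists c.
Qed.

End one_sided_calculus.

(** * Growth of a function from its right logarithmic derivative *)

Section logarithmic_derivative.
Context {R : realType}.
Implicit Types (a b x y e : R) (f g : R -> R[i]) (k l : R[i]).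

Lemma der_rder a b f x l : a <= x < b -> der a b f x l -> rder f x l.
Proof.
move=> /andP[ax xb] df e e0; have [d d0 Hd] := df e e0.
exists (Num.min d (b - x)); first by rewrite lt_min d0; lra.
move=> y /andP[xy]; rewrite -ltrBlDl lt_min => /andP[yd yb].
rewrite -[X in e * X]gtr0_norm ?subr_gt0 //; apply: Hd.
  by apply/andP; split; lra.
by rewrite gtr0_norm ?subr_gt0.
Qed.

Lemma rderB f g x k l : rder f x k -> rder g x l ->
  rder (fun y => f y - g y) x (k - l).
Proof.
move=> df dg e e0; have e2 : 0 < e / 2 by lra.
have [d d0 Hd] := df _ e2; have [d' d'0 Hd'] := dg _ e2.
exists (Num.min d d'); first by rewrite lt_min d0.
move=> y /andP[xy]; rewrite -ltrBlDl lt_min => /andP[yd yd'].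
have := Hd y; rewrite xy -ltrBlDl => /(_ yd).
have := Hd' y; rewrite xy -ltrBlDl => /(_ yd').
have -> : f y - g y - (f x - g x) - (y - x)%:C * (k - l) =
  (f y - f x - (y - x)%:C * k) - (g y - g x - (y - x)%:C * l) by ring.
move=> h1 h2; apply: le_trans (nmB _ _) _; lra.
Qed.

Lemma logderM f g x k l : logder f x k -> logder g x l ->
  logder (fun y => f y * g y) x (k + l).
Proof.
move=> df dg e e0.
have := nm_ge0 (f x); have := nm_ge0 (g x); have := nm_ge0 k; have := nm_ge0 l.
set Fx := nm (f x); set Gx := nm (g x); set K := nm k; set L := nm l.
move=> L0 K0 G0 F0.
(* [M] dominates the coefficients of the four error terms below; each of them is at most e1 M h,
   hence the factor 4 in [e1]. *)
pose M := (1 + Fx) * (1 + Gx) * ((1 + K) * (1 + L)).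
have M1 : 1 <= M.
  rewrite -(mulr1 1) ler_pM //; last by nra.
  by nra.
pose e1 := Num.min 1 (e / (4 * M)).
have e10 : 0 < e1 by rewrite lt_min ltr01 divr_gt0 //; lra.
have e11 : e1 <= 1 by rewrite ge_min lexx.
have e1M : e1 * M * 4 <= e.
  have : e1 <= e / (4 * M) by rewrite ge_min lexx orbT.
  by rewrite ler_pdivlMr; lra.
clearbody e1.
have [d d0 Hd] := df _ e10; have [d' d'0 Hd'] := dg _ e10.
exists (Num.min e1 (Num.min d d')); first by rewrite !lt_min e10 d0.
move=> y /andP[xy]; rewrite -ltrBlDl !lt_min => /and3P[ye yd yd'].
have := Hd y; rewrite xy -ltrBlDl => /(_ yd).
have := Hd' y; rewrite xy -ltrBlDl => /(_ yd').
have h0 : 0 < y - x by rewrite subr_gt0.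
move: ye h0; set h := y - x => he h0.
set A := f y - _ - _; set B := g y - _ - _ => HB HA.
have -> : f y * g y - f x * g x - h%:C * ((k + l) * (f x * g x)) =
  h%:C * h%:C * (k * l) * (f x * g x) + A * g x * (1 + h%:C * l) +
  (f x * (1 + h%:C * k) * B + A * B) by rewrite /A /B; ring.
have HK : nm (1 + h%:C * k) <= 1 + K.
  apply: le_trans (nmD _ _) _; rewrite nm1 nmM nm_real (gtr0_norm h0) -/K lerD2l ler_piMl //; lra.
have HL : nm (1 + h%:C * l) <= 1 + L.
  apply: le_trans (nmD _ _) _; rewrite nm1 nmM nm_real (gtr0_norm h0) -/L lerD2l ler_piMl //; lra.
have FG : Fx * Gx <= (1 + Fx) * (1 + Gx) by nra.
have KL : K * L <= (1 + K) * (1 + L) by nra.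
have FG0 : 0 <= Fx * Gx by exact: mulr_ge0.
have KL0 : 0 <= K * L by exact: mulr_ge0.
have A0 := nm_ge0 A; have B0 := nm_ge0 B.
apply: le_trans (nmD _ _) _; apply: (@le_trans _ _ (2 * (e1 * M * h) + 2 * (e1 * M * h))).
  apply: lerD; apply: le_trans (nmD _ _) _; rewrite mulr_natl mulr2n;
    apply: lerD.
  - rewrite !nmM nm_real gtr0_norm // -/Fx -/Gx -/K -/L.
    have -> : h * h * (K * L) * (Fx * Gx) = h * (K * L * (Fx * Gx)) * h by ring.
    rewrite ler_pM2r //; apply: ler_pM => //; [exact: ltW|by rewrite !mulr_ge0| exact: ltW|].
    by rewrite /M [leRHS]mulrC ler_pM.
  - rewrite !nmM -/Gx; apply: (@le_trans _ _ ((e1 * h) * (Gx * (1 + L)))).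
      by rewrite -mulrA; apply: ler_pM => //; rewrite ?mulr_ge0 ?nm_ge0 //; apply: ler_pM; rewrite ?nm_ge0.
    rewrite [leRHS]mulrAC ler_pM2l ?mulr_gt0 //.
    by rewrite /M; apply: ler_pM; rewrite ?addr_ge0 //; nra.
  - rewrite !nmM -/Fx; apply: (@le_trans _ _ ((Fx * (1 + K)) * (e1 * h))).
      by apply: ler_pM => //; rewrite ?mulr_ge0 ?nm_ge0 //; apply: ler_pM; rewrite ?nm_ge0.
    rewrite mulrC [leRHS]mulrAC ler_pM2l ?mulr_gt0 //.
    by rewrite /M; apply: ler_pM; rewrite ?addr_ge0 ?mulr_ge0 //; nra.
  - rewrite nmM; apply: (@le_trans _ _ ((e1 * h) * (e1 * h))); first exact: ler_pM.
    rewrite [leRHS]mulrAC ler_pM2l ?mulr_gt0 //.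
    apply: le_trans M1; nra.
by have := ltW h0; nra.
Qed.

Lemma logderV f x k : f x != 0 -> logder f x k ->
  logder (fun y => (f y)^-1) x (- k).
Proof.
move=> fx0 df e e0.
have := nm_ge0 k; have : 0 < nm (f x) by rewrite nm_gt0.
set Fx := nm (f x); set K := nm k => F0 K0.
pose M := 1 + Fx * K + K + Fx * K ^+ 2.
have M1 : 1 <= M.
  by rewrite /M -!addrA lerDl !addr_ge0 // ?mulr_ge0 ?sqr_ge0 // ltW.
(* The bound Fx / (2 M) keeps nm (f y) >= Fx / 2. Over that denominator the numerator, at most 3 e1
   M h, asks for the factor 6. *)
pose e1 := Num.min (Num.min 1 (Fx / (2 * M))) (e * Fx ^+ 2 / (6 * M)).
have e10 : 0 < e1.
  rewrite !lt_min ltr01 /= !divr_gt0 ?mulr_gt0 ?exprn_gt0 //; lra.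
have e11 : e1 <= 1 by rewrite !ge_min lexx.
have e1F : e1 * (2 * M) <= Fx.
  have : e1 <= Fx / (2 * M) by rewrite !ge_min lexx orbT.
  by rewrite ler_pdivlMr; lra.
have e1M : e1 * (6 * M) <= e * Fx ^+ 2.
  have : e1 <= e * Fx ^+ 2 / (6 * M) by rewrite !ge_min lexx orbT.
  by rewrite ler_pdivlMr; lra.
clearbody e1; have [d d0 Hd] := df _ e10.
exists (Num.min e1 d); first by rewrite lt_min e10.
move=> y /andP[xy]; rewrite -ltrBlDl !lt_min => /andP[ye yd].
have := Hd y; rewrite xy -ltrBlDl => /(_ yd).
have h0 : 0 < y - x by rewrite subr_gt0.
move: ye h0; set h := y - x => he h0.
set A := f y - _ - _ => HA; have A0 := nm_ge0 A.
have fyE : f y = f x + h%:C * (k * f x) + A by rewrite /A; ring.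
have hh : h * h <= e1 * h by rewrite ler_pM2r // ltW.
have fy_ge : Fx / 2 <= nm (f y).
  have : nm (f x) - nm (f x - f y) <= nm (f y).
    by have := nm_tri (f y) (f x) 0; rewrite !subr0; lra.
  have -> : f x - f y = - (h%:C * (k * f x) + A) by rewrite fyE; ring.
  rewrite nmN => H; apply: le_trans H; rewrite lerBrDr -lerBrDl.
  apply: le_trans (nmD _ _) _; rewrite !nmM nm_real gtr0_norm // -/Fx -/K.
  have : h * (K * Fx) <= e1 * (Fx * K).
    by rewrite (mulrC K) ler_wpM2r ?mulr_ge0 // ltW.
  have : e1 * h <= e1 * 1 by rewrite ler_pM2l //; lra.
  have : e1 * (1 + Fx * K) <= e1 * M.
    by rewrite ler_pM2l // /M -addrA lerDl addr_ge0 // mulr_ge0 ?sqr_ge0 // ltW.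
  lra.
have fy0 : f y != 0 by rewrite -nm_gt0; apply: lt_le_trans fy_ge; lra.
have -> : (f y)^-1 - (f x)^-1 - h%:C * (- k * (f x)^-1) =
  (h%:C * h%:C * (k ^+ 2 * f x) + h%:C * k * A - A) / (f x * f y).
  have -> : A = f y - f x - h%:C * (k * f x) by rewrite fyE; ring.
  by field; rewrite fx0 fy0.
rewrite nmf_div ler_pdivrMr; last by rewrite nm_gt0 mulf_neq0.
rewrite nmM -/Fx; apply: (@le_trans _ _ (e * h * (Fx * (Fx / 2)))); last first.
  by rewrite ler_wpM2l ?mulr_ge0 ?(ltW e0) ?(ltW h0) // ler_wpM2l // ltW.
apply: (@le_trans _ _ (3 * (e1 * M * h))); last first.
  by have := ler_wpM2r (ltW h0) e1M; lra.
apply: le_trans (nmB _ _) _; apply: (@le_trans _ _ (e1 * h * (Fx * K ^+ 2) + e1 * h * K + e1 * h)).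
  apply: lerD => //; apply: le_trans (nmD _ _) _; apply: lerD.
    rewrite !nmM nm_real gtr0_norm // -/Fx -/K -expr2 (mulrC Fx).
    by rewrite ler_wpM2r ?mulr_ge0 ?sqr_ge0 // ltW.
  rewrite !nmM nm_real gtr0_norm // -/K mulrAC ler_wpM2r //.
  apply: (@le_trans _ _ (h * (e1 * h))); first by rewrite ler_pM2l.
  by rewrite -[leRHS]mul1r ler_wpM2r ?mulr_ge0 ?ltW // (lt_le_trans he).
have -> : e1 * h * (Fx * K ^+ 2) + e1 * h * K + e1 * h = e1 * h * (Fx * K ^+ 2 + K + 1) by ring.
have FK : 0 <= Fx * K by rewrite mulr_ge0 // ltW.
have -> : 3 * (e1 * M * h) = e1 * h * (3 * M) by ring.
rewrite ler_pM2l ?mulr_gt0 // /M.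
have := mulr_ge0 (ltW F0) (sqr_ge0 K); lra.
Qed.

(** Gronwall: exp(- K x) nm (f x) does not increase, because 1 + h K <= exp(h K). *)
Lemma logder_bound a b f (k : R -> R[i]) K : a <= b -> 0 <= K -> cts a b f ->
  (forall x, a <= x < b -> logder f x (k x) /\ nm (k x) <= K) ->
  nm (f b) <= expR (K * (b - a)) * nm (f a).
Proof.
move=> ab K0 cf dk.
suff : expR (- (K * b)) * nm (f b) - expR (- (K * a)) * nm (f a) <= 0 - 0.
  rewrite subrr subr_le0 !expRN mulrC ler_pdivrMr ?expR_gt0 // mulrAC.
  by rewrite [X in _ <= X * _]mulrC -expRN -expRD mulrBr (addrC (K * b)).
apply: (@local_le_increment _ a b (fun x => expR (- (K * x)) * nm (f x))
  (fun=> 0)) => //.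
- move=> x /andP[ax xb] e e0.
  pose E := expR (- (K * a)).
  have E0 : 0 < E by exact: expR_gt0.
  have [c cab Hc] := cts_nm_max ab cf.
  have [|d d0 Hd] := cf x _ (e / E) (divr_gt0 e0 E0); first by rewrite (ltW ax).
  exists d => // y /andP[ay yx] xdy.
  have ey : expR (- (K * y)) <= E by rewrite ler_expR lerN2 ler_wpM2l.
  have exy : expR (- (K * x)) <= expR (- (K * y)) by rewrite ler_expR lerN2 ler_wpM2l // ltW.
  have := Hd y; rewrite ay (le_trans (ltW yx)) // distrC gtr0_norm ?subr_gt0 //.
  move=> /(_ isT); have xyd : x - y < d by lra.
  move=> /(_ xyd) Hxy.
  apply: (@le_trans _ _ (expR (- (K * y)) * (nm (f x) - nm (f y)))).
    by rewrite mulrBr lerD2r ler_wpM2r ?nm_ge0.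
  apply: (@le_trans _ _ (expR (- (K * y)) * (e / E))).
    by rewrite ler_wpM2l ?expR_ge0 // (le_trans (nmB_ge _ _)) // nmC.
  rewrite mulrCA -[leRHS]mulr1 ler_pM2l // ler_pdivrMr // mul1r //.
- move=> x /andP[ax xb] e e0; have [|dx kx] := dk x; first by rewrite ax.
  pose E := expR (- (K * a)).
  have E0 : 0 < E by exact: expR_gt0.
  have [d d0 Hd] := dx (e / E) (divr_gt0 e0 E0).
  exists d => // y xyd yb; have /andP[xy yd] := xyd.
  have ey : expR (- (K * y)) <= E by rewrite ler_expR lerN2 ler_wpM2l // (le_trans ax) // ltW.
  have h0 : 0 < y - x by rewrite subr_gt0.
  have := Hd y xyd => H.
  have fy : nm (f y) <= (1 + (y - x) * K) * nm (f x) + e / E * (y - x).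
    have -> : f y = (f y - f x - (y - x)%:C * (k x * f x)) + (1 + (y - x)%:C * k x) * f x by ring.
    apply: le_trans (nmD _ _) _; rewrite addrC lerD // nmM ler_wpM2r ?nm_ge0 //.
    apply: le_trans (nmD _ _) _; rewrite nm1 nmM nm_real gtr0_norm //.
    by rewrite lerD2l ler_pM2l.
  rewrite subrr add0r.
  have e1 : expR (- (K * y)) * (1 + (y - x) * K) <= expR (- (K * x)).
    have -> : - (K * x) = - (K * y) + (y - x) * K by ring.
    by rewrite expRD ler_wpM2l ?expR_ge0 // expR_ge1Dx.
  apply: (@le_trans _ _ (expR (- (K * y)) * (e / E * (y - x)))).
    have := ler_wpM2l (expR_ge0 (- (K * y))) fy.
    have := ler_wpM2r (nm_ge0 (f x)) e1; lra.
  rewrite mulrA ler_pM2r // mulrCA -[leRHS]mulr1 ler_pM2l // ler_pdivrMr // mul1r //.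
Qed.

(** Gronwall in backward time: exp(2 K x) nm (f x) does not decrease. The factor 2 comes from the
    right derivative, which only gives 1 - h K, and 1 <= (1 + 2 u) (1 - u) for 0 <= u <= 1/2. *)
Lemma logder_bound_rev a b f (k : R -> R[i]) K : a <= b -> 0 < K -> cts a b f ->
  (forall x, a <= x < b -> logder f x (k x) /\ nm (k x) <= K) ->
  nm (f a) <= expR (2 * K * (b - a)) * nm (f b).
Proof.
move=> ab K0 cf dk.
suff : - (expR (2 * K * b) * nm (f b)) - - (expR (2 * K * a) * nm (f a)) <= 0 - 0.
  rewrite subrr opprK addrC subr_le0 => H.
  have -> : 2 * K * (b - a) = 2 * K * b - 2 * K * a by ring.
  by rewrite expRD expRN mulrAC ler_pdivlMr ?expR_gt0 // mulrC.
apply: (@local_le_increment _ a b (fun x => - (expR (2 * K * x) * nm (f x)))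
  (fun=> 0)) => //.
- move=> x /andP[ax xb] e e0.
  pose E := expR (2 * K * b).
  have E0 : 0 < E by exact: expR_gt0.
  have [|d d0 Hd] := cf x _ (e / E) (divr_gt0 e0 E0); first by rewrite (ltW ax).
  exists d => // y /andP[ay yx] xdy.
  have yb : y <= b by rewrite (le_trans (ltW yx)).
  have ey : expR (2 * K * y) <= E by rewrite ler_expR ler_wpM2l // mulr_ge0 // ltW.
  have exy : expR (2 * K * y) <= expR (2 * K * x).
    by rewrite ler_expR ler_wpM2l ?(ltW yx) // mulr_ge0 // ltW.
  have := Hd y; rewrite ay yb distrC gtr0_norm ?subr_gt0 //.
  move=> /(_ isT); have xyd : x - y < d by lra.
  move=> /(_ xyd) Hxy.
  apply: (@le_trans _ _ (expR (2 * K * y) * (nm (f y) - nm (f x)))).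
    rewrite mulrBr opprK addrC lerD2l lerN2 ler_wpM2r ?nm_ge0 //.
  apply: (@le_trans _ _ (expR (2 * K * y) * (e / E))).
    by rewrite ler_wpM2l ?expR_ge0 // (le_trans (nmB_ge _ _)).
  rewrite mulrCA -[leRHS]mulr1 ler_pM2l // ler_pdivrMr // mul1r //.
- move=> x /andP[ax xb] e e0; have [|dx kx] := dk x; first by rewrite ax.
  pose E := expR (2 * K * b).
  have E0 : 0 < E by exact: expR_gt0.
  have [d d0 Hd] := dx (e / E) (divr_gt0 e0 E0).
  exists (Num.min d (2 * K)^-1); first by rewrite lt_min d0 /= invr_gt0 mulr_gt0.
  move=> y /andP[xy]; rewrite -ltrBlDl lt_min => /andP[yd yK] yb.
  have ey : expR (2 * K * y) <= E by rewrite ler_expR ler_wpM2l // mulr_ge0 // ltW.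
  have h0 : 0 < y - x by rewrite subr_gt0.
  have Kh : (y - x) * K <= 1 / 2.
    by move: yK; rewrite -[ltRHS]mul1r ltr_pdivlMr ?mulr_gt0 //; lra.
  have := Hd y; rewrite xy -ltrBlDl => /(_ yd) H.
  have fy : (1 - (y - x) * K) * nm (f x) - e / E * (y - x) <= nm (f y).
    have : nm (f x) - nm ((y - x)%:C * (k x * f x)) - nm (f y - f x - (y - x)%:C * (k x * f x)) <= nm (f y).
      rewrite lerBlDr lerBlDr.
      have {1}-> : f x = f y - (f y - f x - (y - x)%:C * (k x * f x)) - (y - x)%:C * (k x * f x) by ring.
      by apply: le_trans (nmB _ _) _; rewrite lerD2r nmB.
    rewrite !nmM nm_real gtr0_norm //.
    have : (y - x) * (nm (k x) * nm (f x)) <= (y - x) * (K * nm (f x)).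
      by rewrite ler_pM2l // ler_wpM2r // nm_ge0.
    lra.
  rewrite subrr add0r.
  have e1 : expR (2 * K * x) <= expR (2 * K * y) * (1 - (y - x) * K).
    have -> : 2 * K * y = 2 * K * x + 2 * ((y - x) * K) by ring.
    rewrite expRD -[leRHS]mulrA ler_peMr ?expR_ge0 //.
    have := expR_ge1Dx (2 * ((y - x) * K)).
    have : 0 <= (y - x) * K by rewrite mulr_ge0 // ltW.
    move: ((y - x) * K) Kh (expR _) => u u2 E' u0 HE.
    apply: (@le_trans _ _ ((1 + 2 * u) * (1 - u))); first by nra.
    by rewrite ler_wpM2r //; lra.
  apply: (@le_trans _ _ (expR (2 * K * y) * (e / E * (y - x)))).
    have := ler_wpM2l (expR_ge0 (2 * K * y)) fy.
    have := ler_wpM2r (nm_ge0 (f x)) e1; lra.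
  rewrite mulrA ler_pM2r // mulrCA -[leRHS]mulr1 ler_pM2l // ler_pdivrMr // mul1r //.
Qed.

(** |1 + h k| >= 1 + h Re k >= 1. No bound on the size of k is involved, which is what makes this
    usable up to a singularity. *)
Lemma logder_Re_ge0_nondecreasing a b f (k : R -> R[i]) : a <= b -> cts a b f ->
  (forall x, a <= x < b -> logder f x (k x) /\ 0 <= complex.Re (k x)) ->
  nm (f a) <= nm (f b).
Proof.
move=> ab cf dk.
suff : - nm (f b) - - nm (f a) <= 0 - 0 by lra.
apply: (@local_le_increment _ a b (fun x => - nm (f x)) (fun=> 0)) => //.
- move=> x /andP[ax xb] e e0.
  have [|d d0 Hd] := cf x _ e e0; first by rewrite (ltW ax).
  exists d => // y /andP[ay yx] xdy.
  have := Hd y; rewrite ay (le_trans (ltW yx)) // distrC gtr0_norm ?subr_gt0 //.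
  move=> /(_ isT); have xyd : x - y < d by lra.
  move=> /(_ xyd); have := nmB_ge (f y) (f x); lra.
- move=> x /andP[ax xb] e e0; have [|dx kx] := dk x; first by rewrite ax.
  have [d d0 Hd] := dx e e0; exists d => // y xyd yb; have /andP[xy yd] := xyd.
  have h0 : 0 < y - x by rewrite subr_gt0.
  have := Hd y xyd.
  have : nm (f x) <= nm (f x + (y - x)%:C * (k x * f x)).
    have -> : f x + (y - x)%:C * (k x * f x) = (1 + (y - x)%:C * k x) * f x by ring.
    rewrite nmM ler_peMl ?nm_ge0 //; apply: le_trans (le_Re_nm _).
    apply: le_trans (ler_norm _); case: (k x) kx => u v /= u0.
    by rewrite mul0r subr0 lerDl mulr_ge0 // ltW.
  have := nmB_ge (f x + (y - x)%:C * (k x * f x)) (f y).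
  rewrite [nm (_ - f y)]nmC opprD addrA; lra.
Qed.

(** [Phi] stands for a primitive of [kappa], which may blow up at b. If N is the maximum of nm f,
    then nm (f b - f x) <= N theta, and theta <= 1/2 turns this into N <= 2 nm (f b). The result
    refers to f b, since slopes are known at the end b. *)
Lemma logder_variation a b f (k : R -> R[i]) (kappa Phi : R -> R) theta :
  a <= b -> cts a b f ->
  (forall x, a <= x < b -> logder f x (k x) /\ nm (k x) <= kappa x) ->
  (forall x y, a <= x -> x <= y -> y <= b -> Phi x <= Phi y) ->
  (forall x, a <= x < b -> forall e, 0 < e -> exists2 d, 0 < d &
     forall y, x < y < x + d -> y <= b ->
       (kappa x - e) * (y - x) <= Phi y - Phi x) ->
  Phi b - Phi a <= theta -> theta <= 1 / 2 ->
  nm (f a - f b) <= 2 * theta * nm (f b).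
Proof.
move=> ab cf dk ndPhi loc thetaP theta2.
have [c /andP[ac cb] Hc] := cts_nm_max ab cf.
set N := nm (f c) in Hc.
have N0 : 0 <= N by exact: nm_ge0.
have main x : a <= x -> x <= b -> nm (f b - f x) <= N * theta.
  move=> ax xb; apply: (@le_trans _ _ (N * Phi b - N * Phi x)); last first.
    rewrite -mulrBr ler_wpM2l //; apply: le_trans thetaP.
    by rewrite lerD2l lerN2; exact: ndPhi.
  apply: (@nm_le_increment _ x b f (fun y => N * Phi y)) => //.
  - exact: cts_sub cf.
  - by move=> y z xy yz zb; rewrite ler_wpM2l // ndPhi // (le_trans ax).
  move=> y /andP[xy yb] e e0.
  have ay : a <= y < b by rewrite (le_trans ax).
  have [dy ky] := dk y ay.
  have N1 : 0 < N + 1 by lra.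
  have e2 : 0 < e / 2 by lra.
  have [d d0 Hd] := dy _ e2.
  have [d' d'0 Hd'] := loc y ay (e / (2 * (N + 1))) (divr_gt0 e0 (mulr_gt0 (ltr0Sn _ _) N1)).
  exists (Num.min d d'); first by rewrite lt_min d0.
  move=> z /andP[yz]; rewrite -ltrBlDl lt_min => /andP[zd zd'] zb.
  have h0 : 0 < z - y by rewrite subr_gt0.
  have := Hd z; rewrite yz -ltrBlDl => /(_ zd) H1.
  have := Hd' z; rewrite yz -ltrBlDl => /(_ zd' zb) H2.
  have -> : f z - f y = (f z - f y - (z - y)%:C * (k y * f y)) + (z - y)%:C * (k y * f y) by ring.
  apply: le_trans (nmD _ _) _; rewrite !nmM nm_real gtr0_norm //.
  have fyN : nm (f y) <= N by apply: Hc; rewrite (le_trans ax) // ltW.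
  have : (z - y) * (nm (k y) * nm (f y)) <= (z - y) * (kappa y * N).
    by rewrite ler_pM2l // ler_pM // nm_ge0.
  have := ler_wpM2l N0 H2.
  have : N * (e / (2 * (N + 1)) * (z - y)) <= e / 2 * (z - y).
    rewrite mulrA ler_pM2r // mulrA ler_pdivrMr ?mulr_gt0 //; nra.
  lra.
have Nb : N <= 2 * nm (f b).
  have := main c ac cb; have := nmB_ge (f c) (f b); rewrite nmC -/N.
  have : N * theta <= N * (1 / 2) by rewrite ler_wpM2l.
  lra.
rewrite nmC; apply: le_trans (main a (lexx _) ab) _.
have theta0 : 0 <= theta by apply: le_trans thetaP; rewrite subr_ge0 ndPhi.
by have := ler_wpM2r theta0 Nb; lra.
Qed.

End logarithmic_derivative.

(** * Orbits of the Loewner equation: comparison, height and the square of g - U *)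

Section flow.
Context {R : realType}.
Implicit Types (b x y r c e : R) (f g : R -> R[i]).

(** The equation is required only before b: the orbit of a tip reaches the real line at time b,
    where the field is singular, but remains continuous there. *)
Definition rflow (U : R -> R) b g := cts 0 b g /\
  forall x, 0 <= x < b -> 0 < complex.Im (g x) /\
    rder g x (2 / (g x - (U x)%:C)).

Section driver.
Variables (U : R -> R).

Lemma rflow_sub b b' g : b' <= b -> rflow U b g -> rflow U b' g.
Proof.
move=> bb [cg dg]; split; first exact: cts_sub cg.
by move=> x /andP[x0 xb]; apply: dg; rewrite x0 (lt_le_trans xb).
Qed.

Lemma ImB_real (z : R[i]) x : complex.Im (z - x%:C) = complex.Im z.
Proof. by case: z => u w /=; rewrite subr0. Qed.

Lemma Im_gt0_neq0 (z : R[i]) : 0 < complex.Im z -> z != 0.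
Proof. by apply: contraTneq => ->; rewrite ltxx. Qed.

Lemma rflow_neq0 b g x : rflow U b g -> 0 <= x < b -> g x - (U x)%:C != 0.
Proof. by move=> [_ dg] /dg[Y0 _]; apply: Im_gt0_neq0; rewrite ImB_real. Qed.

Lemma Im_le_nmB (z : R[i]) x : complex.Im z <= nm (z - x%:C).
Proof. by apply: le_trans (le_Im_nm _); rewrite ImB_real ler_norm. Qed.

(** The driver cancels in the difference: 2 / A - 2 / B = - 2 (A - B) / (A B) with A = f - U and B =
    g - U. *)
Lemma rflow_logderB b f g x : rflow U b f -> rflow U b g -> 0 <= x < b ->
  logder (fun y => f y - g y) x
    (- 2 / ((f x - (U x)%:C) * (g x - (U x)%:C))).
Proof.
move=> Ff Fg xb; have f0 := rflow_neq0 Ff xb; have g0 := rflow_neq0 Fg xb.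
rewrite /logder; have [_ df] := Ff.2 x xb; have [_ dg] := Fg.2 x xb.
have := rderB df dg; congr rder; by field; rewrite f0 g0.
Qed.

Lemma ctsB a b f g : cts a b f -> cts a b g -> cts a b (fun y => f y - g y).
Proof.
move=> cf cg x xab e e0; have e2 : 0 < e / 2 by lra.
have [d d0 Hd] := cf x xab _ e2; have [d' d'0 Hd'] := cg x xab _ e2.
exists (Num.min d d'); first by rewrite lt_min d0.
move=> y yab; rewrite lt_min => /andP[yd yd'].
have -> : f y - g y - (f x - g x) = (f y - f x) - (g y - g x) by ring.
apply: le_trans (nmB _ _) _.
have := Hd y yab yd; have := Hd' y yab yd'; lra.
Qed.

(** Im (2 / Z) = - 2 Im Z / |Z|^2. A lower bound for the height at one time thus holds at all
    earlier times. *)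
Lemma rflow_Im_nonincreasing b g r s : rflow U b g -> 0 <= r -> r <= s ->
  s <= b -> complex.Im (g s) <= complex.Im (g r).
Proof.
move=> [cg dg] r0 rs sb.
have cg' : cts r s g by exact: cts_sub cg.
suff : complex.Im (g s) - complex.Im (g r) <= 0 - 0 by lra.
apply: (@local_le_increment _ r s (fun x => complex.Im (g x)) (fun=> 0)) => //.
- move=> x /andP[rx xs] e e0.
  have [|d d0 Hd] := cg' x _ e e0; first by rewrite (ltW rx).
  exists d => // y /andP[ry yx] xdy.
  have := Hd y; rewrite ry (le_trans (ltW yx)) // distrC gtr0_norm ?subr_gt0 //.
  move=> /(_ isT); have xyd : x - y < d by lra.
  move=> /(_ xyd); have := le_Im_nm (g y - g x).
  by case: (g x) (g y) => ? ? [? ?] /=; rewrite ler_norml => /andP[]; lra.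
- move=> x /andP[rx xs] e e0.
  have [|Y0 dx] := dg x; first by rewrite (le_trans r0) // (lt_le_trans xs).
  have [d d0 Hd] := dx e e0; exists d => // y xyd yb; have /andP[xy yd] := xyd.
  have h0 : 0 < y - x by rewrite subr_gt0.
  have := Hd y xyd; have := le_Im_nm (g y - g x - (y - x)%:C * (2 / (g x - (U x)%:C))).
  have : complex.Im (2 / (g x - (U x)%:C)) <= 0.
    move: Y0; case: (g x) => u w /= w0.
    rewrite !subr0 addr0 mul0r addr0 pmulr_rle0 ?addr_gt0 //.
    by rewrite oppr_le0 divr_ge0 ?addr_ge0 ?sqr_ge0 // ltW.
  case: (2 / _) => a1 a2 /= a20.
  have := ler_wpM2l (ltW h0) a20; rewrite mulr0.
  move: (nm _) => N; case: (g x) (g y) => ? ? [? ?] /=.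
  by rewrite ler_norml mul0r addr0 => ? /andP[]; lra.
Qed.

(* v plays the role of the variation t |-> |||U|||_t. *)
Variables (T : R) (v : R -> R).
Hypothesis cU : cts 0 T (fun x => (U x)%:C).
Hypothesis vU : forall x y, 0 <= x -> x <= y -> y <= T ->
  `|U y - U x| <= v y - v x.

Lemma dominating_nondecreasing x y : 0 <= x -> x <= y -> y <= T -> v x <= v y.
Proof. by move=> x0 xy yT; rewrite -subr_ge0 (le_trans _ (vU x0 xy yT)). Qed.

(* Ito-like formula d(Z^2) = 4 dt - 2 Z dU for Z = g - U. *)
Lemma rflow_sqr_increment b g r m : rflow U b g -> b <= T ->
  0 <= r -> r <= b ->
  (forall x, r <= x <= b -> nm (g x - (U x)%:C) <= m) ->
  nm ((g b - (U b)%:C) ^+ 2 - (g r - (U r)%:C) ^+ 2 - (4 * (b - r))%:C)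
    <= 2 * m * (v b - v r).
Proof.
move=> Fg bT r0 rb Hm.
pose Z x := g x - (U x)%:C.
have cZ : cts r b Z.
  by apply: ctsB; [apply: cts_sub Fg.1|apply: cts_sub cU].
have m0 : 0 <= m by apply: le_trans (Hm r _); rewrite ?nm_ge0 // lexx rb.
pose F x := Z x ^+ 2 - (4 * x)%:C.
have sqrB x y : F y - F x = (Z y - Z x) * (Z x + Z y) - (4 * (y - x))%:C.
  by rewrite /F mulrBr rmorphB /=; ring.
have cF : cts r b F.
  move=> x xrb e e0.
  pose M := 2 * m + 4.
  have M0 : 0 < M by rewrite /M; lra.
  have [d d0 Hd] := cZ x xrb (e / (2 * M)) (divr_gt0 e0 (mulr_gt0 (ltr0Sn _ _) M0)).
  exists (Num.min d (e / (2 * M))); first by rewrite lt_min d0 divr_gt0 // mulr_gt0.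
  move=> y yrb; rewrite lt_min => /andP[yd ye].
  rewrite sqrB; apply: le_trans (nmB _ _) _.
  rewrite nmM nm_real normrM ger0_norm //.
  have H1 := Hd y yrb yd.
  have H2 : nm (Z x + Z y) <= 2 * m.
    by apply: le_trans (nmD _ _) _; have := Hm x xrb; have := Hm y yrb; lra.
  have : nm (Z y - Z x) * nm (Z x + Z y) <= e / (2 * M) * (2 * m).
    by apply: ler_pM => //; exact: nm_ge0.
  have : e / (2 * M) * M = e / 2 by field; lra.
  move: (e / (2 * M)) ye => e1; rewrite /M; nra.
have -> : (g b - (U b)%:C) ^+ 2 - (g r - (U r)%:C) ^+ 2 - (4 * (b - r))%:C = F b - F r.
  by rewrite /F /Z !rmorphM !rmorphB /=; ring.
have -> : 2 * m * (v b - v r) = 2 * m * v b - 2 * m * v r by ring.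
apply: (nm_le_increment (Phi := fun x => 2 * m * v x)) => //.
  move=> x y rx xy yb; rewrite ler_wpM2l ?mulr_ge0 //.
  by apply: dominating_nondecreasing => //; [exact: le_trans rx|exact: le_trans bT].
move=> x /andP[rx xb] e e0.
have xb0 : 0 <= x < b by rewrite (le_trans r0).
have Zx0 : Z x != 0 by exact: rflow_neq0 xb0.
have nZx : 0 < nm (Z x) by rewrite nm_gt0.
have [_ dg] := Fg.2 x xb0.
have xrb : r <= x <= b by rewrite rx ltW.
pose e1 := e / (2 * (2 * m + 1)).
have e10 : 0 < e1 by rewrite divr_gt0 // mulr_gt0 //; lra.
have [d d0 Hd] := dg _ e10.
have [d' d'0 Hd'] := cZ x xrb (e * nm (Z x) / 4) (divr_gt0 (mulr_gt0 e0 nZx) (ltr0Sn _ _)).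
exists (Num.min d d'); first by rewrite lt_min d0.
move=> y /andP[xy]; rewrite -ltrBlDl lt_min => /andP[yd yd'] yb.
have h0 : 0 < y - x by rewrite subr_gt0.
have yrb : r <= y <= b by rewrite yb (le_trans rx) // ltW.
have := Hd y; rewrite xy -ltrBlDl => /(_ yd) H1.
have := Hd' y yrb; rewrite gtr0_norm // => /(_ yd') H2.
have H3 : nm (Z x + Z y) <= 2 * m.
  by apply: le_trans (nmD _ _) _; have := Hm x xrb; have := Hm y yrb; lra.
rewrite sqrB.
(* Of the three terms, the error of the derivative and the drift error are o(y - x); the increment
   of U is not, and is absorbed by the potential 2 m v. *)
have -> : (Z y - Z x) * (Z x + Z y) - (4 * (y - x))%:C =
  (g y - g x - (y - x)%:C * (2 / Z x)) * (Z x + Z y) +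
  (y - x)%:C * 2 / Z x * (Z y - Z x) - (U y - U x)%:C * (Z x + Z y).
  have dZ : Z y - Z x = (g y - g x) - (U y - U x)%:C by rewrite /Z rmorphB /=; ring.
  by rewrite {1}dZ rmorphM rmorph_nat; field.
apply: le_trans (nmB _ _) _.
have H4 : nm ((U y - U x)%:C * (Z x + Z y)) <= 2 * m * v y - 2 * m * v x.
  rewrite nmM nm_real -mulrBr mulrC; apply: ler_pM; rewrite ?nm_ge0 //.
  by apply: vU; [exact: le_trans rx|exact: ltW|exact: le_trans bT].
rewrite [leRHS]addrC; apply: lerD => //.
apply: le_trans (nmD _ _) _; rewrite !nmM nmV nm_real gtr0_norm // nm_nat.
have : nm (g y - g x - (y - x)%:C * (2 / Z x)) * nm (Z x + Z y) <= e1 * (y - x) * (2 * m).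
  by apply: ler_pM => //; exact: nm_ge0.
have : (y - x) * 2 / nm (Z x) * nm (Z y - Z x) <= (y - x) * 2 / nm (Z x) * (e * nm (Z x) / 4).
  by rewrite ler_wpM2l // divr_ge0 ?mulr_ge0 ?nm_ge0 // ltW.
have -> : (y - x) * 2 / nm (Z x) * (e * nm (Z x) / 4) = (y - x) * e / 2.
  by field; rewrite gt_eqF.
have : e1 * (2 * m + 1) = e / 2 by rewrite /e1; field; lra.
have : 0 <= e1 * (y - x) by rewrite mulr_ge0 // ltW.
move: e1 {e10 H1 Hd} => e1 h1 h2 h3 h4.
have h5 : e1 * (y - x) * (2 * m) + e1 * (y - x) = (y - x) * (e / 2) by rewrite -h2; ring.
lra.
Qed.

(* Near the tip the path is close to that of the zero driver, which solves
   Z^2 = - y^2 - 4 (b - r). *)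
Lemma rflow_cone b g y r eta : rflow U b g -> b <= T ->
  g b = (U b)%:C + 'i * y%:C -> 0 <= y -> 0 <= r -> r <= b ->
  eta <= 1 / 2 ->
  (forall x, r <= x <= b -> v b - v x <= eta * Num.sqrt (b - x)) ->
  nm ((g r - (U r)%:C) ^+ 2 + (y ^+ 2 + 4 * (b - r))%:C) <=
    2 * Num.sqrt (2 * y ^+ 2 + 9 * (b - r)) * (v b - v r).
Proof.
move=> Fg bT gb y0 r0 rb eta2 Hv.
pose Z x := g x - (U x)%:C.
have cZ : cts r b Z.
  by apply: ctsB; [apply: cts_sub Fg.1|apply: cts_sub cU].
have [c /andP[rc cb] Hc] := cts_nm_max rb cZ.
set m := nm (Z c) in Hc.
have m0 : 0 <= m by exact: nm_ge0.
have Zb2 : Z b ^+ 2 = - (y ^+ 2)%:C.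
  rewrite /Z gb addrC addKr exprMn rmorphXn /= -[RHS]mulN1r; congr (_ * _).
  exact: sqr_i.
have inc x : r <= x -> x <= b ->
    nm (Z x ^+ 2 + (y ^+ 2 + 4 * (b - x))%:C) <= 2 * m * (v b - v x).
  move=> rx xb; have := @rflow_sqr_increment b g x m Fg bT (le_trans r0 rx) xb.
  rewrite -/(Z b) -/(Z x) Zb2 => H.
  have -> : Z x ^+ 2 + (y ^+ 2 + 4 * (b - x))%:C =
    - (- (y ^+ 2)%:C - Z x ^+ 2 - (4 * (b - x))%:C) by rewrite rmorphD /=; ring.
  rewrite nmN; apply: H => z /andP[xz zb]; apply: Hc; rewrite zb (le_trans rx) //.
set S := Num.sqrt (2 * y ^+ 2 + 9 * (b - r)).
have Sq : S ^+ 2 = 2 * y ^+ 2 + 9 * (b - r).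
  by rewrite sqr_sqrtr // addr_ge0 ?mulr_ge0 ?sqr_ge0 ?subr_ge0.
have S0 : 0 <= S by exact: sqrtr_ge0.
(* The maximum bounds itself: with q = sqrt(b - c), m^2 <= y^2 + 4 q^2 + m q, and 2 m q <= m^2 + q^2
   gives m^2 <= 2 y^2 + 9 q^2. *)
have mS : m <= S.
  have s0 : 0 <= b - c by rewrite subr_ge0.
  have := inc c rc cb; have := Hv c; rewrite rc cb => /(_ isT).
  have := sqr_sqrtr s0; have := sqrtr_ge0 (b - c).
  set q := Num.sqrt _ => q0 qq vq H.
  have : nm (Z c ^+ 2) <= y ^+ 2 + 4 * (b - c) + 2 * m * (v b - v c).
    have -> : Z c ^+ 2 = (Z c ^+ 2 + (y ^+ 2 + 4 * (b - c))%:C) - (y ^+ 2 + 4 * (b - c))%:C by ring.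
    apply: le_trans (nmB _ _) _; rewrite nm_real ger0_norm; last first.
      by rewrite addr_ge0 ?sqr_ge0 // mulr_ge0.
    by rewrite addrC lerD2l.
  rewrite nmX2 -/m => H2.
  have H3 : m * (v b - v c) <= m * (q / 2).
    rewrite ler_wpM2l //; apply: le_trans vq _.
    by rewrite mulrC ler_wpM2l //; lra.
  have mq : 2 * (m * q) <= m ^+ 2 + q ^+ 2.
    by have := sqr_ge0 (m - q); rewrite sqrrB; lra.
  have : m ^+ 2 <= S ^+ 2.
    rewrite Sq; have := sqr_ge0 y.
    have : b - c <= b - r by rewrite lerD2l lerN2.
    by rewrite -qq in H2 *; lra.
  by rewrite ler_sqr.
apply: le_trans (inc r (lexx _) rb) _.
rewrite ler_wpM2r ?subr_ge0 ?dominating_nondecreasing //.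
by rewrite ler_wpM2l.
Qed.

End driver.

(** Nonzero z and w have arguments in [pi/4, 3 pi/4], so that of the product lies in
    [pi/2, 3 pi/2]. *)
Lemma Re_mul_le0 (z w : R[i]) : `|complex.Re z| <= complex.Im z ->
  `|complex.Re w| <= complex.Im w -> complex.Re (z * w) <= 0.
Proof.
case: z w => a b [c d] /= ab cd; rewrite subr_le0.
apply: le_trans (ler_norm _) _; rewrite normrM; exact: ler_pM.
Qed.

Lemma Re_div_ge0 (z : R[i]) : complex.Re z <= 0 -> 0 <= complex.Re (- 2 / z).
Proof.
case: z => a b /= a0.
rewrite addr0 oppr0 mul0r subr0 mulNr -mulrN mulr_ge0 // -mulNr.
by rewrite divr_ge0 ?oppr_ge0 // addr_ge0 ?sqr_ge0.
Qed.

(** In the cone the logarithmic derivative of f - g has nonnegative real part, so distances shrink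
    in backward time. No lower bound on the height is needed, so this reaches the tip. *)
Lemma rflow_contract (U : R -> R) b f g r : rflow U b f -> rflow U b g ->
  0 <= r -> r <= b ->
  (forall x, r <= x < b ->
    `|complex.Re (f x - (U x)%:C)| <= complex.Im (f x) /\
    `|complex.Re (g x - (U x)%:C)| <= complex.Im (g x)) ->
  nm (f r - g r) <= nm (f b - g b).
Proof.
move=> Ff Fg r0 rb cone.
apply: (logder_Re_ge0_nondecreasing (f := fun x => f x - g x)
  (k := fun x => - 2 / ((f x - (U x)%:C) * (g x - (U x)%:C)))) => //.
  by apply: ctsB; [apply: cts_sub Ff.1|apply: cts_sub Fg.1].
move=> x /andP[rx xb]; split.
  by apply: rflow_logderB Ff Fg _; rewrite (le_trans r0).
have [] := cone x; rewrite ?rx // => cf cg.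
by apply/Re_div_ge0/Re_mul_le0; rewrite ImB_real.
Qed.

(** At height c the logarithmic derivative is at most 2 / c^2; [logder_bound_rev] doubles the
    exponent. *)
Lemma rflow_lipschitz (U : R -> R) b f g r c : rflow U b f -> rflow U b g ->
  0 <= r -> r <= b -> 0 < c ->
  (forall x, r <= x < b -> c <= complex.Im (f x) /\ c <= complex.Im (g x)) ->
  nm (f r - g r) <= expR (4 / c ^+ 2 * (b - r)) * nm (f b - g b).
Proof.
move=> Ff Fg r0 rb c0 Hc.
have -> : 4 / c ^+ 2 = 2 * (2 / c ^+ 2) by field; rewrite gt_eqF.
apply: (logder_bound_rev (f := fun x => f x - g x)
  (k := fun x => - 2 / ((f x - (U x)%:C) * (g x - (U x)%:C)))) => //.
  by rewrite divr_gt0 // exprn_gt0.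
  by apply: ctsB; [apply: cts_sub Ff.1|apply: cts_sub Fg.1].
move=> x /andP[rx xb]; split.
  by apply: rflow_logderB Ff Fg _; rewrite (le_trans r0).
have [] := Hc x; rewrite ?rx // => cf cg.
rewrite nmf_div nmN nm_nat nmM ler_pM2l //.
have cf' := le_trans cf (Im_le_nmB (f x) (U x)).
have cg' := le_trans cg (Im_le_nmB (g x) (U x)).
by rewrite lef_pV2 ?posrE ?mulr_gt0 ?(lt_le_trans c0) // expr2 ler_pM // ltW.
Qed.

End flow.

(** * Primitives of continuous complex functions *)

Section primitive.
Context {R : realType}.
Implicit Types (a b x y e : R).

Lemma continuous_primitive (f : R -> R) a b : a <= b -> continuous f ->
  exists F : R -> R, forall x, a <= x <= b -> forall e, 0 < e ->
    exists2 d, 0 < d & forall y, `|y - x| < d ->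
      `|F y - F x - (y - x) * f x| <= e * `|y - x|.
Proof.
move=> ab cf.
pose mu := @lebesgue_measure R.
(* Starting at a - 1, with integrability up to b + 1, puts all of [a, b] in the interior, where the
   derivative is two-sided. *)
exists (fun x => \int[mu]_(t in `[a - 1, x]) f t)%R.
move=> x /andP[ax xb] e e0.
have int_f : mu.-integrable `[a - 1, b + 1] (EFin \o f).
  apply: continuous_compact_integrable; first exact: segment_compact.
  exact: continuous_subspaceT.
have [|||dF F'] := @continuous_FTC1_closed _ f (a - 1) x (b + 1) _ int_f; [lra|lra|exact: cf|].
move: dF F'; set F := (fun x => _) => dF F'.
have : (h^-1 *: (F (h *: 1 + x) - F x) @[h --> 0^']) --> f x.
  by rewrite -F' derive1E.
move=> /cvgrPdist_le/(_ e e0) [d /= d0 Hd].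
exists d => // y yd; have [->|yx] := eqVneq y x.
  by rewrite !subrr mul0r subrr normr0 mulr0.
have nyx : y - x != 0 by rewrite subr_eq0.
have := Hd (y - x); rewrite /ball /= sub0r normrN => /(_ yd nyx).
rewrite /GRing.scale /= mulr1 subrK => H.
have -> : F y - F x - (y - x) * f x = - ((y - x) * (f x - (y - x)^-1 * (F y - F x))).
  by field.
by rewrite normrN normrM mulrC ler_wpM2r.
Qed.

Lemma cts_primitive a b (k : R -> R[i]) z : a <= b -> cts a b k ->
  exists K : R -> R[i], K b = z /\ forall x, a <= x <= b -> der a b K x (k x).
Proof.
move=> ab ck.
(* The 1-Lipschitz retraction onto [a, b] extends k to a continuous function on R. *)
pose cl x := Num.max a (Num.min x b).
have clab x : a <= cl x <= b.
  by rewrite /cl le_max lexx /= ge_max ab ge_min lexx orbT.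
have clE x : a <= x <= b -> cl x = x.
  by move=> /andP[ax xb]; rewrite /cl min_l // max_r.
have cl1 x y : `|cl y - cl x| <= `|y - x|.
  rewrite /cl; have [xb|xb] := leP x b; have [yb|yb] := leP y b;
    rewrite ?(max_r ab); have [ax|ax] := leP a x; have [ay|ay] := leP a y;
    rewrite ler_norml; case: (ler0P (y - x)) => ?; apply/andP; split; lra.
have cpart (p : R[i] -> R) : (forall w w', `|p w - p w'| <= nm (w - w')) ->
    continuous (fun x => p (k (cl x))).
  move=> p1 x; apply/cvgrPdist_le => e e0.
  have [d d0 Hd] := ck (cl x) (clab x) e e0.
  exists d => //= y; rewrite /ball /= distrC => yd.
  apply: le_trans (p1 _ _) _; rewrite nmC; apply: Hd => //.
  exact: le_lt_trans (cl1 _ _) yd.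
have cRe := cpart (@complex.Re _); have cIm := cpart (@complex.Im _).
have [|F HF] := continuous_primitive ab (cRe _).
  by move=> w w'; have := le_Re_nm (w - w'); case: w w' => ? ? [].
have [|G HG] := continuous_primitive ab (cIm _).
  by move=> w w'; have := le_Im_nm (w - w'); case: w w' => ? ? [].
exists (fun x => z + (F x +i* G x - F b +i* G b)); split; first by rewrite subrr addr0.
move=> x xab e e0; have e2 : 0 < e / 2 by lra.
have [d d0 Hd] := HF x xab _ e2; have [d' d'0 Hd'] := HG x xab _ e2.
exists (Num.min d d'); first by rewrite lt_min d0.
move=> y yab; rewrite lt_min => /andP[yd yd'].
apply: le_trans (nm_le_ReIm _) _.
have := Hd y yd; have := Hd' y yd'; rewrite clE //.
case: (k x) => u w /=; case: z => z1 z2 /=.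
rewrite !mul0r subr0 addr0.
set X1 := F y - F x - _; set X2 := G y - G x - _ => h1 h2.
have -> : z1 + (F y - F b) - (z1 + (F x - F b)) - (y - x) * u = X1 by rewrite /X1; ring.
have -> : z2 + (G y - G b) - (z2 + (G x - G b)) - (y - x) * w = X2 by rewrite /X2; ring.
lra.
Qed.

End primitive.

(** * Sequences with geometrically decreasing increments *)

Section geometric_cauchy.
Context {R : realType}.

(** With s n = 2 C / 2^n the intervals [u n - s n, u n + s n] are nested, because s n - s (n + 1) =
    C / 2^n. The supremum of the lower ends lies in all of them, which gives the limit together with
    its rate. *)
Lemma real_geometric_cauchy (u : nat -> R) C :
  (forall n, `|u n.+1 - u n| <= C / 2 ^+ n) ->
  exists l, forall n, `|u n - l| <= 2 * C / 2 ^+ n.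
Proof.
move=> Hu.
have C0 : 0 <= C by have := le_trans (normr_ge0 _) (Hu 0); rewrite expr0 divr1.
pose s n := 2 * C / 2 ^+ n.
have sS n : s n.+1 = C / 2 ^+ n.
  by rewrite /s exprS; field; rewrite expf_neq0.
have s2 n : s n = C / 2 ^+ n + C / 2 ^+ n by rewrite /s; lra.
have s0 n : 0 <= s n by rewrite /s divr_ge0 ?mulr_ge0 ?exprn_ge0.
have lo n m : (n <= m)%N -> u n - s n <= u m - s m.
  move=> /subnK <-; elim: (m - n)%N => [|p IH]; first by rewrite add0n.
  rewrite addSn; apply: le_trans IH _; rewrite sS.
  by have := Hu (p + n)%N; rewrite ler_norml => /andP[]; have := s2 (p + n)%N; lra.
have hi n m : (n <= m)%N -> u m + s m <= u n + s n.
  move=> /subnK <-; elim: (m - n)%N => [|p IH]; first by rewrite add0n.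
  rewrite addSn; apply: le_trans IH; rewrite sS.
  by have := Hu (p + n)%N; rewrite ler_norml => /andP[]; have := s2 (p + n)%N; lra.
have lohi n m : u n - s n <= u m + s m.
  have := lo _ _ (leq_maxl n m); have := hi _ _ (leq_maxr n m).
  have := s0 (maxn n m); lra.
pose S := [set u n - s n | n in [set: nat]].
have supS : has_sup S.
  split; first by exists (u 0%N - s 0%N); exists 0%N.
  by exists (u 0%N + s 0%N) => _ [n _ <-].
exists (sup S) => n; rewrite ler_norml; apply/andP; split.
  have : sup S <= u n + s n by apply: ge_sup; [case: supS|move=> _ [m _ <-]].
  by rewrite -/(s n); lra.
have : u n - s n <= sup S by apply: sup_upper_bound => //; exists n.
by rewrite -/(s n); lra.
Qed.

Lemma geometric_cauchy (u : nat -> R[i]) C :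
  (forall n, nm (u n.+1 - u n) <= C / 2 ^+ n) ->
  exists l, forall n, nm (u n - l) <= 4 * C / 2 ^+ n.
Proof.
move=> Hu.
have [n|x Hx] := @real_geometric_cauchy (fun n => complex.Re (u n)) C.
  apply: le_trans (Hu n); have := le_Re_nm (u n.+1 - u n).
  by case: (u n.+1) (u n) => ? ? [].
have [n|y Hy] := @real_geometric_cauchy (fun n => complex.Im (u n)) C.
  apply: le_trans (Hu n); have := le_Im_nm (u n.+1 - u n).
  by case: (u n.+1) (u n) => ? ? [].
exists (x +i* y) => n; apply: le_trans (nm_le_ReIm _) _.
have := Hx n; have := Hy n; case: (u n) => ? ? /=; lra.
Qed.

Lemma geometric_lt (C e : R) : 0 < e -> exists n, C / 2 ^+ n <= e.
Proof.
move=> e0; have [C0|C0] := leP C 0.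
  by exists 0%N; rewrite expr0 divr1 (le_trans C0) // ltW.
exists (Num.bound (C / e)); rewrite ler_pdivrMr ?exprn_gt0 // -ler_pdivrMl // mulrC.
apply: le_trans (ltW (archi_boundP _)) _; first by rewrite divr_ge0 // ltW.
by rewrite -natrX ler_nat; exact/ltnW/ltn_expl.
Qed.

End geometric_cauchy.

(** * Picard iteration for the Loewner equation with a terminal value above the real line *)

Section picard.
Context {R : realType}.
Implicit Types (a b x y e : R) (f g : R -> R[i]).

Lemma rder_increment a b f (l : R -> R[i]) (kappa Phi : R -> R) :
  a <= b -> cts a b f ->
  (forall x, a <= x < b -> rder f x (l x) /\ nm (l x) <= kappa x) ->
  (forall x y, a <= x -> x <= y -> y <= b -> Phi x <= Phi y) ->
  (forall x, a <= x < b -> forall e, 0 < e -> exists2 d, 0 < d &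
     forall y, x < y < x + d -> y <= b ->
       (kappa x - e) * (y - x) <= Phi y - Phi x) ->
  nm (f b - f a) <= Phi b - Phi a.
Proof.
move=> ab cf dl ndPhi loc; apply: nm_le_increment => //.
move=> x xab e e0; have [dx lx] := dl x xab; have e2 : 0 < e / 2 by lra.
have [d d0 Hd] := dx _ e2; have [d' d'0 Hd'] := loc x xab _ e2.
exists (Num.min d d'); first by rewrite lt_min d0.
move=> y /andP[xy]; rewrite -ltrBlDl lt_min => /andP[yd yd'] yb.
have h0 : 0 < y - x by rewrite subr_gt0.
have := Hd y; rewrite xy -ltrBlDl => /(_ yd) H1.
have := Hd' y; rewrite xy -ltrBlDl => /(_ yd' yb) H2.
have -> : f y - f x = (f y - f x - (y - x)%:C * l x) + (y - x)%:C * l x by ring.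
apply: le_trans (nmD _ _) _; rewrite nmM nm_real gtr0_norm //.
have : (y - x) * nm (l x) <= (y - x) * kappa x by rewrite ler_pM2l.
lra.
Qed.

Lemma cts_const a b (z : R[i]) : cts a b (fun=> z).
Proof. by move=> x _ e e0; exists 1 => // y _ _; rewrite subrr nm0 ltW. Qed.

(** The regular counterpart of [rflow]: positive height and a derivative within [0, b] also at b
    itself, as [loewner_solution] requires. *)
Definition flow (U : R -> R) b g := forall x, 0 <= x <= b ->
  0 < complex.Im (g x) /\ der 0 b g x (2 / (g x - (U x)%:C)).

Lemma flow_rflow U b g : flow U b g -> rflow U b g.
Proof.
move=> Fg; split; first by apply: der_cts => x /Fg[_]; exact.
move=> x /andP[x0 xb]; have [|Y0 dg] := Fg x; first by rewrite x0 ltW.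
by split=> //; apply: der_rder dg; rewrite x0.
Qed.

(** Raising the imaginary part to at least c makes the field globally Lipschitz, so Picard iterates
    need not be kept inside the half plane. *)
Definition clampIm c (z : R[i]) : R[i] :=
  complex.Re z +i* Num.max c (complex.Im z).

Lemma clampIm_ge c (z : R[i]) : c <= complex.Im (clampIm c z).
Proof. by rewrite /= le_max lexx. Qed.

Lemma clampIm_lip c (z w : R[i]) : nm (clampIm c z - clampIm c w) <= nm (z - w).
Proof.
rewrite !nmE; case: z w => a b [a' b'] /=.
rewrite ler_sqrt ?addr_ge0 ?sqr_ge0 // lerD2l.
rewrite -[leLHS]real_normK ?num_real // -[leRHS]real_normK ?num_real //.
rewrite ler_sqr ?nnegrE // /Num.max; case: ltP => ?; case: ltP => ?; rewrite ler_norml;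
  case: (ler0P (b - b')) => ?; apply/andP; split; lra.
Qed.

Lemma clampIm_id c (z : R[i]) : c <= complex.Im z -> clampIm c z = z.
Proof. by case: z => a b /= cb; rewrite /clampIm /= max_r. Qed.

Section terminal_value.
Variables (U : R -> R) (b c : R) (z : R[i]).
Hypotheses (b0 : 0 <= b) (c0 : 0 < c).
Hypothesis cU : cts 0 b (fun x => (U x)%:C).

Let fld g x := 2 / (clampIm c (g x) - (U x)%:C).

Let den_ge g x : c <= nm (clampIm c (g x) - (U x)%:C).
Proof. exact: le_trans (clampIm_ge _ _) (Im_le_nmB _ _). Qed.

Let L := 2 / c ^+ 2.
Let L0 : 0 < L. Proof. by rewrite /L divr_gt0 // exprn_gt0. Qed.

Let inv_lip (A B : R[i]) : c <= nm A -> c <= nm B -> nm (2 / A - 2 / B) <= L * nm (A - B).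
Proof.
move=> cA cB.
have A0 : A != 0 by rewrite -nm_gt0; exact: lt_le_trans cA.
have B0 : B != 0 by rewrite -nm_gt0; exact: lt_le_trans cB.
have -> : 2 / A - 2 / B = 2 / (A * B) * - (A - B) by field; rewrite A0 B0.
rewrite nmM nmN nmf_div nm_nat nmM ler_wpM2r ?nm_ge0 // ler_pM2l //.
by rewrite lef_pV2 ?posrE ?mulr_gt0 ?(lt_le_trans c0) // expr2 ler_pM // ltW.
Qed.

Let fld_lip g h x : nm (fld g x - fld h x) <= L * nm (g x - h x).
Proof.
apply: le_trans (inv_lip (den_ge g x) (den_ge h x)) _.
rewrite ler_pM2l //; apply: le_trans (clampIm_lip c _ _).
by rewrite opprB addrA subrK.
Qed.

Let fld_cts g : cts 0 b g -> cts 0 b (fld g).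
Proof.
move=> cg x xb e e0; have e2 : 0 < e / (2 * L) by rewrite divr_gt0 // mulr_gt0.
have [d d0 Hd] := cg x xb _ e2; have [d' d'0 Hd'] := cU xb e2.
exists (Num.min d d'); first by rewrite lt_min d0.
move=> y yb; rewrite lt_min => /andP[yd yd'].
apply: le_trans (inv_lip (den_ge g y) (den_ge g x)) _.
have -> : clampIm c (g y) - (U y)%:C - (clampIm c (g x) - (U x)%:C) =
  (clampIm c (g y) - clampIm c (g x)) - ((U y)%:C - (U x)%:C) by ring.
have : nm (clampIm c (g y) - clampIm c (g x) - ((U y)%:C - (U x)%:C)) <= e / L.
  apply: le_trans (nmB _ _) _; apply: (@le_trans _ _ (e / (2 * L) + e / (2 * L))).
    by apply: lerD; [apply: le_trans (clampIm_lip _ _ _) _; exact: Hd|exact: Hd'].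
  suff -> : e / (2 * L) + e / (2 * L) = e / L by [].
  by field; rewrite gt_eqF.
by rewrite ler_pdivlMr // mulrC.
Qed.

Let weight_le x y : 0 <= x -> x <= y -> expR (2 * L * (b - y)) <= expR (2 * L * (b - x)).
Proof.
move=> x0 xy; rewrite ler_expR; apply: ler_wpM2l; last by rewrite lerD2l lerN2.
by rewrite mulr_ge0 // ltW.
Qed.

Let weight_ge1 x : x <= b -> 1 <= expR (2 * L * (b - x)).
Proof.
move=> xb; rewrite -expR0 ler_expR; apply: mulr_ge0; last by rewrite subr_ge0.
by apply: mulr_ge0 => //; exact: ltW L0.
Qed.

Let weight_top x : 0 <= x -> expR (2 * L * (b - x)) <= expR (2 * L * b).
Proof. by move=> x0; have := weight_le (lexx 0) x0; rewrite subr0. Qed.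

(* One Picard step halves the distance in the weighted supremum norm. *)
Let picard_step g h G H M : cts 0 b G -> cts 0 b H -> 0 <= M ->
  G b = H b ->
  (forall x, 0 <= x <= b -> der 0 b G x (fld g x)) ->
  (forall x, 0 <= x <= b -> der 0 b H x (fld h x)) ->
  (forall x, 0 <= x <= b -> nm (g x - h x) <= M * expR (2 * L * (b - x))) ->
  forall x, 0 <= x <= b -> nm (G x - H x) <= M / 2 * expR (2 * L * (b - x)).
Proof.
move=> cG cH M0 GHb dG dH Hgh x /andP[x0 xb].
pose D y := G y - H y.
have Db : D b = 0 by rewrite /D GHb subrr.
have cD : cts x b D by apply: (@cts_sub _ 0 b) => //; exact: ctsB.
rewrite -/(D x).
have := @rder_increment x b D (fun y => fld g y - fld h y)
  (fun y => L * (M * expR (2 * L * (b - y))))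
  (fun y => - (M / 2 * expR (2 * L * (b - y)))) xb cD.
rewrite Db sub0r nmN subrr mulr0 expR0 mulr1 => Hinc.
apply: le_trans (Hinc _ _ _) _.
- move=> y /andP[xy yb]; have y0b : 0 <= y <= b by rewrite (le_trans x0) // ltW.
  have y0b' : 0 <= y < b by rewrite (le_trans x0).
  split; first by apply: rderB; apply: der_rder y0b' _; [exact: dG|exact: dH].
  by apply: le_trans (fld_lip _ _ _) _; rewrite ler_pM2l // Hgh.
- move=> y y' xy yy' y'b; rewrite lerN2 ler_wpM2l ?divr_ge0 //.
  by apply: weight_le => //; exact: le_trans xy.
- move=> y /andP[xy yb] e e0.
  pose E := expR (2 * L * (b - y)).
  (* W - 1 is the coefficient of the quadratic error made when the weight at y' is replaced by the
     weight at y. *)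
  pose W := L * (M * E) * (2 * L) + 1.
  have W1 : 1 <= W.
    have l0 := ltW L0; rewrite /W lerDr; apply: mulr_ge0; last exact: mulr_ge0.
    by apply: mulr_ge0 => //; apply: mulr_ge0 => //; exact: expR_ge0.
  exists (e / W); first by rewrite divr_gt0 //; lra.
  move=> y' /andP[yy']; rewrite -ltrBlDl ltr_pdivlMr; last by lra.
  move=> He y'b; have h0 : 0 < y' - y by rewrite subr_gt0.
  have E1 : E * (1 - 2 * L * (y' - y)) <= expR (2 * L * (b - y')).
    have -> : 2 * L * (b - y') = 2 * L * (b - y) - 2 * L * (y' - y) by ring.
    by rewrite expRD ler_wpM2l ?expR_ge0 // expR_ge1Dx.
  have E2 : expR (2 * L * (b - y')) * (2 * L * (y' - y)) <= E - expR (2 * L * (b - y')).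
    rewrite lerBrDl -[X in X + _]mulr1 -mulrDr.
    have -> : E = expR (2 * L * (b - y')) * expR (2 * L * (y' - y)).
      by rewrite -expRD /E; congr expR; ring.
    by rewrite ler_wpM2l ?expR_ge0 // expR_ge1Dx.
  rewrite -/E.
  move: (expR (2 * L * (b - y'))) E1 E2 => E' E1 E2.
  have Lh : 0 <= L * (y' - y) by rewrite mulr_ge0 // ltW.
  have := ler_wpM2l M0 E2.
  have := ler_wpM2l M0 (ler_wpM2r Lh E1).
  have : (y' - y) * (L * (M * E) * (2 * L)) * (y' - y) <= e * (y' - y).
    rewrite ler_pM2r //; apply: le_trans (ltW He); rewrite ler_wpM2l ?(ltW h0) //.
    by rewrite /W lerDl.
  move=> i1 i2 i3; lra.
- by have := mulr_ge0 M0 (expR_ge0 (2 * L * (b - x))); lra.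
Qed.

Let picard : exists g, g b = z /\
  forall x, 0 <= x <= b -> der 0 b g x (fld g x).
Proof.
(* [P] is the integral operator with value z at b; its values at discontinuous k are junk. *)
have /choice[P HP] : forall k : R -> R[i], exists K : R -> R[i], cts 0 b k ->
    K b = z /\ forall x, 0 <= x <= b -> der 0 b K x (k x).
  move=> k; have [ck|nck] := pselect (cts 0 b k).
    by have [K HK] := cts_primitive z b0 ck; exists K.
  by exists (fun=> 0).
pose u n := iter n (fun g => P (fld g)) (fun=> z).
have uS n : u n.+1 = P (fld (u n)) by [].
have cu n : cts 0 b (u n).
  elim: n => [|n IH]; first exact: cts_const.
  by rewrite uS; exact: der_cts (HP _ (fld_cts IH)).2.
have ub n : u n b = z.
  by case: n => // n; rewrite uS; have [] := HP _ (fld_cts (cu n)).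
have du n x : 0 <= x <= b -> der 0 b (u n.+1) x (fld (u n) x).
  by rewrite uS; have [_] := HP _ (fld_cts (cu n)); apply.
have [c1 c1b Hc1] := cts_nm_max b0 (ctsB (cu 1%N) (cu 0%N)).
set M := nm _ in Hc1.
have M0 : 0 <= M by exact: nm_ge0.
have stepn n x : 0 <= x <= b ->
    nm (u n.+1 x - u n x) <= M / 2 ^+ n * expR (2 * L * (b - x)).
  elim: n x => [|n IH] x xb.
    rewrite expr0 divr1; apply: le_trans (Hc1 x xb) _.
    by rewrite ler_peMr // weight_ge1 //; case/andP: xb.
  have -> : M / 2 ^+ n.+1 = M / 2 ^+ n / 2 by rewrite exprSr invfM mulrA.
  apply: (picard_step (g := u n.+1) (h := u n)) => //.
  - by rewrite divr_ge0 // exprn_ge0.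
  - by rewrite !ub.
  - by move=> y; exact: du.
  - by move=> y; exact: du.
pose C := M * expR (2 * L * b).
have C0 : 0 <= C by rewrite mulr_ge0 // expR_ge0.
have /choice[g Hg] : forall x, exists l : R[i], 0 <= x <= b ->
    forall n, nm (u n x - l) <= 4 * C / 2 ^+ n.
  move=> x; have [xb|nxb] := boolP (0 <= x <= b); last by exists 0.
  have [|l Hl] := @geometric_cauchy _ (fun n => u n x) C; last by exists l.
  move=> n; apply: le_trans (stepn n x xb) _.
  rewrite /C mulrAC ler_wpM2r ?invr_ge0 ?exprn_ge0 // ler_wpM2l //.
  by apply: weight_top; case/andP: xb.
have cg : cts 0 b g.
  move=> x xb e e0; have e3 : 0 < e / 3 by lra.
  have [n Hn] := geometric_lt (4 * C) e3.
  have [d d0 Hd] := cu n x xb _ e3.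
  exists d => // y yb yd; have := Hd y yb yd.
  have := nm_tri (u n y) (g y) (g x); have := nm_tri (u n x) (u n y) (g x).
  by have := Hg x xb n; have := Hg y yb n; rewrite (nmC (u n y) (g y)); lra.
have [Kb dK] := HP _ (fld_cts cg).
(* The limit is a fixed point: one more Picard step, from g and from u n, puts P (fld g) close to u
   n.+1, which is close to g. *)
have Kg x : 0 <= x <= b -> P (fld g) x = g x.
  move=> xb; apply/eqP; rewrite -subr_eq0; apply/eqP; apply: ComplexField.Normc.eq0_normc.
  apply/eqP; rewrite eq_le nm_ge0 andbT; apply/ler_addgt0Pr => e e0; rewrite add0r.
  pose B := 1 + expR (2 * L * b).
  have B0 : 0 < B by rewrite /B addr_gt0 // expR_gt0.
  have [n Hn] := geometric_lt (4 * C) (divr_gt0 e0 B0).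
  have s0 : 0 <= 4 * C / 2 ^+ n by rewrite divr_ge0 ?mulr_ge0 ?exprn_ge0.
  have H1 : nm (P (fld g) x - u n.+1 x) <= 4 * C / 2 ^+ n / 2 * expR (2 * L * (b - x)).
    apply: (picard_step (g := g) (h := u n)) => //.
    - exact: der_cts dK.
    - by rewrite ub.
    - by move=> y; exact: du.
    - move=> y yb; rewrite nmC; apply: le_trans (Hg y yb n) _.
      by rewrite ler_peMr // weight_ge1 //; case/andP: yb.
  have H2 : expR (2 * L * (b - x)) <= expR (2 * L * b).
    by apply: weight_top; case/andP: xb.
  have H3 : nm (u n.+1 x - g x) <= 4 * C / 2 ^+ n.
    apply: le_trans (Hg x xb n.+1) _; rewrite ler_wpM2l ?mulr_ge0 //.
    by rewrite lef_pV2 ?posrE ?exprn_gt0 // ler_weXn2l // ler1n.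
  apply: le_trans (nm_tri (u n.+1 x) _ _) _.
  move: Hn; rewrite ler_pdivlMr // /B => Hn.
  have := ler_wpM2l s0 H2; have := mulr_ge0 s0 (expR_ge0 (2 * L * b)).
  have := mulr_ge0 s0 (expR_ge0 (2 * L * (b - x))); lra.
exists g; split; first by rewrite -Kg ?b0 ?lexx.
by move=> x xb; apply: (der_eq Kg) => //; exact: dK.
Qed.

(** The clamped field also points downward, so in backward time the height stays at least its
    terminal value c and the clamp is never active. *)
Lemma flow_exists : complex.Im z = c -> exists g, g b = z /\ flow U b g.
Proof.
move=> zc; have [g [gb dg]] := picard; exists g; split=> //.
have Imge x : 0 <= x <= b -> c <= complex.Im (g x).
  move=> /andP[x0 xb]; rewrite -zc -gb.
  have cg : cts x b g by apply: (@cts_sub _ 0 b) => //; apply: der_cts dg.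
  suff : complex.Im (g b) - complex.Im (g x) <= 0 - 0 by lra.
  apply: (@local_le_increment _ x b (fun y => complex.Im (g y)) (fun=> 0)) => //.
  - move=> s /andP[rs sb] e e0.
    have [|d d0 Hd] := cg s _ e e0; first by rewrite (ltW rs).
    exists d => // y /andP[ry yx] xdy.
    have := Hd y; rewrite ry (le_trans (ltW yx)) // distrC gtr0_norm ?subr_gt0 //.
    move=> /(_ isT); have xyd : s - y < d by lra.
    move=> /(_ xyd); have := le_Im_nm (g y - g s).
    by case: (g s) (g y) => ? ? [? ?] /=; rewrite ler_norml => /andP[]; lra.
  - move=> s /andP[rs sb] e e0.
    have s0 : 0 <= s < b by rewrite (le_trans x0).
    have [|d d0 Hd] := der_rder s0 (dg s _) e0.
      by rewrite (le_trans x0) // ltW.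
    exists d => // y xyd yb; have /andP[xy yd] := xyd.
    have h0 : 0 < y - s by rewrite subr_gt0.
    have := Hd y xyd; have := le_Im_nm (g y - g s - (y - s)%:C * fld g s).
    have : complex.Im (fld g s) <= 0.
      have := clampIm_ge c (g s); rewrite /fld; case: (clampIm c _) => u w /= wc.
      have w0 := lt_le_trans c0 wc.
      rewrite !subr0 addr0 mul0r addr0 pmulr_rle0 ?addr_gt0 //.
      by rewrite oppr_le0 divr_ge0 ?addr_ge0 ?sqr_ge0 // ltW.
    case: (fld g s) => a1 a2 /= a20.
    have := ler_wpM2l (ltW h0) a20; rewrite mulr0.
    move: (nm _) => N; case: (g s) (g y) => ? ? [? ?] /=.
    by rewrite ler_norml mul0r addr0 => ? /andP[]; lra.
move=> x xb; have cx := Imge x xb; split; first exact: lt_le_trans cx.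
by have := dg x xb; rewrite /fld clampIm_id.
Qed.

End terminal_value.

End picard.

(** * The orbit ending at the tip: cone estimates, existence and dependence on b *)

Section tip.
Context {R : realType}.
Variables (T : R) (U v : R -> R).
Hypothesis cU : cts 0 T (fun x => (U x)%:C).
Hypothesis vU : forall x y, 0 <= x -> x <= y -> y <= T ->
  `|U y - U x| <= v y - v x.
Implicit Types (r s x y b : R) (f g : R -> R[i]).

Definition small_variation (eta eps : R) := forall x y, 0 <= x -> x <= y ->
  y <= T -> y - x <= eps -> v y - v x <= eta * Num.sqrt (y - x).

Definition in_cone g r := `|complex.Re (g r - (U r)%:C)| <= complex.Im (g r).

Lemma cone_small g b y r eta eps : rflow U b g -> b <= T ->
  g b = (U b)%:C + 'i * y%:C -> 0 <= y -> 0 <= r -> r <= b -> b - r <= eps ->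
  0 <= eta -> eta <= 1 / 2 -> small_variation eta eps ->
  nm ((g r - (U r)%:C) ^+ 2 + (y ^+ 2 + 4 * (b - r))%:C) <=
    3 / 2 * eta * (y ^+ 2 + 4 * (b - r)).
Proof.
move=> Fg bT gb y0 r0 rb beps eta0 eta2 Hs.
apply: le_trans (rflow_cone cU vU Fg bT gb y0 r0 rb eta2 _) _.
  move=> x /andP[rx xb]; apply: Hs => //; first exact: le_trans rx.
  by apply: le_trans beps; rewrite lerD2l lerN2.
have := Hs r b r0 rb bT beps.
have br : 0 <= b - r by rewrite subr_ge0.
have := sqr_ge0 y; move: (y ^+ 2) (b - r) br => a s s0 a0.
have A0 : 0 <= a + 4 * s by rewrite addr_ge0 // mulr_ge0.
set q := Num.sqrt s; set S := Num.sqrt (2 * a + 9 * s) => vq.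
have q0 : 0 <= q by exact: sqrtr_ge0.
have S0 : 0 <= S by exact: sqrtr_ge0.
have qq : q ^+ 2 = s by exact: sqr_sqrtr.
have SS : S ^+ 2 = 2 * a + 9 * s.
  by rewrite sqr_sqrtr // addr_ge0 // mulr_ge0.
(* The inequality of means is applied to S and 3 q, which coincide when y = 0; this is where 3/2
   comes from. *)
have Sq : 2 * S * q <= 3 / 2 * (a + 4 * s).
  have : 2 * (S * (3 * q)) <= S ^+ 2 + (3 * q) ^+ 2.
    by have := sqr_ge0 (S - 3 * q); rewrite sqrrB; lra.
  have : (3 * q) ^+ 2 = 9 * s by rewrite exprMn qq; ring.
  rewrite SS; lra.
apply: (@le_trans _ _ (2 * S * (eta * q))).
  by rewrite ler_wpM2l // mulr_ge0.
by have := ler_wpM2l eta0 Sq; lra.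
Qed.

Variable eps0 : R.
Hypothesis eps0_gt0 : 0 < eps0.
Hypothesis small0 : small_variation (1 / 10) eps0.

(** Put A = y^2 + 4 (b - r) and eta = 1/10 in [cone_small]. The real part of Z^2 + A is at most 3/20
    A, so (Re Z)^2 + 17/20 A <= (Im Z)^2, which gives both the cone and the height. *)
Lemma cone_height g b y r : rflow U b g -> b <= T ->
  g b = (U b)%:C + 'i * y%:C -> 0 <= y -> 0 <= r -> r < b -> b - r <= eps0 ->
  in_cone g r /\ 17 / 20 * (y ^+ 2 + 4 * (b - r)) <= complex.Im (g r) ^+ 2.
Proof.
move=> Fg bT gb y0 r0 rb beps; have [|Y0 _] := Fg.2 r; first by rewrite r0.
have e1 : 0 <= 1 / 10 :> R by lra.
have e2 : 1 / 10 <= 1 / 2 :> R by lra.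
have := cone_small Fg bT gb y0 r0 (ltW rb) beps e1 e2 small0.
have A0 : 0 <= y ^+ 2 + 4 * (b - r).
  by rewrite addr_ge0 ?sqr_ge0 // mulr_ge0 // subr_ge0 ltW.
move: (y ^+ 2 + 4 * (b - r)) A0 => A A0.
set Z := g r - (U r)%:C => H; have := le_trans (le_Re_nm _) H.
have -> : complex.Re (Z ^+ 2 + A%:C) = complex.Re Z ^+ 2 - complex.Im Z ^+ 2 + A.
  by rewrite expr2; case: (Z) => u w /=; ring.
rewrite /in_cone -/Z ImB_real ler_norml => /andP[_ H2].
have XY : complex.Re Z ^+ 2 + 17 / 20 * A <= complex.Im (g r) ^+ 2 by lra.
split; last by have := sqr_ge0 (complex.Re Z); lra.
rewrite -ler_sqr ?nnegrE ?normr_ge0 ?(ltW Y0) // real_normK ?num_real //.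
lra.
Qed.

(** Two regimes that meet at time b - e. In the last stretch the cone contracts distances; before it
    the height is at least sqrt e, and Gronwall costs exp(4 / e T). *)
Lemma tip_lipschitz f g b e : rflow U b f -> rflow U b g -> 0 <= b -> b <= T ->
  0 < e ->
  (forall r, 0 <= r < b -> b - r <= e -> in_cone f r /\ in_cone g r) ->
  (forall r, 0 <= r < b -> b - r = e ->
     e <= complex.Im (f r) ^+ 2 /\ e <= complex.Im (g r) ^+ 2) ->
  forall r, 0 <= r -> r <= b ->
    nm (f r - g r) <= expR (4 / e * T) * nm (f b - g b).
Proof.
move=> Ff Fg b0 bT e0 cone low.
have T0 : 0 <= T by exact: le_trans bT.
have near r : 0 <= r -> r <= b -> b - r <= e -> nm (f r - g r) <= nm (f b - g b).
  move=> r0 rb bre; apply: (rflow_contract Ff Fg r0 rb) => x /andP[rx xb].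
  have xb0 : 0 <= x < b by rewrite (le_trans r0).
  by apply: cone => //; apply: le_trans bre; rewrite lerD2l lerN2.
move=> r r0 rb; have [bre|bre] := leP (b - r) e.
  apply: le_trans (near r r0 rb bre) _.
  rewrite ler_peMl ?nm_ge0 // -expR0 ler_expR mulr_ge0 //.
  by rewrite divr_ge0 // ltW.
set s := b - e.
have rs : r <= s by rewrite /s; lra.
have s0 : 0 <= s by exact: le_trans rs.
have sb : s < b by rewrite /s; lra.
have [||fs gs] := low s; [by rewrite s0|by rewrite /s; lra|].
have [|Yf _] := Ff.2 s; first by rewrite s0.
have [|Yg _] := Fg.2 s; first by rewrite s0.
have c0 : 0 < Num.sqrt e by rewrite sqrtr_gt0.
have Hlow h x : rflow U b h -> 0 < complex.Im (h s) ->
    e <= complex.Im (h s) ^+ 2 -> r <= x -> x < s -> Num.sqrt e <= complex.Im (h x).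
  move=> Fh Yh eh rx xs.
  apply: le_trans (rflow_Im_nonincreasing Fh (le_trans r0 rx) (ltW xs) (ltW sb)).
  by rewrite -(ger0_norm (ltW Yh)) -sqrtr_sqr ler_sqrt // sqr_ge0.
have := rflow_lipschitz (rflow_sub (ltW sb) Ff) (rflow_sub (ltW sb) Fg) r0 rs c0.
move=> /(_ _)/le_trans; apply.
  by move=> x /andP[rx xs]; split; apply: Hlow.
rewrite (sqr_sqrtr (ltW e0)); apply: ler_pM; rewrite ?expR_ge0 ?nm_ge0 //.
  rewrite ler_expR ler_wpM2l ?divr_ge0 ?(ltW e0) //; lra.
by apply: near => //; [exact: ltW|rewrite /s; lra].
Qed.

(* g is the orbit r |-> g_r(gamma_b) of the tip of the chain at time b, run
   backward from U b; the tip itself is g 0. *)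
Definition tip_flow b g := [/\ rflow U b g, g b = (U b)%:C &
  forall r, 0 <= r < b -> flow U r g].

(** The orbits [u n] ending at U b + i / 2^n differ, at every r, by at most K times their difference
    at b. They converge geometrically, uniformly up to the tip. *)
Lemma tip_flow_exists b : 0 < b -> b <= T -> exists g, tip_flow b g.
Proof.
move=> b0 bT; have T0 : 0 <= T by apply: le_trans bT; exact: ltW.
have cUb : cts 0 b (fun x => (U x)%:C) by exact: cts_sub cU.
pose y n : R := 1 / 2 ^+ n.
have y0 n : 0 < y n by rewrite divr_gt0 // exprn_gt0.
have /choice[u Hu] : forall n, exists g, g b = (U b)%:C + 'i * (y n)%:C /\ flow U b g.
  move=> n; apply: (flow_exists (ltW b0) (y0 n) cUb) => /=.
  by ring.
have ub n : u n b = (U b)%:C + 'i * (y n)%:C by case: (Hu n).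
have Fu n : rflow U b (u n) by apply: flow_rflow; case: (Hu n).
pose K := expR (4 / eps0 * T).
have K0 : 0 <= K by exact: expR_ge0.
have height n r : 0 <= r -> r < b -> b - r <= eps0 ->
    in_cone (u n) r /\ 17 / 5 * (b - r) <= complex.Im (u n r) ^+ 2.
  move=> r0 rb bre; have [] := cone_height (Fu n) bT (ub n) (ltW (y0 n)) r0 rb bre.
  by move=> h1 h2; split=> //; have := sqr_ge0 (y n); lra.
have lip n m r : 0 <= r -> r <= b -> nm (u n r - u m r) <= K * nm (u n b - u m b).
  apply: (tip_lipschitz (Fu n) (Fu m) (ltW b0) bT eps0_gt0).
    move=> x /andP[x0 xb] bx.
    by have [? _] := height n x x0 xb bx; have [] := height m x x0 xb bx.
  move=> x /andP[x0 xb] bx; have le0 : b - x <= eps0 by rewrite bx.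
  have [_] := height n x x0 xb le0; have [_] := height m x x0 xb le0.
  by rewrite bx; lra.
have cauchy r : 0 <= r -> r <= b -> forall n, nm (u n.+1 r - u n r) <= K / 2 ^+ n.
  move=> r0 rb n; apply: le_trans (lip _ _ r r0 rb) _; rewrite ler_wpM2l //.
  rewrite !ub.
  have -> : (U b)%:C + 'i * (y n.+1)%:C - ((U b)%:C + 'i * (y n)%:C) =
    'i * (y n.+1 - y n)%:C by rewrite rmorphB /=; ring.
  rewrite nmM nm_i mul1r nm_real /y exprS distrC ger0_norm; last first.
    rewrite subr_ge0 ler_pM2l // lef_pV2 ?posrE ?mulr_gt0 ?exprn_gt0 //.
    by rewrite ler_peMl ?exprn_ge0 // ler1n.
  by rewrite mul1r gerBl divr_ge0 // mulr_ge0 // exprn_ge0.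
have /choice[g Hg] : forall r, exists l : R[i], 0 <= r <= b ->
    forall n, nm (u n r - l) <= 4 * K / 2 ^+ n.
  move=> r; have [/andP[r0 rb]|nrb] := boolP (0 <= r <= b); last by exists 0.
  have [|l Hl] := @geometric_cauchy _ (fun n => u n r) K; last by exists l.
  exact: cauchy.
have cg : cts 0 b g.
  move=> x xb e e0; have e3 : 0 < e / 3 by lra.
  have [n Hn] := geometric_lt (4 * K) e3.
  have [d d0 Hd] := (Fu n).1 x xb _ e3.
  exists d => // z zb zd; have := Hd z zb zd.
  have := nm_tri (u n z) (g z) (g x); have := nm_tri (u n x) (u n z) (g x).
  by have := Hg x xb n; have := Hg z zb n; rewrite (nmC (u n z) (g z)); lra.
have limit_unique (z w : R[i]) C : (forall n, nm (z - w) <= C / 2 ^+ n) -> z = w.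
  move=> H; apply/eqP; rewrite -subr_eq0; apply/eqP/ComplexField.Normc.eq0_normc.
  apply/eqP; rewrite eq_le nm_ge0 andbT; apply/ler_addgt0Pr => e e0; rewrite add0r.
  by have [n Hn] := geometric_lt C e0; exact: le_trans (H n) Hn.
have gb : g b = (U b)%:C.
  apply: (limit_unique _ _ (4 * K + 1)) => n.
  apply: le_trans (nm_tri (u n b) _ _) _; rewrite [4 * K + 1]addrC mulrDl addrC.
  apply: lerD; last by rewrite nmC; apply: Hg; rewrite lexx ltW.
  by rewrite ub addrC addKr nmM nm_i mul1r nm_real gtr0_norm.
have Fg r : 0 <= r < b -> flow U r g.
  move=> /andP[r0 rb].
  (* r' lies in the last eps0 before b, where the height is known; monotonicity of the height
     carries the bound c back to [0, r]. *)
  pose r' := Num.max r (b - eps0).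
  have r'b : r' < b by rewrite /r' gt_max rb /= gtrBl.
  have rr' : r <= r' by rewrite /r' le_max lexx.
  have r'e : b - r' <= eps0.
    by rewrite /r' lerBlDr -lerBlDl le_max lexx orbT.
  pose c := Num.sqrt (17 / 5 * (b - r')).
  have c0 : 0 < c by rewrite sqrtr_gt0 mulr_gt0 ?subr_gt0 //; lra.
  have cu n x : 0 <= x -> x <= r -> c <= complex.Im (u n x).
    move=> x0 xr; have r'0 := le_trans r0 rr'.
    apply: le_trans (rflow_Im_nonincreasing (Fu n) x0 (le_trans xr rr') (ltW r'b)).
    have [_ H] := height n r' r'0 r'b r'e.
    have [|Y0 _] := (Fu n).2 r'; first by rewrite r'0.
    by rewrite -(ger0_norm (ltW Y0)) -sqrtr_sqr ler_sqrt // sqr_ge0.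
  have cgr : c <= complex.Im (g r).
    apply/ler_addgt0Pr => e e0; have [n Hn] := geometric_lt (4 * K) e0.
    have rb' : 0 <= r <= b by rewrite r0 ltW.
    have := le_trans (Hg r rb' n) Hn; have := le_Im_nm (u n r - g r).
    have := cu n r r0 (lexx _); case: (u n r) (g r) => ? ? [? ?] /=.
    by rewrite ler_norml => ? /andP[]; lra.
  have cUr : cts 0 r (fun x => (U x)%:C) by apply: cts_sub cUb => //; exact: ltW.
  (* The equation is not passed to the limit. P solves it with P r = g r, and the Lipschitz bound
     against [u n] forces P = g on [0, r]. *)
  have [P [Pr FP]] := flow_exists r0 (lt_le_trans c0 cgr) cUr (erefl _).
  have cP x : 0 <= x -> x <= r -> c <= complex.Im (P x).
    move=> x0 xr; apply: le_trans cgr _; rewrite -Pr.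
    exact: rflow_Im_nonincreasing (flow_rflow FP) x0 xr (lexx _).
  have Pg x : 0 <= x <= r -> P x = g x.
    move=> /andP[x0 xr]; have xb := le_trans xr (ltW rb).
    apply: (limit_unique _ _ (expR (4 / c ^+ 2 * (r - x)) * (4 * K) + 4 * K)) => n.
    apply: le_trans (nm_tri (u n x) _ _) _; rewrite mulrDl; apply: lerD; last first.
      by apply: Hg; rewrite x0.
    have := rflow_lipschitz (flow_rflow FP) (rflow_sub (ltW rb) (Fu n)) x0 xr c0.
    move=> /(_ _)/le_trans; apply.
      move=> z /andP[xz zr]; have z0 := le_trans x0 xz.
      by split; [apply: cP|apply: cu] => //; exact: ltW.
    rewrite -[leRHS]mulrA ler_wpM2l ?expR_ge0 // Pr nmC.
    by apply: Hg; rewrite r0 ltW.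
  move=> x xr; rewrite -Pg //; have [Y0 dP] := FP x xr; split=> //.
  exact: der_eq dP.
exists g; split=> //; split=> // x /andP[x0 xb].
(* A right derivative at x needs an interval that extends beyond x, hence the midpoint of x and
   b. *)
have [] := Fg ((x + b) / 2) _ x _; [apply/andP; split; lra|apply/andP; split; lra|].
by move=> Y0 dg; split=> //; apply: der_rder dg; apply/andP; split; lra.
Qed.

Lemma tip_flow_iy0 b g : tip_flow b g -> g b = (U b)%:C + 'i * 0%:C.
Proof. by case=> _ -> _; rewrite mulr0 addr0. Qed.

Lemma tip_flow_cone b g r : tip_flow b g -> b <= T -> 0 <= r -> r < b ->
  b - r <= eps0 ->
  in_cone g r /\ 17 / 5 * (b - r) <= complex.Im (g r) ^+ 2.
Proof.
move=> Fg bT r0 rb bre; have [Frg _ _] := Fg.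
have [] := cone_height Frg bT (tip_flow_iy0 Fg) (lexx _) r0 rb bre.
by move=> h1; rewrite expr0n add0r => h2; split=> //; lra.
Qed.

(** The cone estimate gives |Z|^2 <= (1 + 3/20) 4 (b - r), which is below 9 (b - r). *)
Lemma tip_flow_nm b g r : tip_flow b g -> b <= T -> 0 <= r -> r <= b ->
  b - r <= eps0 -> nm (g r - (U r)%:C) <= 3 * Num.sqrt (b - r).
Proof.
move=> Fg bT r0 rb bre; have [Frg _ _] := Fg.
have e1 : 0 <= 1 / 10 :> R by lra.
have e2 : 1 / 10 <= 1 / 2 :> R by lra.
have := cone_small Frg bT (tip_flow_iy0 Fg) (lexx _) r0 rb bre e1 e2 small0.
rewrite expr0n add0r => H.
have br : 0 <= b - r by rewrite subr_ge0.
rewrite -ler_sqr ?nnegrE ?nm_ge0 ?mulr_ge0 ?sqrtr_ge0 // exprMn sqr_sqrtr // -nmX2.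
have := nmB ((g r - (U r)%:C) ^+ 2 + (4 * (b - r))%:C) (4 * (b - r))%:C.
rewrite addrK nm_real ger0_norm ?mulr_ge0 //; lra.
Qed.

(** At time b the path g has reached U b, and g' is within 3 sqrt(b' - b) of it; [tip_lipschitz]
    carries this back. Taking e = eps0 / 2 keeps b' - x <= eps0, so g' is in the cone as well. *)
Lemma tip_flow_continuous b b' g g' r : tip_flow b g -> tip_flow b' g' ->
  0 < b -> b <= b' -> b' <= T -> b' - b <= eps0 / 2 -> 0 <= r -> r <= b ->
  nm (g' r - g r) <= 3 * expR (8 / eps0 * T) * Num.sqrt (b' - b).
Proof.
move=> Fg Fg' b0 bb' b'T bbe r0 rb.
have bT := le_trans bb' b'T.
have e0 : 0 < eps0 / 2 by rewrite divr_gt0.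
have [Frg gb _] := Fg; have [Frg' _ _] := Fg'.
have := tip_lipschitz (rflow_sub bb' Frg') Frg (ltW b0) bT e0.
move=> /(_ _ _ r r0 rb)/le_trans; apply.
- move=> x /andP[x0 xb] bx; split.
    by have [] := tip_flow_cone Fg' b'T x0 (lt_le_trans xb bb') _ => //; lra.
  by have [] := tip_flow_cone Fg bT x0 xb _ => //; lra.
- move=> x /andP[x0 xb] bx; split.
    have [] := tip_flow_cone Fg' b'T x0 (lt_le_trans xb bb') _ => //; lra.
  have [] := tip_flow_cone Fg bT x0 xb _ => //; lra.
rewrite gb.
have -> : 4 / (eps0 / 2) = 8 / eps0 by field; rewrite gt_eqF.
rewrite -mulrA mulrCA ler_wpM2l ?expR_ge0 //.
by apply: tip_flow_nm Fg' b'T (ltW b0) bb' _; lra.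
Qed.

End tip.

(** * Products and inverses of continuous functions *)

Section cts_algebra.
Context {R : realType}.
Implicit Types (a b x y e : R) (f g : R -> R[i]).

Lemma ctsM a b f g : a <= b -> cts a b f -> cts a b g ->
  cts a b (fun y => f y * g y).
Proof.
move=> ab cf cg x xab e e0.
have [c1 _ H1] := cts_nm_max ab cf; have [c2 _ H2] := cts_nm_max ab cg.
set M1 := nm _ in H1; set M2 := nm _ in H2.
have M10 : 0 <= M1 by exact: nm_ge0.
have M20 : 0 <= M2 by exact: nm_ge0.
pose e1 := e / (M1 + M2 + 1).
have e10 : 0 < e1 by rewrite divr_gt0 //; lra.
have [d d0 Hd] := cf x xab _ e10; have [d' d'0 Hd'] := cg x xab _ e10.
exists (Num.min d d'); first by rewrite lt_min d0.
move=> y yab; rewrite lt_min => /andP[yd yd'].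
have -> : f y * g y - f x * g x = (f y - f x) * g y + f x * (g y - g x) by ring.
apply: le_trans (nmD _ _) _; rewrite !nmM.
have : nm (f y - f x) * nm (g y) <= e1 * M2.
  by apply: ler_pM; rewrite ?nm_ge0 //; [exact: Hd|exact: H2].
have : nm (f x) * nm (g y - g x) <= M1 * e1.
  by apply: ler_pM; rewrite ?nm_ge0 //; [exact: H1|exact: Hd'].
have : e1 * (M1 + M2 + 1) = e by rewrite /e1; field; lra.
move: (nm _ * nm _) (nm _ * nm _) => u w; nra.
Qed.

Lemma ctsV a b f : a <= b -> cts a b f -> (forall x, a <= x <= b -> f x != 0) ->
  cts a b (fun y => (f y)^-1).
Proof.
move=> ab cf f0 x xab e e0.
have [c cab Hc] := cts_nm_min ab cf.
set m := nm _ in Hc; have m0 : 0 < m by rewrite nm_gt0 f0.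
have [d d0 Hd] := cf x xab (e * m ^+ 2) (mulr_gt0 e0 (exprn_gt0 _ m0)).
exists d => // y yab yd.
have -> : (f y)^-1 - (f x)^-1 = - (f y - f x) / (f y * f x).
  by field; rewrite !f0.
rewrite nmf_div nmN ler_pdivrMr ?nm_gt0 ?mulf_neq0 ?f0 //.
apply: le_trans (Hd y yab yd) _; rewrite ler_pM2l // nmM expr2.
by apply: ler_pM; rewrite ?(ltW m0) // Hc.
Qed.

End cts_algebra.

(** * The reference path of the zero driver *)

Section sqrt_flow.
Context {R : realType}.
Implicit Types (b x y p q : R).

Lemma sqrtB_le p q : 0 <= q -> q <= p -> Num.sqrt p - Num.sqrt q <= Num.sqrt (p - q).
Proof.
move=> q0 qp; have p0 := le_trans q0 qp.
have pq0 : 0 <= p - q by rewrite subr_ge0.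
rewrite lerBlDr -ler_sqr ?nnegrE ?addr_ge0 ?sqrtr_ge0 // sqrrD !sqr_sqrtr //.
have := mulr_ge0 (sqrtr_ge0 (p - q)) (sqrtr_ge0 q); lra.
Qed.

Lemma sqrt_dist p q : 0 <= q -> 0 <= p -> `|Num.sqrt p - Num.sqrt q| <= Num.sqrt `|p - q|.
Proof.
move=> q0 p0; wlog qp : p q q0 p0 / q <= p.
  have [qp|pq] := leP q p; first by apply.
  by move=> /(_ q p); rewrite distrC (distrC p); apply=> //; exact: ltW.
rewrite !ger0_norm ?subr_ge0 ?ler_sqrt //; exact: sqrtB_le.
Qed.

(* The path of the chain with zero driver, the reference for all comparisons. *)
Definition sqrt_path b x : R[i] := 'i * (2 * Num.sqrt (b - x))%:C.

Lemma sqrt_path_sqr b x : x <= b -> sqrt_path b x ^+ 2 = - (4 * (b - x))%:C.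
Proof.
move=> xb; rewrite /sqrt_path exprMn sqr_i -rmorphXn /= exprMn sqr_sqrtr ?subr_ge0 //.
by rewrite mulN1r -natrX.
Qed.

Lemma nm_sqrt_path b x : nm (sqrt_path b x) = 2 * Num.sqrt (b - x).
Proof.
by rewrite nmM nm_i mul1r nm_real ger0_norm // mulr_ge0 // sqrtr_ge0.
Qed.

Lemma nm_sqrt_pathB b b' x y : x <= b -> y <= b' ->
  nm (sqrt_path b x - sqrt_path b' y) <= 2 * Num.sqrt `|(b - x) - (b' - y)|.
Proof.
move=> xb yb.
have -> : sqrt_path b x - sqrt_path b' y =
    'i * (2 * (Num.sqrt (b - x) - Num.sqrt (b' - y)))%:C.
  by rewrite /sqrt_path mulrBr rmorphB /=; ring.
rewrite nmM nm_i mul1r nm_real normrM.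
by rewrite ger0_norm // ler_pM2l // sqrt_dist ?subr_ge0.
Qed.

(** Being itself an orbit, the reference path is covered by [rflow_logderB], which therefore treats
    numerator and denominator of a slope alike. *)
Lemma sqrt_path_rflow b : 0 <= b -> rflow (fun=> 0) b (sqrt_path b).
Proof.
move=> b0; split.
  move=> x /andP[x0 xb] e e0; exists ((e / 2) ^+ 2); first by rewrite exprn_gt0 // divr_gt0.
  move=> y /andP[y0 yb] yd; apply: le_trans (nm_sqrt_pathB yb xb) _.
  rewrite -ler_pdivlMl // -[leRHS]ger0_norm ?mulr_ge0 ?(ltW e0) //.
  rewrite -(sqrtr_sqr (2^-1 * e)) ler_sqrt ?sqr_ge0 // mulrC; apply: le_trans (ltW yd).
  by rewrite opprB addrC addrA subrK distrC.
move=> x /andP[x0 xb]; have p0 : 0 < b - x by rewrite subr_gt0.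
have sp0 : 0 < Num.sqrt (b - x) by rewrite sqrtr_gt0.
split; first by rewrite /= !mul0r mul1r add0r mulr_gt0.
rewrite subr0 => e e0.
have ep : 0 < e * (b - x) by rewrite mulr_gt0.
exists (Num.min (b - x) ((e * (b - x)) ^+ 2)); first by rewrite lt_min p0 exprn_gt0.
move=> y /andP[xy]; rewrite -ltrBlDl lt_min => /andP[yb ye].
have h0 : 0 < y - x by rewrite subr_gt0.
have yb' : y < b by lra.
have q0 : 0 <= b - y by rewrite subr_ge0 ltW.
have hle : Num.sqrt (b - x) - Num.sqrt (b - y) <= e * (b - x).
  apply: le_trans (sqrtB_le q0 _) _; first by lra.
  rewrite -[leRHS]ger0_norm ?(ltW ep) // -sqrtr_sqr ler_sqrt ?sqr_ge0 //.
  by apply: le_trans (ltW ye); rewrite le_eqVlt; apply/orP; left; apply/eqP; ring.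
have sq0 : 0 <= Num.sqrt (b - y) by exact: sqrtr_ge0.
have pE : Num.sqrt (b - x) ^+ 2 = b - x by rewrite sqr_sqrtr // ltW.
have qE : Num.sqrt (b - y) ^+ 2 = b - y by rewrite sqr_sqrtr.
have hE : y - x = Num.sqrt (b - x) ^+ 2 - Num.sqrt (b - y) ^+ 2 by rewrite pE qE; ring.
have sqp : Num.sqrt (b - y) <= Num.sqrt (b - x).
  by rewrite ler_sqrt ?(ltW p0) //; lra.
rewrite /sqrt_path.
move: (Num.sqrt (b - x)) (Num.sqrt (b - y)) sp0 sq0 pE hE hle sqp {qE} => p q p1 q1 pE hE hle qp.
have pC : (p%:C : R[i]) != 0 by rewrite -nm_gt0 nm_real gtr0_norm.
have iC : ('i : R[i]) != 0 by rewrite -nm_gt0 nm_i.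
have -> : 'i * (2 * q)%:C - 'i * (2 * p)%:C - (y - x)%:C * (2 / ('i * (2 * p)%:C)) =
    'i * ((p - q) ^+ 2 / p * -1)%:C :> R[i].
  have i2 : 2 / ('i * (2 * p)%:C) = - 'i * (p%:C)^-1 :> R[i].
    have -> : - 'i = 'i ^-1 :> R[i] by apply: (mulfI iC); rewrite mulfV // mulrN -expr2 sqr_i opprK.
    by rewrite rmorphM rmorph_nat; field; rewrite iC pC.
  rewrite i2 hE !(rmorphM, rmorphB, rmorphXn, rmorphN, rmorph1, fmorphV, rmorph_nat) /=; field.
  exact: pC.
rewrite nmM nm_i mul1r nm_real normrM normrN1 mulr1 ger0_norm; last first.
  by rewrite divr_ge0 ?sqr_ge0 // ltW.
rewrite ler_pdivrMr // expr2.
have pq0 : 0 <= p - q by rewrite subr_ge0.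
apply: (@le_trans _ _ ((p - q) * (e * p ^+ 2))); first by rewrite ler_wpM2l // pE.
have -> : e * (y - x) * p = (p - q) * (e * ((p + q) * p)) by rewrite hE; ring.
rewrite ler_wpM2l // ler_pM2l // expr2 ler_wpM2r ?(ltW p1) //; lra.
Qed.

End sqrt_flow.

(** * Slopes of two paths near their tips *)

Section slopes.
Context {R : realType}.
Variables (T : R) (U v : R -> R).
Hypothesis cU : cts 0 T (fun x => (U x)%:C).
Hypothesis vU : forall x y, 0 <= x -> x <= y -> y <= T ->
  `|U y - U x| <= v y - v x.
Hypothesis cv : cts 0 T (fun x => (v x)%:C).
Implicit Types (r s t x y b : R) (f g : R -> R[i]).

(* J s stands for the integral of r^(-1/2) over ]0, s] against the variation
   measure seen backward from b. *)
Definition small_integral (eta eps : R) := forall b, 0 < b <= T ->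
  exists J : R -> R, [/\ J 0 = 0,
    forall s, 0 < s -> s <= b -> s <= eps ->
      (v b - v (b - s)) / Num.sqrt s <= J s /\ J s <= eta &
    forall s' s, 0 < s' -> s' <= s -> s <= b -> s <= eps ->
      (v (b - s') - v (b - s)) / Num.sqrt s <= J s - J s'].

(** The integral dominates the variation because r^(-1/2) >= s^(-1/2) on ]0, s]. This is how the
    cone estimates obtain their hypothesis. *)
Lemma small_integral_variation eta eps : small_integral eta eps ->
  small_variation T v eta eps.
Proof.
move=> H x y x0; rewrite le_eqVlt => /orP[/eqP ->|xy] yT yxe.
  by rewrite !subrr sqrtr0 mulr0.
have [|J [_ H1 _]] := H y; first by rewrite yT (le_lt_trans x0).
have yx0 : 0 < y - x by rewrite subr_gt0.
have [|h1 h2] := H1 (y - x) yx0 _ yxe; first by rewrite lerBlDr lerDl.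
have := le_trans h1 h2; have -> : y - (y - x) = x by ring.
by rewrite ler_pdivrMr ?sqrtr_gt0.
Qed.

Lemma small_integral_le eta eps eps' : eps' <= eps -> small_integral eta eps ->
  small_integral eta eps'.
Proof.
move=> le_eps H b /H[J [J0 J1 J2]]; exists J; split=> // [s s0 sb se|s' s s'0 ss' sb se].
  by apply: J1 => //; exact: le_trans le_eps.
by apply: J2 => //; exact: le_trans le_eps.
Qed.

Variable eps0 : R.
Hypothesis eps0_gt0 : 0 < eps0.
Hypothesis small0 : small_variation T v (1 / 10) eps0.

Lemma tip_flow_ratio b g r (eta eps : R) : tip_flow U b g -> b <= T -> 0 <= r ->
  r < b -> b - r <= eps -> eta <= 1 / 2 -> small_variation T v eta eps ->
  nm ((g r - (U r)%:C) / sqrt_path b r - 1) <=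
    3 / 2 * ((v b - v r) / Num.sqrt (b - r)).
Proof.
move=> Fg bT r0 rb bre eta2 Hs; have [Frg _ _] := Fg.
have p0 : 0 < b - r by rewrite subr_gt0.
have := rflow_cone cU vU Frg bT (tip_flow_iy0 Fg) (lexx _) r0 (ltW rb) eta2 _.
rewrite expr0n mulr0 !add0r => /(_ _) H.
have {H} := H _; move=> /(_ _) H.
have {H}H : nm ((g r - (U r)%:C) ^+ 2 + (4 * (b - r))%:C) <=
    2 * Num.sqrt (9 * (b - r)) * (v b - v r).
  apply: H => x /andP[rx xb]; apply: Hs => //; first exact: le_trans rx.
  by apply: le_trans bre; rewrite lerD2l lerN2.
have [|Y0 _] := Frg.2 r; first by rewrite r0.
set F := sqrt_path b r; set Z := g r - (U r)%:C in H *.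
have sp0 : 0 < Num.sqrt (b - r) by rewrite sqrtr_gt0.
have F0 : F != 0 by rewrite -nm_gt0 nm_sqrt_path mulr_gt0.
have F2 : F ^+ 2 = - (4 * (b - r))%:C by rewrite sqrt_path_sqr // ltW.
have re1 : 1 <= nm (Z / F + 1).
  apply: le_trans (le_Re_nm _); apply: le_trans (ler_norm _).
  have -> : Z / F + 1 = 'i^-1 * ((2 * Num.sqrt (b - r))%:C^-1 * Z) + 1.
    have pC : (2 * Num.sqrt (b - r))%:C != 0 :> R[i].
      by rewrite -nm_gt0 nm_real normr_gt0 mulf_neq0 // gt_eqF.
    have iC : 'i != 0 :> R[i] by rewrite -nm_gt0 nm_i.
    move: pC; rewrite /F /sqrt_path; move: ((2 * Num.sqrt (b - r))%:C) => c pC.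
    by field; rewrite pC iC.
  have -> : 'i^-1 = - 'i :> R[i].
    have iC : 'i != 0 :> R[i] by rewrite -nm_gt0 nm_i.
    by apply: (mulfI iC); rewrite mulfV // mulrN -expr2 sqr_i opprK.
  rewrite -fmorphV.
  have : 0 < complex.Im Z by rewrite ImB_real.
  case: Z {H} => u w /= w0.
  have := mulr_ge0 (ltW w0) (ltW (divr_gt0 ltr01 (mulr_gt0 (ltr0Sn _ 1) sp0))).
  rewrite mul1r; move: (_^-1) => c; lra.
have : nm (Z / F - 1) <= nm (Z / F - 1) * nm (Z / F + 1) by rewrite ler_peMr ?nm_ge0.
rewrite -nmM; have -> : (Z / F - 1) * (Z / F + 1) = (Z ^+ 2 - F ^+ 2) / F ^+ 2 by field.
rewrite nmf_div F2 opprK nmN nm_real ger0_norm; last by rewrite mulr_ge0 // ltW.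
move=> /le_trans; apply; rewrite ler_pdivrMr ?mulr_gt0 //; apply: le_trans H _.
have s9 : Num.sqrt (9 * (b - r)) = 3 * Num.sqrt (b - r).
  have -> : 9 * (b - r) = (3 * Num.sqrt (b - r)) ^+ 2.
    by rewrite exprMn sqr_sqrtr ?(ltW p0) //; ring.
  by rewrite sqrtr_sqr ger0_norm // mulr_ge0 // ltW.
rewrite s9 -{3}[b - r]sqr_sqrtr ?(ltW p0) // expr2.
by move: (Num.sqrt _) sp0 => q q0; rewrite le_eqVlt; apply/orP; left; apply/eqP; field; rewrite gt_eqF.
Qed.

(* Normalised difference of two paths; at r = 0 it is a difference quotient of
   the square-root parametrised trace, up to the factor 2i. *)
Definition path_slope b b' g g' r :=
  (g' r - g r) / (sqrt_path b' r - sqrt_path b r).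

Definition path_slope_rate b b' g g' r : R[i] :=
  - 2 / ((g' r - (U r)%:C) * (g r - (U r)%:C)) +
  2 / (sqrt_path b' r * sqrt_path b r).

Lemma sqrt_pathB_neq0 b b' r : 0 <= b -> b < b' -> r <= b ->
  sqrt_path b' r - sqrt_path b r != 0.
Proof.
move=> b0 bb' rb; rewrite /sqrt_path -mulrBr -rmorphB /= -mulrBr.
rewrite -nm_gt0 nmM nm_i mul1r nm_real normr_gt0 mulf_neq0 // subr_eq0.
rewrite gt_eqF // ltr_sqrt; last by rewrite subr_gt0 (le_lt_trans rb).
by rewrite ltrD2r.
Qed.

Lemma path_slope_logder b b' g g' r : rflow U b g -> rflow U b' g' ->
  0 <= r -> r < b -> b < b' ->
  logder (path_slope b b' g g') r (path_slope_rate b b' g g' r).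
Proof.
move=> Fg Fg' r0 rb bb'; have b0 : 0 <= b by exact: ltW (le_lt_trans r0 rb).
have rb0 : 0 <= r < b by rewrite r0.
have H1 := rflow_logderB (rflow_sub (ltW bb') Fg') Fg rb0.
have b'0 : 0 <= b' by rewrite (le_trans b0) // ltW.
have H2 := rflow_logderB (rflow_sub (ltW bb') (sqrt_path_rflow b'0)) (sqrt_path_rflow b0) rb0.
have H3 := logderV (sqrt_pathB_neq0 b0 bb' (ltW rb)) H2.
have := logderM H1 H3; rewrite rmorph0 !subr0 !mulNr opprK.
by rewrite /path_slope_rate mulNr.
Qed.

Lemma path_slope_cts b b' g g' : rflow U b g -> rflow U b' g' ->
  0 <= b -> b < b' -> cts 0 b (path_slope b b' g g').
Proof.
move=> Fg Fg' b0 bb'; have b'0 : 0 <= b' by rewrite (le_trans b0) // ltW.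
apply: ctsM => //.
  by apply: ctsB; [exact: (rflow_sub (ltW bb') Fg').1|exact: Fg.1].
apply: ctsV => //.
  by apply: ctsB; [exact: (rflow_sub (ltW bb') (sqrt_path_rflow b'0)).1|exact: (sqrt_path_rflow b0).1].
by move=> x /andP[x0 xb]; exact: sqrt_pathB_neq0.
Qed.

(** Meant for mu = Z/F - 1 and mu' = Z'/F' - 1, whose bound 3/2 eta is 3/20 at eta = 1/10. Each
    factor 1 + mu has modulus at least 17/20, and 1 + 3/20 <= 2 (17/20)^2. *)
Lemma perturbation_bound (m m' : R) (mu mu' : R[i]) :
  nm mu <= m -> nm mu' <= m' -> m <= 3 / 20 -> m' <= 3 / 20 ->
  nm (1 - ((1 + mu) * (1 + mu'))^-1) <= 2 * (m + m').
Proof.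
move=> Hm Hm' m15 m'15.
have m0 : 0 <= m by apply: le_trans Hm; exact: nm_ge0.
have m'0 : 0 <= m' by apply: le_trans Hm'; exact: nm_ge0.
have low (w : R[i]) c : nm w <= c -> c <= 3 / 20 -> 17 / 20 <= nm (1 + w).
  by move=> wc c15; have := nmB_ge 1 (- w); rewrite nmN nm1 opprK; lra.
have l1 := low _ _ Hm m15; have l2 := low _ _ Hm' m'15.
have n1 : 1 + mu != 0 by rewrite -nm_gt0; lra.
have n2 : 1 + mu' != 0 by rewrite -nm_gt0; lra.
have -> : 1 - ((1 + mu) * (1 + mu'))^-1 = (mu + mu' + mu * mu') / ((1 + mu) * (1 + mu')).
  by field; rewrite n1 n2.
rewrite nmf_div ler_pdivrMr ?nm_gt0 ?mulf_neq0 //.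
have h1 : nm (mu + mu' + mu * mu') <= m + m' + m * m'.
  apply: le_trans (nmD _ _) _; apply: lerD.
    by apply: le_trans (nmD _ _) _; apply: lerD.
  by rewrite nmM; apply: ler_pM => //; exact: nm_ge0.
have h2 : 17 / 20 * (17 / 20) <= nm ((1 + mu) * (1 + mu')).
  by rewrite nmM; apply: ler_pM.
have h3 : m * m' <= 3 / 20 * m' by rewrite ler_wpM2r.
apply: le_trans h1 _; have := ler_wpM2l (addr_ge0 m0 m'0) h2; lra.
Qed.

(** The variation seen from b' is split at b. The part between b and b' is at most eta sqrt(b' - b)
    and gives the scale-invariant second term; the part before b merges with the contribution of the
    shorter path. *)
Lemma path_slope_rate_near b b' g g' r (eta eps : R) : tip_flow U b g ->
  tip_flow U b' g' -> b' <= T -> 0 <= r -> r < b -> b < b' -> b' - r <= eps ->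
  0 <= eta -> eta <= 1 / 10 -> small_variation T v eta eps ->
  nm (path_slope_rate b b' g g' r) <=
    3 * ((v b - v r) / ((b - r) * Num.sqrt (b - r))) +
    3 / 2 * eta * (Num.sqrt (b' - b) / ((b' - r) * Num.sqrt (b - r))).
Proof.
move=> Fg Fg' b'T r0 rb bb' b're eta0 eta10 Hs.
have bT : b <= T by rewrite (le_trans (ltW bb')).
have eta2 : eta <= 1 / 2 by lra.
have rb' := lt_trans rb bb'.
have br_e : b - r <= eps by apply: le_trans b're; rewrite lerD2r ltW.
have H := tip_flow_ratio Fg bT r0 rb br_e eta2 Hs.
have H' := tip_flow_ratio Fg' b'T r0 rb' b're eta2 Hs.
have p0 : 0 < b - r by rewrite subr_gt0.
have p'0 : 0 < b' - r by rewrite subr_gt0.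
have q0 : 0 < Num.sqrt (b - r) by rewrite sqrtr_gt0.
have q'0 : 0 < Num.sqrt (b' - r) by rewrite sqrtr_gt0.
have w15 x : r < x -> x <= T -> x - r <= eps ->
    3 / 2 * ((v x - v r) / Num.sqrt (x - r)) <= 3 / 20.
  move=> rx xT xe; have sx : 0 < Num.sqrt (x - r) by rewrite sqrtr_gt0 subr_gt0.
  have : (v x - v r) / Num.sqrt (x - r) <= eta.
    by rewrite ler_pdivrMr //; apply: Hs => //; exact: ltW.
  lra.
set Z := g r - (U r)%:C in H; set Z' := g' r - (U r)%:C in H'.
set F := sqrt_path b r in H; set F' := sqrt_path b' r in H'.
have F0 : F != 0 by rewrite -nm_gt0 nm_sqrt_path mulr_gt0.
have F'0 : F' != 0 by rewrite -nm_gt0 nm_sqrt_path mulr_gt0.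
have Z0 : Z != 0 by apply: (rflow_neq0 (b := b)); [case: Fg|rewrite r0].
have Z'0 : Z' != 0 by apply: (rflow_neq0 (b := b')); [case: Fg'|rewrite r0].
have -> : path_slope_rate b b' g g' r =
    2 / (F' * F) * (1 - ((1 + (Z' / F' - 1)) * (1 + (Z / F - 1)))^-1).
  rewrite /path_slope_rate -/Z -/Z' -/F -/F'; clearbody Z Z' F F'.
  have zw (z w : R[i]) : z + (w + -1 * z) = w by ring.
  by field; rewrite !zw F0 F'0 Z0 Z'0.
rewrite nmM nmf_div nm_nat nmM !nm_sqrt_path.
have := perturbation_bound H' H (w15 b' rb' b'T b're) (w15 b rb bT br_e).
set N := nm _ => HN.
have hE : 0 <= b' - b by rewrite subr_ge0 ltW.
have vh : v b' - v b <= eta * Num.sqrt (b' - b).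
  apply: Hs => //; [exact: le_trans (ltW rb)|exact: ltW|].
  by apply: le_trans b're; rewrite lerD2l lerN2 ltW.
have vr : 0 <= v b - v r.
  by rewrite subr_ge0; apply: (dominating_nondecreasing vU) => //; exact: ltW.
have pE : b - r = Num.sqrt (b - r) ^+ 2 by rewrite sqr_sqrtr // ltW.
have p'E : b' - r = Num.sqrt (b' - r) ^+ 2 by rewrite sqr_sqrtr // ltW.
have qq' : Num.sqrt (b - r) <= Num.sqrt (b' - r).
  by rewrite ler_sqrt ?(ltW p'0) // lerD2r ltW.
rewrite {2}pE {2}p'E.
move: (Num.sqrt (b - r)) (Num.sqrt (b' - r)) (Num.sqrt (b' - b)) q0 q'0 qq' vh HN.
move=> q q' h q0 q'0 qq' vh HN.
apply: (@le_trans _ _ (2 / (2 * q' * (2 * q)) * (2 * (3 / 2 * ((v b' - v r) / q') + 3 / 2 * ((v b - v r) / q))))).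
  by rewrite ler_wpM2l // divr_ge0 // !mulr_ge0 // ltW.
have -> : 2 / (2 * q' * (2 * q)) * (2 * (3 / 2 * ((v b' - v r) / q') + 3 / 2 * ((v b - v r) / q))) =
  3 / 2 * ((v b' - v b) / (q' ^+ 2 * q)) + 3 / 2 * ((v b - v r) / (q' ^+ 2 * q) + (v b - v r) / (q' * q ^+ 2)).
  by field; rewrite !gt_eqF.
have i1 : (v b - v r) / (q' ^+ 2 * q) <= (v b - v r) / (q ^+ 2 * q).
  rewrite ler_wpM2l // lef_pV2 ?posrE ?mulr_gt0 ?exprn_gt0 //.
  by rewrite ler_pM2r // ler_sqr ?nnegrE // ltW.
have i2 : (v b - v r) / (q' * q ^+ 2) <= (v b - v r) / (q ^+ 2 * q).
  rewrite ler_wpM2l // lef_pV2 ?posrE ?mulr_gt0 ?exprn_gt0 //.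
  by rewrite mulrC ler_pM2r // exprn_gt0.
have i3 : (v b' - v b) / (q' ^+ 2 * q) <= eta * (h / (q' ^+ 2 * q)).
  by rewrite mulrA ler_pM2r // invr_gt0 mulr_gt0 // exprn_gt0.
lra.
Qed.

(* Bounds p^(-3/2) w by the increments of a bounded function: formally
   2 (w p^(-1/2) - J) has derivative w p^(-3/2) along dw = - p^(1/2) dJ. *)
Lemma variation_potential_increment b (eta eps : R) (J : R -> R) x y :
  (forall s' s, 0 < s' -> s' <= s -> s <= b -> s <= eps ->
    (v (b - s') - v (b - s)) / Num.sqrt s <= J s - J s') ->
  b <= T -> 0 <= x -> x < y -> y < b -> b - x <= eps -> 0 <= eta ->
  (v b - v y) / ((b - x) * Num.sqrt (b - x)) * (y - x) <=
  2 * ((v b - v y) / Num.sqrt (b - y) - J (b - y)) -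
  2 * ((v b - v x) / Num.sqrt (b - x) - J (b - x)).
Proof.
move=> HJ bT x0 xy yb bxe eta0.
have p0 : 0 < b - x by rewrite subr_gt0 (lt_trans xy).
have p'0 : 0 < b - y by rewrite subr_gt0.
have := HJ (b - y) (b - x) p'0 _ _ bxe.
have -> : b - (b - y) = y by ring.
have -> : b - (b - x) = x by ring.
move=> /(_ _ _) HJ'.
have {HJ'}HJ' : (v y - v x) / Num.sqrt (b - x) <= J (b - x) - J (b - y).
  by apply: HJ'; [rewrite lerD2l lerN2 ltW|rewrite lerBlDr lerDl].
have q0 : 0 < Num.sqrt (b - x) by rewrite sqrtr_gt0.
have q'0 : 0 < Num.sqrt (b - y) by rewrite sqrtr_gt0.
have qq : Num.sqrt (b - x) ^+ 2 = b - x by rewrite sqr_sqrtr // ltW.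
have q'q' : Num.sqrt (b - y) ^+ 2 = b - y by rewrite sqr_sqrtr // ltW.
have q'q : Num.sqrt (b - y) <= Num.sqrt (b - x).
  by rewrite ler_sqrt ?(ltW p0) // lerD2l lerN2 ltW.
have w0 : 0 <= v b - v y.
  rewrite subr_ge0; apply: (dominating_nondecreasing vU) => //; last exact: ltW.
  by rewrite (le_trans x0) // ltW.
have yxE : y - x = Num.sqrt (b - x) ^+ 2 - Num.sqrt (b - y) ^+ 2.
  by rewrite qq q'q'; ring.
rewrite yxE -{1}qq; move: (Num.sqrt (b - x)) (Num.sqrt (b - y)) q0 q'0 q'q HJ'.
move=> q q' q0 q'0 q'q HJ'.
have step : (v b - v y) / (q ^+ 2 * q) * (q ^+ 2 - q' ^+ 2) <=
    2 * ((v b - v y) * (q'^-1 - q^-1)).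
  have -> : 2 * ((v b - v y) * (q'^-1 - q^-1)) =
      (v b - v y) * ((q - q') * (2 / (q * q'))) by field; rewrite !gt_eqF.
  have -> : (v b - v y) / (q ^+ 2 * q) * (q ^+ 2 - q' ^+ 2) =
      (v b - v y) * ((q - q') * ((q + q') / (q ^+ 2 * q))).
    by field; rewrite gt_eqF.
  apply: ler_wpM2l => //; apply: ler_wpM2l; first by rewrite subr_ge0.
  rewrite ler_pdivrMr ?mulr_gt0 ?exprn_gt0 // mulrAC ler_pdivlMr ?mulr_gt0 //.
  have : (q + q') * (q * q') <= (2 * q) * (q * q).
    apply: ler_pM; rewrite ?addr_ge0 ?mulr_ge0 ?(ltW q0) ?(ltW q'0) //; first by lra.
    by rewrite ler_pM2l.
  by rewrite expr2; lra.
apply: le_trans step _.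
(* The variation between x and y is paid for by the decrease of J. *)
have -> : (v b - v x) / q = (v b - v y) / q + (v y - v x) / q by ring.
lra.
Qed.

(** With q = sqrt(b - x) and s = sqrt(b' - b) the integrand is 2 s / (q^2 + s^2) dq, whose primitive
    is 2 arctan(q / s). The rational q / (q + s) replaces it: its derivative s / (q + s)^2 is at
    least s / (2 (q^2 + s^2)). As it lies in [0, 1], the total is bounded independently of b' -
    b. *)
Lemma sqrt_potential_increment b b' x y : x < y -> y <= b -> b < b' ->
  Num.sqrt (b' - b) / ((b' - x) * Num.sqrt (b - x)) * (y - x) <=
  4 * (Num.sqrt (b - x) / (Num.sqrt (b - x) + Num.sqrt (b' - b)) -
       Num.sqrt (b - y) / (Num.sqrt (b - y) + Num.sqrt (b' - b))).
Proof.
move=> xy yb bb'.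
have p0 : 0 < b - x by rewrite subr_gt0 (lt_le_trans xy).
have p'0 : 0 <= b - y by rewrite subr_ge0.
have h0 : 0 < b' - b by rewrite subr_gt0.
have q0 : 0 < Num.sqrt (b - x) by rewrite sqrtr_gt0.
have s0 : 0 < Num.sqrt (b' - b) by rewrite sqrtr_gt0.
have q'0 : 0 <= Num.sqrt (b - y) by exact: sqrtr_ge0.
have qq : Num.sqrt (b - x) ^+ 2 = b - x by rewrite sqr_sqrtr // ltW.
have ss : Num.sqrt (b' - b) ^+ 2 = b' - b by rewrite sqr_sqrtr // ltW.
have q'q' : Num.sqrt (b - y) ^+ 2 = b - y by rewrite sqr_sqrtr.
have q'q : Num.sqrt (b - y) <= Num.sqrt (b - x).
  by rewrite ler_sqrt ?(ltW p0) // lerD2l lerN2 ltW.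
have -> : y - x = Num.sqrt (b - x) ^+ 2 - Num.sqrt (b - y) ^+ 2.
  by rewrite qq q'q'; ring.
have -> : b' - x = Num.sqrt (b - x) ^+ 2 + Num.sqrt (b' - b) ^+ 2.
  by rewrite qq ss; ring.
move: (Num.sqrt (b - x)) (Num.sqrt (b - y)) (Num.sqrt (b' - b)) q0 q'0 s0 q'q.
move=> q q' s q0 q'0 s0 q'q.
have qs0 : 0 < q + s by rewrite addr_gt0.
have q's0 : 0 < q' + s by rewrite ltr_wpDl.
have Q0 : 0 < q ^+ 2 + s ^+ 2 by rewrite addr_gt0 // exprn_gt0.
have -> : q / (q + s) - q' / (q' + s) = s * (q - q') / ((q + s) * (q' + s)).
  by field; rewrite !gt_eqF.
have -> : s / ((q ^+ 2 + s ^+ 2) * q) * (q ^+ 2 - q' ^+ 2) =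
  s * (q - q') * ((q + q') / ((q ^+ 2 + s ^+ 2) * q)).
  by field; rewrite !gt_eqF.
have -> : 4 * (s * (q - q') / ((q + s) * (q' + s))) =
  s * (q - q') * (4 / ((q + s) * (q' + s))) by ring.
apply: ler_wpM2l; first by rewrite mulr_ge0 ?subr_ge0 // ltW.
rewrite ler_pdivrMr ?mulr_gt0 // mulrAC ler_pdivlMr ?mulr_gt0 //.
have i1 : (q + s) * (q' + s) <= (q + s) ^+ 2 by rewrite expr2 ler_pM2l // lerD2r.
have i2 : (q + s) ^+ 2 <= 2 * (q ^+ 2 + s ^+ 2).
  by have := sqr_ge0 (q - s); rewrite sqrrB sqrrD; lra.
have : (q + q') * ((q + s) * (q' + s)) <= (2 * q) * (2 * (q ^+ 2 + s ^+ 2)).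
  apply: ler_pM; [by rewrite addr_ge0 // ltW|by rewrite mulr_ge0 // ltW|lra|lra].
lra.
Qed.

(** At r = b the slope is the ratio of [tip_flow_ratio], within 3/2 eta of 1. Going back,
    [logder_variation] with theta = 12 eta adds at most 24 eta (1 + 3/2 eta), and the sum stays
    below 30 eta. *)
Lemma path_slope_near b b' g g' r (eta eps : R) : tip_flow U b g ->
  tip_flow U b' g' -> b' <= T -> 0 < b -> b < b' -> 0 <= r -> r <= b ->
  b' - r <= eps -> 0 <= eta -> eta <= 1 / 100 -> small_integral eta eps ->
  nm (path_slope b b' g g' r - 1) <= 30 * eta.
Proof.
move=> Fg Fg' b'T b0 bb' r0 rb b're eta0 eta100 Hint.
have Hs := small_integral_variation Hint.
have bT : b <= T by rewrite (le_trans (ltW bb')).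
have eta10 : eta <= 1 / 10 by lra.
have eta2 : eta <= 1 / 2 by lra.
have h0 : 0 < b' - b by rewrite subr_gt0.
have s0 : 0 < Num.sqrt (b' - b) by rewrite sqrtr_gt0.
have b'be : b' - b <= eps by apply: le_trans b're; rewrite lerD2l lerN2.
have tipE : nm (path_slope b b' g g' b - 1) <= 3 / 2 * eta.
  have -> : path_slope b b' g g' b = (g' b - (U b)%:C) / sqrt_path b' b.
    case: Fg => _ gb _; rewrite /path_slope gb; congr (_ / _).
    by rewrite {2}/sqrt_path subrr sqrtr0 mulr0 rmorph0 mulr0 subr0.
  apply: le_trans (tip_flow_ratio Fg' b'T (ltW b0) bb' b'be eta2 Hs) _.
  by rewrite ler_pM2l // ler_pdivrMr //; apply: Hs => //; exact: ltW.
move: rb; rewrite le_eqVlt => /orP[/eqP ->|rb]; first by lra.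
have [|J [J0 J1 J2]] := Hint b; first by rewrite b0.
have [Frg _ _] := Fg; have [Frg' _ _] := Fg'.
pose psi x := Num.sqrt (b - x) / (Num.sqrt (b - x) + Num.sqrt (b' - b)).
pose phi x := 2 * ((v b - v x) / Num.sqrt (b - x) - J (b - x)).
(* 6 is 3/2 from [kappa] times 4 from [sqrt_potential_increment]. Since - 2 eta <= phi <= 0 and 0 <=
   psi <= 1, the total increase is at most 6 eta + 6 eta. *)
pose Phi x := 3 * phi x - 6 * eta * psi x.
pose kappa x := 3 * ((v b - v x) / ((b - x) * Num.sqrt (b - x))) +
    3 / 2 * eta * (Num.sqrt (b' - b) / ((b' - x) * Num.sqrt (b - x))).
have psi0 x : 0 <= psi x.
  by rewrite /psi divr_ge0 ?addr_ge0 ?sqrtr_ge0.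
have psi1 x : psi x <= 1.
  by rewrite /psi ler_pdivrMr ?mul1r ?lerDl ?sqrtr_ge0 // ltr_wpDl ?sqrtr_ge0.
have bxe x : r <= x -> b - x <= eps.
  by move=> rx; apply: le_trans b're; apply: lerB => //; exact: ltW.
(* Division by sqrt 0 yields 0 here. [Phi] may jump at b, but upward, by [phi_le0]. *)
have phib : phi b = 0 by rewrite /phi !subrr J0 mul0r subrr mulr0.
have psib : psi b = 0 by rewrite /psi subrr sqrtr0 mul0r.
have phi_le0 x : r <= x -> x < b -> phi x <= 0.
  move=> rx xb; have [||h1 _] := J1 (b - x) _ _ (bxe x rx).
  - by rewrite subr_gt0.
  - by rewrite lerBlDr lerDl (le_trans r0).
  by move: h1; rewrite subKr /phi; lra.
have inc x y : r <= x -> x < y -> y < b ->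
    3 * ((v b - v y) / ((b - x) * Num.sqrt (b - x)) * (y - x)) +
    3 / 2 * eta * (Num.sqrt (b' - b) / ((b' - x) * Num.sqrt (b - x)) * (y - x))
    <= Phi y - Phi x.
  move=> rx xy yb.
  have h1 := variation_potential_increment J2 bT (le_trans r0 rx) xy yb (bxe x rx) eta0.
  have := ler_wpM2l eta0 (sqrt_potential_increment xy (ltW yb) bb').
  by rewrite /Phi /phi /psi; lra.
have wpos x : r <= x -> x <= b -> 0 <= v b - v x.
  move=> rx xb; rewrite subr_ge0.
  by apply: (dominating_nondecreasing vU) => //; exact: le_trans rx.
have q1 : nm (path_slope b b' g g' b) <= 1 + 3 / 2 * eta.
  have := nmD (path_slope b b' g g' b - 1) 1; rewrite subrK nm1; lra.
have Hvar : nm (path_slope b b' g g' r - path_slope b b' g g' b) <=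
    2 * (12 * eta) * nm (path_slope b b' g g' b).
  apply: (@logder_variation R r b (path_slope b b' g g')
    (path_slope_rate b b' g g') kappa Phi (12 * eta) (ltW rb)).
  - by apply: cts_sub (path_slope_cts Frg Frg' (ltW b0) bb').
  - move=> x /andP[rx xb]; have x0 := le_trans r0 rx; split.
      exact: path_slope_logder.
    apply: (path_slope_rate_near (eps := eps)) => //.
    by apply: le_trans b're; rewrite lerD2l lerN2.
  - move=> x y rx; rewrite le_eqVlt => /orP[/eqP -> //|xy].
    rewrite le_eqVlt => /orP[/eqP yb|yb].
      have xb : x < b by rewrite -yb.
      rewrite yb /Phi phib psib; have := phi_le0 x rx xb.
      by have := mulr_ge0 eta0 (psi0 x); lra.
    rewrite -subr_ge0; apply: le_trans (inc x y rx xy yb).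
    have yx0 : 0 <= y - x by rewrite subr_ge0 ltW.
    have bx0 : 0 <= b - x by rewrite subr_ge0 ltW // (lt_trans xy).
    have b'x0 : 0 <= b' - x by rewrite subr_ge0 ltW // (lt_trans (lt_trans xy yb)).
    rewrite addr_ge0 // !mulr_ge0 ?invr_ge0 ?mulr_ge0 ?sqrtr_ge0 //.
    by apply: wpos; rewrite ?(ltW yb) // (le_trans rx) // ltW.
  - move=> x /andP[rx xb] e e0; have x0 := le_trans r0 rx.
    have p0 : 0 < b - x by rewrite subr_gt0.
    have P0 : 0 < (b - x) * Num.sqrt (b - x) by rewrite mulr_gt0 // sqrtr_gt0.
    have xT : 0 <= x <= T by rewrite x0 (le_trans (ltW xb)).
    (* [kappa] involves v x but the increment only provides v y; continuity of v makes the
       difference cost at most e. *)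
    have [d d0 Hd] := cv xT (divr_gt0 (mulr_gt0 e0 P0) (ltr0Sn _ 2)).
    exists (Num.min d (b - x)); first by rewrite lt_min d0.
    move=> y /andP[xy]; rewrite -ltrBlDl lt_min => /andP[yd yb] _.
    have {}yb : y < b by lra.
    have yx0 : 0 < y - x by rewrite subr_gt0.
    apply: le_trans (inc x y rx xy yb).
    have := Hd y; rewrite (le_trans x0 (ltW xy)) (le_trans (ltW yb) bT) gtr0_norm //.
    move=> /(_ isT yd); rewrite -rmorphB nm_real => /(le_trans (ler_norm _)) Hv.
    rewrite /kappa; set A := Num.sqrt (b' - b) / _.
    suff : 3 * ((v b - v x) / ((b - x) * Num.sqrt (b - x))) - e <=
        3 * ((v b - v y) / ((b - x) * Num.sqrt (b - x))).
      move=> h; have := ler_wpM2r (ltW yx0) h; lra.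
    rewrite lerBlDr -lerBlDl -mulrBr -mulrBl mulrC -ler_pdivlMr // ler_pdivrMr //.
    lra.
  - rewrite /Phi phib psib; have [||h1 h2] := J1 (b - r) _ _ (bxe r (lexx _)).
    + by rewrite subr_gt0.
    + by rewrite lerBlDr lerDl.
    have : 0 <= (v b - v r) / Num.sqrt (b - r).
      by rewrite divr_ge0 ?sqrtr_ge0 // wpos // ltW.
    have := ler_wpM2l eta0 (psi1 r); rewrite /phi; lra.
  - lra.
have := nm_tri (path_slope b b' g g' b) (path_slope b b' g g' r) 1.
have := ler_wpM2l eta0 q1; have := ler_wpM2l eta0 eta100.
lra.
Qed.

End slopes.

(** * Slopes away from the tips and the Cauchy property of the difference quotients *)

Section trace_slopes.
Context {R : realType}.
Variables (T : R) (U v : R -> R).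
Hypothesis cU : cts 0 T (fun x => (U x)%:C).
Hypothesis vU : forall x y, 0 <= x -> x <= y -> y <= T ->
  `|U y - U x| <= v y - v x.
Hypothesis cv : cts 0 T (fun x => (v x)%:C).
Variable eps0 : R.
Hypothesis eps0_gt0 : 0 < eps0.
Hypothesis small0 : small_variation T v (1 / 10) eps0.
Implicit Types (r s t x y b c eta eps : R) (f g : R -> R[i]).

Lemma inv_mul_dist (A B A' B' : R[i]) c dA dB : 0 < c -> c <= nm A -> c <= nm B ->
  c <= nm A' -> c <= nm B' -> nm (A - A') <= dA -> nm (B - B') <= dB ->
  nm (2 / (A * B) - 2 / (A' * B')) <= 2 * (dA + dB) / c ^+ 3.
Proof.
move=> c0 cA cB cA' cB' HA HB.
have n0 w : c <= nm w -> w != 0 by move=> cw; rewrite -nm_gt0 (lt_le_trans c0).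
have A0 := n0 _ cA; have B0 := n0 _ cB; have A'0 := n0 _ cA'; have B'0 := n0 _ cB'.
have -> : 2 / (A * B) - 2 / (A' * B') =
    - (2 * ((A - A') / (A * B * A') + (B - B') / (B * A' * B'))).
  by field; rewrite A0 B0 A'0 B'0.
rewrite nmN nmM nm_nat -[leRHS]mulrA ler_pM2l //.
have part (w p q z : R[i]) d : nm w <= d -> c <= nm p -> c <= nm q -> c <= nm z ->
    nm (w / (p * q * z)) <= d / c ^+ 3.
  move=> wd cp cq cz; rewrite nmf_div; apply: ler_pM; rewrite ?nm_ge0 ?invr_ge0 ?nm_ge0 //.
  have p0 := lt_le_trans c0 cp; have q0 := lt_le_trans c0 cq; have z0 := lt_le_trans c0 cz.
  rewrite !nmM lef_pV2 ?posrE ?mulr_gt0 ?exprn_gt0 // exprSr expr2.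
  by apply: ler_pM; rewrite ?mulr_ge0 ?(ltW c0) //; apply: ler_pM; rewrite ?(ltW c0).
by apply: le_trans (nmD _ _) _; rewrite [leRHS]mulrDl; apply: lerD; apply: part.
Qed.

(** By Gronwall, paths that coincide at r would still coincide at s. This permits division by a
    slope in [path_slope_far]. *)
Lemma path_slope_neq0 b b' g g' r c : tip_flow U b g -> tip_flow U b' g' ->
  b' <= T -> 0 <= r -> b < b' -> 0 < c ->
  forall s, r <= s -> s < b ->
  (forall x, r <= x -> x <= s -> c <= complex.Im (g x) /\ c <= complex.Im (g' x)) ->
  path_slope b b' g g' s != 0 -> path_slope b b' g g' r != 0.
Proof.
move=> Fg Fg' b'T r0 bb' c0 s rs sb low; have [Frg _ _] := Fg; have [Frg' _ _] := Fg'.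
have b0 : 0 <= b by rewrite (le_trans r0) // (le_trans rs) // ltW.
have F0 x : x <= b -> (sqrt_path b' x - sqrt_path b x)^-1 != 0.
  by move=> xb; rewrite invr_eq0; exact: sqrt_pathB_neq0.
rewrite /path_slope !mulf_eq0 !negb_or !F0 ?(ltW sb) ?(le_trans rs (ltW sb)) // !andbT.
apply: contra => /eqP Dr; apply/eqP/ComplexField.Normc.eq0_normc/eqP.
rewrite eq_le nm_ge0 andbT.
have := @logder_bound R r s (fun x => g' x - g x)
  (fun x => - 2 / ((g' x - (U x)%:C) * (g x - (U x)%:C))) (2 / c ^+ 2) rs.
rewrite Dr nm0 mulr0; apply.
- by rewrite divr_ge0 // exprn_ge0 // ltW.
- apply: ctsB.
    by apply: cts_sub Frg'.1 => //; rewrite ltW // (lt_trans sb).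
  by apply: cts_sub Frg.1 => //; exact: ltW.
move=> x /andP[rx xs]; have xb := lt_trans xs sb; split.
  by apply: (rflow_logderB (rflow_sub (ltW bb') Frg') Frg); rewrite (le_trans r0).
have [h1 h2] := low x rx (ltW xs).
rewrite nmf_div nmN nm_nat nmM ler_pM2l //.
have c1 := le_trans h1 (Im_le_nmB (g x) (U x)).
have c2 := le_trans h2 (Im_le_nmB (g' x) (U x)).
by rewrite lef_pV2 ?posrE ?mulr_gt0 ?exprn_gt0 ?(lt_le_trans c0) // expr2 ler_pM // ltW.
Qed.

Lemma tip_flow_height b g t eps x : tip_flow U b g -> b <= T -> 0 <= t ->
  t < b -> b - t <= eps0 -> eps <= b - t -> 0 < eps ->
  0 <= x -> x <= t -> Num.sqrt eps <= complex.Im (g x).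
Proof.
move=> Fg bT t0 tb bte epsb eps_gt0 x0 xt; have [Frg _ _] := Fg.
apply: le_trans (rflow_Im_nonincreasing Frg x0 xt (ltW tb)).
have [_ H] := tip_flow_cone cU vU small0 Fg bT t0 tb bte.
have [|Y0 _] := Frg.2 t; first by rewrite t0.
rewrite -(ger0_norm (ltW Y0)) -sqrtr_sqr ler_sqrt ?sqr_ge0 //; lra.
Qed.

(* Comparison of two difference quotients through the quotient of the path
   slopes, whose logarithmic derivative is small away from the tips. *)
Lemma path_slope_far b1 b1' b2 b2' g1 g1' g2 g2' t c eta delta :
  tip_flow U b1 g1 -> tip_flow U b1' g1' -> tip_flow U b2 g2 -> tip_flow U b2' g2' ->
  b1' <= T -> b2' <= T -> 0 <= t -> t < b1 -> t < b2 -> b1 < b1' -> b2 < b2' ->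
  0 < c -> 0 <= eta -> eta <= 1 / 100 ->
  (forall x, 0 <= x -> x <= t ->
    [/\ c <= complex.Im (g1 x), c <= complex.Im (g1' x), c <= complex.Im (g2 x)
      & c <= complex.Im (g2' x)]) ->
  (forall x, 0 <= x -> x <= t ->
    [/\ c <= nm (sqrt_path b1 x), c <= nm (sqrt_path b1' x),
        c <= nm (sqrt_path b2 x) & c <= nm (sqrt_path b2' x)]) ->
  (forall x, 0 <= x -> x <= t ->
    [/\ nm (g1 x - g2 x) <= delta, nm (g1' x - g2' x) <= delta,
        nm (sqrt_path b1 x - sqrt_path b2 x) <= delta
      & nm (sqrt_path b1' x - sqrt_path b2' x) <= delta]) ->
  8 * delta / c ^+ 3 * t <= eta ->
  nm (path_slope b1 b1' g1 g1' t - 1) <= 30 * eta ->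
  nm (path_slope b2 b2' g2 g2' t - 1) <= 30 * eta ->
  nm (path_slope b1 b1' g1 g1' 0 - path_slope b2 b2' g2 g2' 0) <=
    104 * eta * nm (path_slope b2 b2' g2 g2' 0).
Proof.
move=> F1 F1' F2 F2' b1'T b2'T t0 tb1 tb2 bb1 bb2 c0 eta0 eta100 low lowF dist deta q1t q2t.
have [Fr1 _ _] := F1; have [Fr1' _ _] := F1'; have [Fr2 _ _] := F2; have [Fr2' _ _] := F2'.
pose q1 := path_slope b1 b1' g1 g1'; pose q2 := path_slope b2 b2' g2 g2'.
rewrite -/(q1 t) -/(q2 t) -/(q1 0) -/(q2 0) in q1t q2t *.
have b10 : 0 <= b1 by rewrite (le_trans t0) // ltW.
have b20 : 0 <= b2 by rewrite (le_trans t0) // ltW.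
have eta1 : eta * eta <= 1 / 100 * eta by rewrite ler_wpM2r.
have q2t_ge : 7 / 10 <= nm (q2 t).
  by have := nm_tri (q2 t) 1 0; rewrite !subr0 nm1 (nmC 1); lra.
have q2t0 : q2 t != 0 by rewrite -nm_gt0; apply: lt_le_trans q2t_ge; lra.
have q20 x : 0 <= x -> x <= t -> q2 x != 0.
  move=> x0 xt; apply: (path_slope_neq0 F2 F2' b2'T x0 bb2 c0 xt tb2) => //.
  by move=> y xy yt; have [] := low y (le_trans x0 xy) yt.
pose rho x := q1 x / q2 x.
have crho : cts 0 t rho.
  apply: ctsM => //.
    by apply: cts_sub (path_slope_cts Fr1 Fr1' b10 bb1) => //; exact: ltW.
  apply: ctsV => //; last by move=> x /andP[]; exact: q20.
  by apply: cts_sub (path_slope_cts Fr2 Fr2' b20 bb2) => //; exact: ltW.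
have d0 : 0 <= delta by have [h _ _ _] := dist 0 (lexx _) t0; apply: le_trans h; exact: nm_ge0.
have kappa0 : 0 <= 8 * delta / c ^+ 3.
  by apply: divr_ge0; [exact: mulr_ge0|exact/exprn_ge0/ltW].
(* The rate 8 delta / c^3 is 4 delta / c^3 from the orbits plus as much from the reference paths. *)
have Hrho : nm (rho 0 - rho t) <= 2 * eta * nm (rho t).
  apply: (@logder_variation R 0 t rho
    (fun x => path_slope_rate U b1 b1' g1 g1' x - path_slope_rate U b2 b2' g2 g2' x)
    (fun=> 8 * delta / c ^+ 3) (fun x => 8 * delta / c ^+ 3 * x) eta t0 crho).
  - move=> x /andP[x0 xt]; split.
      apply: logderM; first exact: path_slope_logder (lt_trans xt tb1) bb1.
      apply: logderV; first by rewrite q20 // ltW.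
      exact: path_slope_logder (lt_trans xt tb2) bb2.
    have [l1 l2 l3 l4] := low x x0 (ltW xt).
    have [m1 m2 m3 m4] := lowF x x0 (ltW xt).
    have [d1 d2 d3 d4] := dist x x0 (ltW xt).
    have zl z : c <= complex.Im z -> c <= nm (z - (U x)%:C).
      by move=> cz; exact: le_trans cz (Im_le_nmB _ _).
    have sub (z w : R[i]) : z - (U x)%:C - (w - (U x)%:C) = z - w by ring.
    have h1 := inv_mul_dist c0 (zl _ l2) (zl _ l1) (zl _ l4) (zl _ l3).
    have {}h1 := h1 delta delta; rewrite !sub in h1; have {}h1 := h1 d2 d1.
    have h2 := inv_mul_dist c0 m2 m1 m4 m3 d4 d3.
    rewrite /path_slope_rate.
    set A := 2 / (sqrt_path b1' x * _) in h2 *; set B := 2 / (sqrt_path b2' x * _) in h2 *.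
    rewrite !mulNr.
    set C := 2 / _ in h1 *; set D := 2 / ((g2' x - _) * _) in h1 *.
    have -> : - C + A - (- D + B) = (A - B) - (C - D) by ring.
    apply: le_trans (nmB _ _) _; apply: le_trans (lerD h2 h1) _; lra.
  - by move=> x y x0 xy yt; rewrite ler_wpM2l.
  - move=> x _ e e0; exists 1 => // y /andP[xy _] _; rewrite -mulrBr.
    apply: ler_wpM2r; first by rewrite subr_ge0 ltW.
    by rewrite lerBlDr lerDl ltW.
  - by rewrite mulr0 subr0.
  - lra.
(* 30 eta + 30 eta over the lower bound 7/10 for q2 t. *)
have rhot : nm (rho t - 1) <= 90 * eta.
  have -> : rho t - 1 = ((q1 t - 1) - (q2 t - 1)) / q2 t by rewrite /rho; field.
  rewrite nmf_div ler_pdivrMr ?nm_gt0 //; apply: le_trans (nmB _ _) _.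
  have := ler_wpM2l eta0 q2t_ge; lra.
have rho0 : nm (rho 0 - 1) <= 104 * eta.
  have := nm_tri (rho t) (rho 0) 1.
  have : nm (rho t) <= 1 + 90 * eta.
    by have := nmD (rho t - 1) 1; rewrite subrK nm1; lra.
  move=> h; have := ler_wpM2l eta0 h; lra.
have q200 : q2 0 != 0 by exact: q20.
have -> : q1 0 - q2 0 = (rho 0 - 1) * q2 0 by rewrite /rho; field.
by rewrite nmM ler_wpM2r // nm_ge0.
Qed.

Hypothesis small_int : forall eta, 0 < eta ->
  exists2 eps, 0 < eps & small_integral T v eta eps.
Hypothesis U0 : U 0 = 0.
Hypothesis T_gt0 : 0 < T.

Definition is_trace_of (G : R -> R -> R[i]) (tr : R -> R[i]) :=
  [/\ forall b, 0 < b <= T -> tip_flow U b (G b),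
      tr 0 = 0 & forall b, 0 < b <= T -> tr b = G b 0].

Definition trace_slope (tr : R -> R[i]) b b' :=
  (tr b' - tr b) / ('i * (2 * (Num.sqrt b' - Num.sqrt b))%:C).

Lemma trace_slopeE G tr b b' : is_trace_of G tr -> 0 < b -> b < b' -> b' <= T ->
  trace_slope tr b b' = path_slope b b' (G b) (G b') 0.
Proof.
move=> [_ _ trE] b0 bb' b'T; have b'0 := lt_trans b0 bb'.
rewrite /trace_slope !trE ?b0 ?b'0 ?b'T ?(le_trans (ltW bb')) //.
rewrite /path_slope /sqrt_path !subr0; congr (_ / _).
by rewrite mulrBr rmorphB /= mulrBr.
Qed.

(** At time 0 the limit of the slopes is explicitly 1. The case b = 0 has no orbit of its own: the
    slope is then the ratio of the orbit of b' to its reference path. *)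
Lemma trace_slope_at0 G tr eta : is_trace_of G tr -> 0 < eta -> eta <= 1 / 100 ->
  exists2 eps, 0 < eps & forall b b', 0 <= b -> b < b' -> b' <= T -> b' <= eps ->
    nm (trace_slope tr b b' - 1) <= 30 * eta.
Proof.
move=> HG eta0 eta100; have [eps eps_gt0 Hint] := small_int eta0.
exists eps => // b b' b0 bb' b'T b'e; have [FG tr0 trE] := HG.
have b'0 : 0 < b' by exact: le_lt_trans bb'.
have Fb' : tip_flow U b' (G b') by apply: FG; rewrite b'0.
move: b0; rewrite le_eqVlt => /orP[/eqP b0|b0]; last first.
  rewrite (trace_slopeE HG) //; apply: (path_slope_near cU vU cv (eps := eps)) => //.
  - by apply: FG; rewrite b0 (le_trans (ltW bb')).
  - exact: ltW.
  - by rewrite subr0.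
  - exact: ltW.
have Hs := small_integral_variation Hint.
have := tip_flow_ratio cU vU Fb' b'T (lexx 0) b'0 (eps := eps) (eta := eta).
rewrite U0 subr0 => /(_ b'e _ Hs) H.
rewrite /trace_slope -b0 tr0 trE ?b'0 // sqrtr0 !subr0.
have -> : 'i * (2 * Num.sqrt b')%:C = sqrt_path b' 0 by rewrite /sqrt_path subr0.
rewrite rmorph0 subr0 in H; apply: le_trans (H _) _; first by lra.
have : (v b' - v 0) / Num.sqrt b' <= eta.
  by rewrite ler_pdivrMr ?sqrtr_gt0 //; have := Hs 0 b'; rewrite subr0; apply => //; exact: ltW.
lra.
Qed.

(** The time r0 = t - eps / 2 is close enough to all four tips for [path_slope_near], yet the paths
    have height at least c on [0, r0], so that [path_slope_far] carries the comparison back to 0. *)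
Lemma trace_slope_relative_cauchy G tr t eta : is_trace_of G tr ->
  0 < t -> t <= T -> 0 < eta -> eta <= 1 / 100 ->
  exists2 d, 0 < d & forall b1 b1' b2 b2', `|b1 - t| < d -> `|b1' - t| < d ->
    `|b2 - t| < d -> `|b2' - t| < d -> 0 <= b1 -> 0 <= b2 ->
    b1 < b1' -> b2 < b2' -> b1' <= T -> b2' <= T ->
    nm (trace_slope tr b1 b1' - trace_slope tr b2 b2') <=
      104 * eta * nm (trace_slope tr b2 b2').
Proof.
move=> HG t0 tT eta0 eta100; have [FG tr0 trE] := HG.
have [eps1 eps1_gt0 Hint1] := small_int eta0.
pose eps := Num.min (Num.min eps1 eps0) t.
have eps_gt0 : 0 < eps by rewrite !lt_min eps1_gt0 eps0_gt0.
have epst : eps <= t by rewrite ge_min lexx orbT.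
have eps_eps0 : eps <= eps0 by rewrite !ge_min lexx orbT.
have eps_eps1 : eps <= eps1 by rewrite !ge_min lexx.
have Hint := small_integral_le eps_eps1 Hint1.
clearbody eps.
pose r0 := t - eps / 2.
have r00 : 0 <= r0 by rewrite /r0; lra.
pose c := Num.sqrt (eps / 4).
have c0 : 0 < c by rewrite sqrtr_gt0 divr_gt0.
(* One constant for the dependence on sqrt|b - b'| of both the orbits and the reference paths, the
   latter contributing 2. *)
pose K := 3 * expR (8 / eps0 * T) + 2.
have K0 : 0 < K by rewrite /K addr_gt0 // mulr_gt0 // expR_gt0.
(* Chosen so that delta = K X turns 8 delta / c^3 r0 into eta r0 / T. Times within X^2 / 2 of t
   satisfy sqrt|b - b'| <= X. *)
pose X := eta * c ^+ 3 / (8 * K * T).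
have X0 : 0 < X by rewrite !divr_gt0 ?mulr_gt0 ?exprn_gt0.
exists (Num.min (eps / 4) (X ^+ 2 / 2)).
  by rewrite lt_min !divr_gt0 // exprn_gt0.
move=> b1 b1' b2 b2'; rewrite !lt_min => /andP[e1 x1] /andP[e1' x1'] /andP[e2 x2] /andP[e2' x2'].
move=> b10 b20 bb1 bb2 b1'T b2'T.
have near b : `|b - t| < eps / 4 -> eps / 4 <= b - r0 /\ b - r0 <= 3 / 4 * eps.
  by rewrite ltr_norml /r0 => /andP[h1 h2]; split; lra.
have [n1 m1] := near _ e1; have [n1' m1'] := near _ e1'.
have [n2 m2] := near _ e2; have [n2' m2'] := near _ e2'.
have pos b : eps / 4 <= b - r0 -> 0 < b by lra.
have {}b10 := pos _ n1; have {}b20 := pos _ n2.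
have b1'0 := pos _ n1'; have b2'0 := pos _ n2'.
have b1T : b1 <= T by rewrite (le_trans (ltW bb1)).
have b2T : b2 <= T by rewrite (le_trans (ltW bb2)).
have F1 : tip_flow U b1 (G b1) by apply: FG; rewrite b10.
have F2 : tip_flow U b2 (G b2) by apply: FG; rewrite b20.
have F1' : tip_flow U b1' (G b1') by apply: FG; rewrite b1'0.
have F2' : tip_flow U b2' (G b2') by apply: FG; rewrite b2'0.
rewrite !(trace_slopeE HG) //.
have rb b : eps / 4 <= b - r0 -> r0 < b by lra.
have height b : 0 < b <= T -> eps / 4 <= b - r0 -> b - r0 <= 3 / 4 * eps ->
    forall x, 0 <= x -> x <= r0 -> c <= complex.Im (G b x).
  move=> b0T nb mb x x0 xr; have /andP[_ bT] := b0T.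
  apply: (tip_flow_height (FG b b0T) bT r00 (rb _ nb) _ nb) => //; last by rewrite divr_gt0.
  lra.
have heightF b : eps / 4 <= b - r0 ->
    forall x, 0 <= x -> x <= r0 -> c <= nm (sqrt_path b x).
  move=> nb x x0 xr; rewrite nm_sqrt_path.
  have h : c <= Num.sqrt (b - x) by rewrite ler_sqrt; lra.
  by have := sqrtr_ge0 (b - x); lra.
pose delta := K * X.
have distX b b' : `|b - t| < X ^+ 2 / 2 -> `|b' - t| < X ^+ 2 / 2 ->
    Num.sqrt `|b - b'| <= X.
  move=> h1 h2; rewrite -[leRHS]ger0_norm ?(ltW X0) // -(sqrtr_sqr X) ler_sqrt ?sqr_ge0 //.
  have : `|b - b'| <= `|b - t| + `|b' - t|.
    by rewrite (distrC b'); have := ler_distD t b b'.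
  lra.
have dist b b' : 0 < b <= T -> 0 < b' <= T -> eps / 4 <= b - r0 -> eps / 4 <= b' - r0 ->
    `|b - t| < eps / 4 -> `|b' - t| < eps / 4 ->
    Num.sqrt `|b - b'| <= X ->
    forall x, 0 <= x -> x <= r0 -> nm (G b x - G b' x) <= delta.
  move=> b0T b'0T nb nb' eb eb' bX x x0 xr.
  wlog bb' : b b' b0T b'0T nb nb' eb eb' bX / b' <= b.
    have [b'b|b'b] := leP b' b; first by apply.
    by rewrite nmC; move=> /(_ b' b); apply=> //; [rewrite distrC|exact: ltW].
  have /andP[b0 bT] := b0T; have /andP[b'0 b'T] := b'0T.
  apply: le_trans (tip_flow_continuous cU vU eps0_gt0 small0 (FG b' b'0T) (FG b b0T) b'0 bb' bT _ x0 _) _.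
  - by move: eb eb'; rewrite !ltr_norml => /andP[? ?] /andP[? ?]; lra.
  - by lra.
  rewrite -(ger0_norm (_ : 0 <= b - b')) ?subr_ge0 //.
  rewrite /delta /K; apply: ler_pM; rewrite ?sqrtr_ge0 ?mulr_ge0 ?expR_ge0 //.
  by rewrite lerDl.
have distF b b' : eps / 4 <= b - r0 -> eps / 4 <= b' - r0 -> Num.sqrt `|b - b'| <= X ->
    forall x, 0 <= x -> x <= r0 -> nm (sqrt_path b x - sqrt_path b' x) <= delta.
  move=> nb nb' bX x x0 xr; apply: le_trans (nm_sqrt_pathB _ _) _; [exact: le_trans xr (ltW (rb _ nb))|exact: le_trans xr (ltW (rb _ nb'))|].
  have -> : b - x - (b' - x) = b - b' by ring.
  rewrite /delta /K; apply: ler_pM; rewrite ?sqrtr_ge0 //.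
  by rewrite lerDr mulr_ge0 // expR_ge0.
have X1 := distX _ _ x1 x2; have X1' := distX _ _ x1' x2'.
have slope_near b b' : 0 < b <= T -> 0 < b' <= T -> b < b' -> eps / 4 <= b - r0 ->
    b' - r0 <= 3 / 4 * eps -> nm (path_slope b b' (G b) (G b') r0 - 1) <= 30 * eta.
  move=> b0T b'0T bb' nb mb'; have /andP[b0 bT] := b0T; have /andP[b'0 b'T] := b'0T.
  apply: (path_slope_near cU vU cv (eps := eps) (FG b b0T) (FG b' b'0T)) => //.
  - by apply: ltW; exact: rb.
  - lra.
  - exact: ltW.
apply: (path_slope_far F1 F1' F2 F2' (t := r0) (c := c) (delta := delta)) => //.
- exact: rb.
- exact: rb.
- exact: ltW.
- by move=> x x0 xr; split; apply: height => //; apply/andP.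
- by move=> x x0 xr; split; apply: heightF.
- move=> x x0 xr; split; [apply: dist|apply: dist|apply: distF|apply: distF] => //; exact/andP.
- have -> : 8 * delta / c ^+ 3 * r0 = eta * (r0 / T).
    by rewrite /delta /X; field; rewrite !gt_eqF.
  rewrite ler_piMr ?(ltW eta0) // ler_pdivrMr // mul1r /r0; lra.
- by apply: slope_near => //; apply/andP.
- by apply: slope_near => //; apply/andP.
Qed.

(** For t > 0 the relative estimate is used twice: with eta = 1/100 against a fixed pair it bounds
    all slopes near t by some B, and then eta is chosen in terms of e and B. *)
Lemma trace_slope_cauchy G tr t e : is_trace_of G tr -> 0 <= t -> t <= T -> 0 < e ->
  exists2 d, 0 < d & forall b1 b1' b2 b2', `|b1 - t| < d -> `|b1' - t| < d ->
    `|b2 - t| < d -> `|b2' - t| < d -> 0 <= b1 -> 0 <= b2 ->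
    b1 < b1' -> b2 < b2' -> b1' <= T -> b2' <= T ->
    nm (trace_slope tr b1 b1' - trace_slope tr b2 b2') <= e.
Proof.
move=> HG; rewrite le_eqVlt => /orP[/eqP <- _ e0|t0 tT e0].
  pose eta := Num.min (1 / 100) (e / 60).
  have eta0 : 0 < eta by rewrite lt_min !divr_gt0.
  have eta100 : eta <= 1 / 100 by rewrite ge_min lexx.
  have etae : 60 * eta <= e.
    have : eta <= e / 60 by rewrite ge_min lexx orbT.
    lra.
  have [d d0 Hd] := trace_slope_at0 HG eta0 eta100.
  exists d => // b1 b1' b2 b2'; rewrite !subr0 => _ d1 _ d2 b10 b20 bb1 bb2 b1T b2T.
  have h1 := Hd b1 b1' b10 bb1 b1T (ltW (le_lt_trans (ler_norm _) d1)).
  have h2 := Hd b2 b2' b20 bb2 b2T (ltW (le_lt_trans (ler_norm _) d2)).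
  have := nm_tri 1 (trace_slope tr b1 b1') (trace_slope tr b2 b2').
  rewrite (nmC 1); lra.
have eta1 : 0 < 1 / 100 :> R by lra.
have [d1 d10 H1] := trace_slope_relative_cauchy HG t0 tT eta1 (lexx _).
have [B B0 HB] : exists2 B, 0 < B & forall b b', `|b - t| < d1 -> `|b' - t| < d1 ->
    0 <= b -> b < b' -> b' <= T -> nm (trace_slope tr b b') <= B.
  pose b0 := t - Num.min (t / 2) (d1 / 2).
  have m0 : 0 < Num.min (t / 2) (d1 / 2) by rewrite lt_min !divr_gt0.
  have m1 : Num.min (t / 2) (d1 / 2) <= t / 2 by rewrite ge_min lexx.
  have m2 : Num.min (t / 2) (d1 / 2) <= d1 / 2 by rewrite ge_min lexx orbT.
  have db0 : `|b0 - t| < d1 by rewrite /b0 ltr_norml; apply/andP; split; lra.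
  have dt : `|t - t| < d1 by rewrite subrr normr0.
  have b00 : 0 <= b0 by rewrite /b0; lra.
  have b0t : b0 < t by rewrite /b0; lra.
  (* A slope is at most 1 + 104/100 times the reference slope; adding 1 keeps B positive. *)
  exists (3 * nm (trace_slope tr b0 t) + 1).
    by have := nm_ge0 (trace_slope tr b0 t); lra.
  move=> b b' db db' b0' bb' b'T.
  have := H1 b b' b0 t db db' db0 dt b0' b00 bb' b0t b'T tT.
  have := nmB_ge (trace_slope tr b b') (trace_slope tr b0 t).
  have := nm_ge0 (trace_slope tr b0 t); lra.
pose eta := Num.min (1 / 100) (e / (104 * B)).
have eta0 : 0 < eta by rewrite lt_min !divr_gt0 // mulr_gt0.
have eta100 : eta <= 1 / 100 by rewrite ge_min lexx.
have etae : 104 * eta * B <= e.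
  have : eta <= e / (104 * B) by rewrite ge_min lexx orbT.
  by rewrite ler_pdivlMr ?mulr_gt0 //; lra.
have [d d0 Hd] := trace_slope_relative_cauchy HG t0 tT eta0 eta100.
exists (Num.min d d1); first by rewrite lt_min d0.
move=> b1 b1' b2 b2'; rewrite !lt_min => /andP[e1 x1] /andP[e1' x1'] /andP[e2 x2] /andP[e2' x2'].
move=> b10 b20 bb1 bb2 b1T b2T.
apply: le_trans (Hd _ _ _ _ e1 e1' e2 e2' b10 b20 bb1 bb2 b1T b2T) _.
apply: le_trans etae; apply: ler_wpM2l; last exact: HB.
by apply: mulr_ge0 => //; exact: ltW.
Qed.

End trace_slopes.

(** * The variation function of U and the Stieltjes integral *)

Section variation_of_driver.
Context {R : realType}.
Variables (T : R) (U : R -> R).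
Hypotheses (T_gt0 : 0 < T) (bvU : BV_LR T U).

Definition variation_function (t : R) := fine (total_variation 0 t U).
Let v := variation_function.

Let bv0T : bounded_variation 0 T U.
Proof.
case: bvU => _ _ tv _; apply/(bounded_variationP _ (ltW T_gt0)).
by rewrite ge0_fin_numE // total_variation_ge0 // ltW.
Qed.

Let tv_fin a b : 0 <= a -> a <= b -> b <= T ->
  total_variation a b U \is a fin_num.
Proof.
move=> a0 ab bT; apply/bounded_variationP => //.
apply: (@bounded_variationl _ _ _ T) => //.
by apply: (@bounded_variationr _ 0) => //; exact: le_trans ab bT.
Qed.

Lemma variation_functionB a b : 0 <= a -> a <= b -> b <= T ->
  v b - v a = fine (total_variation a b U).
Proof.
move=> a0 ab bT; rewrite /v /variation_function (total_variationD U a0 ab).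
rewrite fineD ?tv_fin // ?(le_trans ab) //; first by rewrite addrC addKr.
Qed.

Lemma variation_function_dominates x y : 0 <= x -> x <= y -> y <= T ->
  `|U y - U x| <= v y - v x.
Proof.
move=> x0 xy yT; rewrite variation_functionB // -lee_fin fineK ?tv_fin //.
exact: total_variation_ge.
Qed.

Lemma within_cts a b (f : R -> R) : {within `[a, b], continuous f} ->
  cts a b (fun x => (f x)%:C).
Proof.
move=> cf x xab e e0; have /subspace_continuousP/(_ x) H := cf.
have xin : `[a, b]%classic x by rewrite /= in_itv.
move: (H xin) => /cvgrPdist_le/(_ e e0) [d d0 Hd]; exists d => // y yab yd.
have -> : (f y)%:C - (f x)%:C = (f y - f x)%:C by rewrite rmorphB.
rewrite nm_real distrC; apply: (Hd y); first by rewrite /ball /= distrC.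
by rewrite /= in_itv.
Qed.

Lemma driver_cts : cts 0 T (fun x => (U x)%:C).
Proof. by apply: within_cts; case: bvU. Qed.

Lemma variation_function_cts : cts 0 T (fun x => (v x)%:C).
Proof.
apply: (within_cts (f := v)); case: bvU => cU _ _ _.
exact: (total_variation_continuous T_gt0 cU bv0T).
Qed.

Lemma backward_variationE b s : 0 <= s -> s <= b -> b <= T ->
  backward_variation U b s = v b - v (b - s).
Proof.
move=> s0 sb bT; rewrite /backward_variation min_l // max_r //.
by rewrite variation_functionB ?subr_ge0 // gerBl.
Qed.

Lemma measurable_inv_sqrt (D : set (measurableTypeR R)) :
  measurable D -> D `<=` [set x : R | 0 < x] ->
  measurable_fun D (fun r => ((Num.sqrt (r : R))^-1)%:E).
Proof.
move=> mD D0; apply/measurable_EFinP.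
apply: (@eq_measurable_fun _ _ _ _ _ (fun r : R => r `^ (- 2^-1))).
  by move=> r /set_mem /D0 /= r0; rewrite powRN powR12_sqrt // ltW.
exact: measurable_funTS (measurable_powR _).
Qed.

Section backward_measure.
Variable b : R.
Hypothesis bT : 0 < b <= T.

Let F := cumulative_of (backward_variation U b).
Let mu := lebesgue_stieltjes_measure F.

(** This excludes the junk branch of [cumulative_of]. *)
Let FE : F = backward_variation U b :> (R -> R).
Proof.
apply: (backward_variation_cumulative T_gt0 bvU).
by case/andP: bT => b0 ->; rewrite ltW.
Qed.

Let Fin s : 0 <= s -> s <= b -> F s = v b - v (b - s).
Proof. by move=> s0 sb; rewrite FE backward_variationE //; case/andP: bT. Qed.

Let mu_itv s' s : 0 <= s' -> s' <= s -> s <= b ->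
  mu `]s', s]%classic = (v (b - s') - v (b - s))%:E.
Proof.
move=> s'0 s's sb; rewrite /mu /lebesgue_stieltjes_measure /measure_extension.
rewrite measurable_mu_extE /=; last exact: is_ocitv.
have s0 := le_trans s'0 s's; have s'b := le_trans s's sb.
rewrite wlength_itv_bnd // !Fin //.
by congr _%:E; ring.
Qed.

Let I (s : R) : \bar R := (\int[mu]_(r in `]0%R, s]) ((Num.sqrt r)^-1)%:E)%E.

Let f0 (r : R) : (0 <= ((Num.sqrt r)^-1)%:E :> \bar R)%E.
Proof. by rewrite lee_fin invr_ge0 sqrtr_ge0. Qed.

Let mf (s' s : R) : 0 <= s' ->
  measurable_fun (`]s', s]%classic : set (measurableTypeR R))
    (fun r => ((Num.sqrt (r : R))^-1)%:E).
Proof.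
move=> s'0; apply: measurable_inv_sqrt; first exact: measurable_itv.
by move=> r /=; rewrite in_itv /= => /andP[+ _]; exact: le_lt_trans.
Qed.

Let I_split s' s : 0 <= s' -> s' <= s ->
  (I s = I s' + \int[mu]_(r in `]s', s]) ((Num.sqrt r)^-1)%:E)%E.
Proof.
move=> s'0 s's; rewrite /I -ge0_integral_setU //.
- by congr (integral _ _ _); rewrite -itv_bndbnd_setU // bnd_simp.
- rewrite -itv_bndbnd_setU ?bnd_simp //; exact: mf.
- apply/disj_setPS => r [] /=; rewrite !in_itv /= => /andP[_ rs'] /andP[s'r _].
  by have := lt_le_trans s'r rs'; rewrite ltxx.
Qed.

Let I_lower s' s : 0 <= s' -> s' <= s -> 0 < s -> s <= b ->
  (((v (b - s') - v (b - s)) / Num.sqrt s)%:E <=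
   \int[mu]_(r in `]s', s]) ((Num.sqrt r)^-1)%:E)%E.
Proof.
move=> s'0 s's s0 sb; rewrite mulrC EFinM -mu_itv // -integral_cst //.
apply: ge0_le_integral => //.
- by move=> r _; rewrite lee_fin invr_ge0 sqrtr_ge0.
- exact: mf.
- move=> r /=; rewrite in_itv /= => /andP[s'r rs].
  have r0 := le_lt_trans s'0 s'r.
  by rewrite lee_fin lef_pV2 ?posrE ?sqrtr_gt0 // ler_sqrt // ltW.
Qed.

(** J s is the integral over ]0, s]. On ]s', s] the integrand is at least s^(-1/2) and the mass is v
    (b - s') - v (b - s). The smallness hypothesis also makes these integrals finite, so [fine]
    loses nothing. *)
Lemma backward_integral_potential eta eps : 0 < eps ->
  (sqrt_variation_integral U b eps < eta%:E)%E ->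
  exists J : R -> R, [/\ J 0 = 0,
    forall s, 0 < s -> s <= b -> s <= eps ->
      (v b - v (b - s)) / Num.sqrt s <= J s /\ J s <= eta &
    forall s' s, 0 < s' -> s' <= s -> s <= b -> s <= eps ->
      (v (b - s') - v (b - s)) / Num.sqrt s <= J s - J s'].
Proof.
move=> eps0 Hsmall; have /andP[b0 _] := bT.
have Ipos s : (0 <= I s)%E by apply: integral_ge0.
have Ile s : 0 <= s -> s <= b -> s <= eps -> (I s <= eta%:E)%E.
  move=> s0 sb se; apply: le_trans (ltW Hsmall).
  rewrite /sqrt_variation_integral -/F -/mu -/(I (Num.min eps b)).
  have sm : s <= Num.min eps b by rewrite le_min se sb.
  by rewrite (I_split s0 sm) leeDl // integral_ge0.
have Ifin s : 0 <= s -> s <= b -> s <= eps -> I s \is a fin_num.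
  by move=> s0 sb se; rewrite ge0_fin_numE // (le_lt_trans (Ile s s0 sb se)) // ltry.
have I0 : I 0 = 0%E by rewrite /I set_itvoc0 integral_set0.
exists (fun s => fine (I s)); split.
- by rewrite I0.
- move=> s s0 sb se; have s0' := ltW s0; split.
    rewrite -lee_fin fineK ?Ifin // (I_split (lexx 0) s0') I0 add0e.
    by have := I_lower (lexx 0) s0' s0 sb; rewrite subr0.
  by rewrite -lee_fin fineK ?Ifin // Ile.
- move=> s' s s'0 s's sb se; have s0 := lt_le_trans s'0 s's.
  have fs := Ifin s (ltW s0) sb se.
  have fs' := Ifin s' (ltW s'0) (le_trans s's sb) (le_trans s's se).
  rewrite lerBrDl -lee_fin EFinD !fineK // (I_split (ltW s'0) s's).
  by rewrite leeD2l // I_lower // ltW.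
Qed.

End backward_measure.

Lemma uniformly_small_small_integral : uniformly_small_integral T U ->
  forall eta, 0 < eta -> exists2 eps, 0 < eps & small_integral T v eta eps.
Proof.
move=> Usmall eta eta0.
have := Usmall eta eta0; rewrite /prop_near1 => -[d /= d0 Hd].
have d2 : 0 < d / 2 by rewrite divr_gt0.
exists (d / 2) => // b bT.
apply: backward_integral_potential => //; apply: Hd => //.
by rewrite /ball /= sub0r normrN gtr0_norm // ltr_pdivrMr // ltr_pMr // ltr1n.
Qed.

End variation_of_driver.

(** * Derivatives and continuity of the statement in terms of [nm] *)

Section epsilon_delta.
Context {R : realType}.
Implicit Types (f : R -> R[i]) (D : set R) (z l : R[i]).

Lemma gt0_complexE (e : R[i]) : 0 < e -> exists2 r : R, 0 < r & e = r%:C.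
Proof.
case: e => r i; rewrite ltcE /= => /andP[i0 r0]; exists r => //.
by move/eqP: i0 => ->.
Qed.

Lemma normc_le_real (z : R[i]) (r : R) : (`|z| <= r%:C) = (nm z <= r).
Proof. by rewrite lecR. Qed.

Lemma derivative_withinP D f t l : derivative_within D f t l <->
  forall e, 0 < e -> exists2 d, 0 < d & forall s, D s -> `|s - t| < d ->
    nm (f s - f t - (s - t)%:C * l) <= e * `|s - t|.
Proof.
have quot (s : R) : s != t ->
    f s - f t - (s - t)%:C * l = - ((s - t)%:C * (l - ((s - t)^-1)%:C * (f s - f t))).
  move=> st; have st0 : (s - t)%:C != 0 :> R[i].
    by apply: contra st => /eqP[/eqP]; rewrite subr_eq0.
  by rewrite mulrBr mulrA -rmorphM /= divff ?subr_eq0 // mul1r opprB.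
split=> [/cvgrPdist_le dl e e0|dl].
  have e0' : 0 < e%:C by rewrite ltcR.
  have := dl _ e0'; rewrite /prop_near1 /= => -[d /= d0 Hd].
  exists d => // s Ds std; have [->|st] := eqVneq s t.
    by rewrite !subrr rmorph0 mul0r subr0 nm0 normr0 mulr0.
  rewrite quot // nmN nmM nm_real mulrC ler_wpM2r // -normc_le_real.
  by apply: Hd => //; rewrite /ball /= distrC.
apply/cvgrPdist_le => e /gt0_complexE[r r0 ->].
have [d d0 Hd] := dl r r0.
exists d => //= s; rewrite /ball /= distrC => std st Ds.
rewrite normc_le_real -(ler_pM2l (_ : 0 < `|s - t|)) ?normr_gt0 ?subr_eq0 //.
by rewrite -nm_real -nmM -nmN -quot // [X in _ <= X]mulrC nm_real; apply: Hd.
Qed.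

Lemma within_continuousP D f : {within D, continuous f} <->
  forall x, D x -> forall e, 0 < e -> exists2 d, 0 < d &
    forall y, D y -> `|y - x| < d -> nm (f y - f x) <= e.
Proof.
split=> [/subspace_continuousP cf x Dx e e0|cf].
  have e0' : 0 < e%:C by rewrite ltcR.
  have /cvgrPdist_le /(_ _ e0') := cf x Dx.
  rewrite /prop_near1 /= => -[d /= d0 Hd]; exists d => // y Dy yx.
  by rewrite nmC -normc_le_real; apply: Hd => //; rewrite /ball /= distrC.
apply/subspace_continuousP => x Dx; apply/cvgrPdist_le => e /gt0_complexE[r r0 ->].
have [d d0 Hd] := cf x Dx r r0.
exists d => //= y; rewrite /ball /= distrC => yx Dy.
by rewrite normc_le_real nmC; apply: Hd.
Qed.

End epsilon_delta.

(** * The tip of time b is swallowed exactly at time b *)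

Section lifetime.
Context {R : realType}.
Variables (T : R) (U : R -> R).

Lemma flow_loewner_solution b g : flow U b g -> loewner_solution U (g 0) b g.
Proof.
move=> Fg; split=> // t tb; have [Im0 dg] := Fg t tb; split.
  by move=> gU; move: Im0; rewrite gU ltxx.
apply/derivative_withinP => e e0; have [d d0 Hd] := dg e e0.
by exists d => // s; rewrite /= in_itv /=; exact: Hd.
Qed.

(** The orbit is a solution on [0, r] for each r < b; taking r > s makes the inequality strict. *)
Lemma lifetime_gt b (g : R -> R[i]) (s : R) : tip_flow U b g -> b <= T ->
  0 <= s -> s < b -> (s%:E < lifetime T U (g 0%R))%E.
Proof.
move=> [_ _ Fg] bT s0 sb.
have [r sr rb] : exists2 r, s < r & r < b by exists ((s + b) / 2); lra.
have r0 : 0 <= r < b by rewrite rb andbT ltW // (le_lt_trans s0).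
have Fr := Fg r r0.
have r0' : 0 <= r by case/andP: r0.
have z0 : g 0 != 0.
  by apply: Im_gt0_neq0; have [] := Fr 0 _; rewrite ?lexx.
rewrite /lifetime (negbTE z0); case: ifP => _; first exact: ltry.
apply: (@lt_le_trans _ _ r%:E); first by rewrite lte_fin.
apply: ereal_sup_ubound; exists r => //=; split.
  by rewrite r0' (le_trans (ltW rb)).
by exists g; exact: flow_loewner_solution.
Qed.

(* Uniqueness forces a longer solution to follow g up to its singularity at b. *)
Lemma loewner_solution_lt b g b' h : cts 0 T (fun x => (U x)%:C) ->
  tip_flow U b g -> 0 < b -> b' <= T ->
  loewner_solution U (g 0) b' h -> b' < b.
Proof.
move=> cU [[cg _] gb Fg] b0 b'T [h0 Hh]; rewrite ltNge; apply/negP => bb'.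
have dh x : 0 <= x <= b' -> der 0 b' h x (2 / (h x - (U x)%:C)).
  move=> xb' e e0; have [_ /derivative_withinP/(_ e e0)[d d0 Hd]] := Hh x xb'.
  by exists d => // s sb'; apply: Hd; rewrite /= in_itv.
have ch : cts 0 b' h by apply: der_cts dh.
have hU x : 0 <= x <= b' -> h x - (U x)%:C != 0.
  by move=> /Hh[hU _]; rewrite subr_eq0; apply/eqP.
(* Before b both solutions keep a positive distance from U on [0, r], so Gronwall applies to h - g,
   which vanishes at 0. *)
have E r : 0 <= r < b -> h r = g r.
  move=> rb; have Fr := Fg r rb; have /andP[r0 rb'] := rb.
  have rb1 := le_trans (ltW rb') bb'; have rT := le_trans rb1 b'T.
  have cUr := cts_sub (lexx 0) rT cU; have chr := cts_sub (lexx 0) rb1 ch.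
  have gU x : 0 <= x <= r -> g x - (U x)%:C != 0.
    by move=> xr; have [Im0 _] := Fr x xr; apply: Im_gt0_neq0; rewrite ImB_real.
  have cgr : cts 0 r g by apply: cts_sub cg; rewrite ?lexx ?(ltW rb').
  have [m /andP[m0 mr] Hm] := cts_nm_min r0 (ctsB chr cUr).
  have [n /andP[n0 nr] Hn] := cts_nm_min r0 (ctsB cgr cUr).
  set A := nm (h m - (U m)%:C) in Hm; set B := nm (g n - (U n)%:C) in Hn.
  have A0 : 0 < A by rewrite nm_gt0; apply: hU; rewrite m0 (le_trans mr).
  have B0 : 0 < B by rewrite nm_gt0; apply: gU; rewrite n0.
  clearbody A B; have K0 : 0 <= 2 / (A * B) by rewrite ltW // divr_gt0 // mulr_gt0.
  have Hlog x : 0 <= x < r -> logder (fun y => h y - g y) x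
       (- 2 / ((h x - (U x)%:C) * (g x - (U x)%:C))) /\
       nm (- 2 / ((h x - (U x)%:C) * (g x - (U x)%:C))) <= 2 / (A * B).
    move=> /andP[x0 xr]; have xr' : 0 <= x <= r by rewrite x0 ltW.
    have xb' : 0 <= x <= b' by rewrite x0 (le_trans (ltW xr)).
    split.
      have xb1 : 0 <= x < b' by rewrite x0 (lt_le_trans xr).
      have xr1 : 0 <= x < r by rewrite x0.
      have := rderB (der_rder xb1 (dh x xb')) (der_rder xr1 (Fr x xr').2).
      rewrite /logder; congr rder; have hU0 := hU x xb'; have gU0 := gU x xr'.
      by field; rewrite hU0 gU0.
    rewrite nmf_div nmN nm_nat ler_pM2l // lef_pV2 ?posrE ?nmM ?mulr_gt0 ?nm_gt0 ?(gU x) ?(hU x) //.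
    by apply: ler_pM; rewrite ?(ltW A0) ?(ltW B0) ?Hm ?Hn.
  have := logder_bound r0 K0 (ctsB chr cgr) Hlog.
  rewrite h0 subrr nm0 mulr0 => nm_le0.
  apply/eqP; rewrite -subr_eq0; apply: contraLR nm_le0.
  by rewrite -ltNge nm_gt0.
(* By continuity h would equal g at b as well, that is U b, which a solution must avoid. *)
have bb : 0 <= b <= b' by rewrite ltW.
have : 0 < nm (h b - g b) by rewrite gb nm_gt0 hU.
have cgh : cts 0 b (fun y => h y - g y) by apply: ctsB (cts_sub _ bb' ch) cg.
move=> P0; have e0 : 0 < nm (h b - g b) / 2 by rewrite divr_gt0.
have b0b : 0 <= b <= b by rewrite ltW /=.
have [d d0 Hd] := cgh b b0b _ e0.
have [y y0 yd] : exists2 y, 0 <= y < b & `|y - b| < d.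
  exists (Num.max 0 (b - d / 2)).
    by rewrite le_max lexx gt_max b0 /= ltrBlDr ltrDl divr_gt0.
  rewrite ler0_norm; last by rewrite subr_le0 ge_max ltW //= lerBlDr lerDl ltW // divr_gt0.
  have : b - d / 2 <= Num.max 0 (b - d / 2) by rewrite le_max lexx orbT.
  lra.
have yb : 0 <= y <= b by case/andP: y0 => -> /ltW.
have := Hd y yb yd; rewrite (E y y0) subrr sub0r nmN.
lra.
Qed.

Lemma lifetime_le b (g : R -> R[i]) : cts 0 T (fun x => (U x)%:C) ->
  tip_flow U b g -> 0 < b -> b <= T -> (lifetime T U (g 0%R) <= b%:E)%E.
Proof.
move=> cU Fg b0 bT; have lt_b := loewner_solution_lt cU Fg b0.
rewrite /lifetime; case: ifP => _; first by rewrite lee_fin ltW.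
case: asboolP => [[h /(lt_b T h (lexx T))]|_]; first by rewrite ltNge bT.
apply: ge_ereal_sup => _ [b' [/andP[_ b'T] [h Hh]] <-].
by rewrite lee_fin ltW // (lt_b b' h).
Qed.

End lifetime.

(** * Identification of the given trace with the tips *)

Section trace_points.
Context {R : realType}.
Variables (T : R) (U v : R -> R).
Hypothesis cU : cts 0 T (fun x => (U x)%:C).
Hypothesis vU : forall x y, 0 <= x -> x <= y -> y <= T ->
  `|U y - U x| <= v y - v x.
Variable eps0 : R.
Hypothesis eps0_gt0 : 0 < eps0.
Hypothesis small0 : small_variation T v (1 / 10) eps0.
Variable G : R -> R -> R[i].
Hypothesis tipG : forall b, 0 < b <= T -> tip_flow U b (G b).
Variable gamma : R -> R[i].
Hypothesis trace : is_loewner_trace T U gamma.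

Lemma tip_Im_gt0 b g : 0 < b -> tip_flow U b g -> 0 < complex.Im (g 0).
Proof.
move=> b0 [_ _ Fg]; have h : 0 <= (0 : R) < b by rewrite lexx.
by have [] := Fg 0 h 0; rewrite ?lexx.
Qed.

Lemma tip_in_domain b s : 0 < b <= T -> 0 <= s -> s < b ->
  loewner_domain T U s (G b 0).
Proof.
move=> /[dup] bT /andP[b0 bT'] s0 sb; split; first exact: tip_Im_gt0 (tipG bT).
by case=> _; rewrite leNgt (lifetime_gt (tipG bT)).
Qed.

(** The tip of a later time b is still in H_r, and H_r avoids gamma[0, r], in particular gamma r. *)
Lemma trace_not_past b r : 0 < b <= T -> 0 <= r -> r < b -> gamma r <> G b 0.
Proof.
move=> bT r0 rb grG; have := tip_in_domain bT r0 rb.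
have rT : 0 <= r <= T by rewrite r0 (le_trans (ltW rb)) //; case/andP: bT.
have [_ _ _ /(_ r rT)[[z0 _ ->] _ _]] := trace.
move=> /(@connected_component_sub _ _ _) [_]; apply.
by exists r => //; rewrite /= in_itv /= r0 lexx.
Qed.

Lemma tip_uniform_cts e : 0 < e -> exists2 d, 0 < d &
  forall x y, 0 < x -> x <= y -> y <= T -> y - x < d ->
    nm (G y 0 - G x 0) <= e.
Proof.
move=> e0; set M := 3 * expR (8 / eps0 * T).
have M0 : 0 < M by rewrite mulr_gt0 ?expR_gt0.
exists (Num.min (eps0 / 2) ((e / M) ^+ 2)).
  by rewrite lt_min divr_gt0 //= exprn_gt0 // divr_gt0.
move=> x y x0 xy yT; rewrite lt_min => /andP[yx1 yx2].
have xT : 0 < x <= T by rewrite x0 (le_trans xy).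
have yT' : 0 < y <= T by rewrite (lt_le_trans x0 xy).
apply: le_trans (tip_flow_continuous cU vU eps0_gt0 small0 (tipG xT) (tipG yT')
  x0 xy yT (ltW yx1) (lexx 0) (ltW x0)) _.
rewrite -/M mulrC -ler_pdivlMr //.
rewrite -[leRHS]ger0_norm ?(ltW (divr_gt0 e0 M0)) // -(sqrtr_sqr (e / M)).
by rewrite ler_sqrt ?sqr_ge0 // ltW.
Qed.

Lemma segment_image_connected (z w : R[i]) :
  connected ((fun t : R => z + t%:C * (w - z)) @` `[0, 1]).
Proof.
apply: connected_continuous_connected; first exact: segment_connected.
apply/within_continuousP => x _ e e0.
have m1 : 0 < nm (w - z) + 1 by rewrite ltr_wpDl ?nm_ge0.
exists (e / (nm (w - z) + 1)); first by rewrite divr_gt0.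
move=> y _; rewrite ltr_pdivlMr // => yx.
have -> : z + y%:C * (w - z) - (z + x%:C * (w - z)) = (y - x)%:C * (w - z).
  by rewrite rmorphB /=; ring.
rewrite nmM nm_real (le_trans _ (ltW yx)) // ler_wpM2l // lerDl //.
Qed.

Lemma trace_cts : cts 0 T gamma.
Proof.
case: trace => /within_continuousP cg _ _ _ x xT e e0.
have xin : `[0, T]%classic x by rewrite /= in_itv.
have [d d0 Hd] := cg x xin e e0.
by exists d => // y yT; apply: Hd; rewrite /= in_itv.
Qed.

(* Otherwise the tip could be joined off gamma[0, b] to a point swallowed after
   time b, and it would still lie in H_b. *)
Lemma trace_meets_tip b : 0 < b -> b < T -> exists2 r, 0 <= r <= b & gamma r = G b 0.
Proof.
move=> b0 bT; set z := G b 0; apply: contrapT => nmeet.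
have bT' : 0 < b <= T by rewrite b0 ltW.
have Im0 : 0 < complex.Im z := tip_Im_gt0 b0 (tipG bT').
have cz : cts 0 b (fun r => gamma r - z).
  by apply: (ctsB _ (cts_const z)); apply: (cts_sub _ _ trace_cts) => //; apply: ltW.
have [m mb Hm] := cts_nm_min (ltW b0) cz.
have m0 : 0 < nm (gamma m - z).
  by rewrite nm_gt0 subr_eq0; apply/eqP => gz; apply: nmeet; exists m.
set A := upper_half_plane `\` gamma @` `[0, b].
have inA w : nm (w - z) < nm (gamma m - z) -> nm (w - z) < complex.Im z -> A w.
  move=> wm wI; split.
    have := le_Im_nm (w - z); rewrite /upper_half_plane /= raddfB /=.
    by rewrite ler_norml => /andP[+ _]; lra.
  case=> r; rewrite /= in_itv /= => rb gw; move: wm; rewrite -gw ltNge Hm //.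
(* The disc of radius e about the tip avoids both gamma[0, b] and the real line. *)
set e := Num.min (nm (gamma m - z)) (complex.Im z).
have e0 : 0 < e by rewrite lt_min m0.
have bb : 0 <= b <= T by rewrite !ltW.
have e2 : 0 < e / 2 by rewrite divr_gt0.
have [d d0 Hd] := tip_uniform_cts e2.
have [b' bb' [b'T b'd]] : exists2 b', b < b' & b' <= T /\ b' < b + d.
  exists (Num.min T (b + d / 2)).
    by rewrite lt_min bT ltrDl divr_gt0.
  split; first by rewrite ge_min lexx.
  by rewrite gt_min ltrD2l ltr_pdivrMr // ltr_pMr // ltr1n orbT.
have b'0 := lt_trans b0 bb'; have b'T' : 0 < b' <= T by rewrite b'0.
set w := G b' 0.
have wz : nm (w - z) < e.
  apply: le_lt_trans (_ : e / 2 < e); last by rewrite ltr_pdivrMr // ltr_pMr // ltr1n.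
  by apply: Hd => //; lra.
have [_ _ _ /(_ b bb)[[z0 _ CE] _ _]] := trace.
have := tip_in_domain b'T' (ltW b0) bb'; rewrite CE => Cw.
suff : loewner_domain T U b z.
  by case=> _; apply; split; [exact: ltW|exact: lifetime_le cU (tipG bT') b0 (ltW bT)].
rewrite CE (same_connected_component Cw).
apply: (connected_component_max (B := (fun t : R => z + t%:C * (w - z)) @` `[0, 1])).
- exists 1; first by rewrite /= in_itv /= ler01 lexx.
  by rewrite rmorph1 mul1r addrC subrK.
- move=> _ [t + <-]; rewrite /= in_itv /= => /andP[t0 t1].
  have : nm (z + t%:C * (w - z) - z) < e.
    have -> : z + t%:C * (w - z) - z = t%:C * (w - z) by ring.
    by rewrite nmM nm_real ger0_norm // (le_lt_trans _ wz) // ler_piMl // nm_ge0.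
  by rewrite lt_min => /andP[]; exact: inA.
- exact: segment_image_connected.
- exists 0; first by rewrite /= in_itv /= lexx ler01.
  by rewrite rmorph0 mul0r addr0.
Qed.

Lemma trace_tip_lt b : 0 < b -> b < T -> gamma b = G b 0.
Proof.
move=> b0 bT; have [r /andP[r0 rb] gr] := trace_meets_tip b0 bT.
have bT' : 0 < b <= T by rewrite b0 ltW.
move: rb; rewrite le_eqVlt => /orP[/eqP rb|rb]; first by rewrite -{1}rb.
by have := trace_not_past bT' r0 rb.
Qed.

Lemma trace_tip : 0 < T -> is_trace_of T U G gamma.
Proof.
move=> T0; split=> //; first by case: trace.
(* The case b = T has no later tip to compare with; it follows from the continuity of gamma and of
   the tips. *)
move=> b /andP[b0]; rewrite le_eqVlt => /orP[/eqP ->|bT]; last exact: trace_tip_lt.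
have TT : 0 < T <= T by rewrite T0 lexx.
apply/eqP; rewrite -subr_eq0; apply: contraT => neq.
have P0 : 0 < nm (gamma T - G T 0) by rewrite nm_gt0.
have e0 : 0 < nm (gamma T - G T 0) / 3 by rewrite divr_gt0.
have T0T : 0 <= T <= T by rewrite lexx ltW.
have [d d0 Hd] := trace_cts T0T e0.
have [d' d'0 Hd'] := tip_uniform_cts e0.
have [y [[y0 yT] [yd yd']]] :
    exists y, (0 < y /\ y < T) /\ (T - y < d /\ T - y < d').
  exists (T - Num.min (T / 2) (Num.min (d / 2) (d' / 2))).
  set m := Num.min _ _.
  have m0 : 0 < m by rewrite !lt_min !divr_gt0.
  have [mT [md md']] : m <= T / 2 /\ m <= d / 2 /\ m <= d' / 2.
    by rewrite /m !ge_min !lexx !orbT.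
  by split; split; lra.
have yT' : `|y - T| < d by rewrite distrC ger0_norm // subr_ge0 ltW.
have y0T : 0 <= y <= T by rewrite !ltW.
have := Hd y y0T yT'; have := Hd' y T y0 (ltW yT) (lexx T) yd'.
rewrite (trace_tip_lt y0 yT) (nmC (G T 0)) (nmC _ (gamma T)) => h1 h2.
by have := nm_tri (G y 0) (gamma T) (G T 0); lra.
Qed.
End trace_points.

(** * From Cauchy difference quotients to a continuous derivative *)

Section slopes.
Context {R : realType}.
Variables (c : R) (f : R -> R[i]).
Hypothesis c0 : 0 < c.

Let slope u w := (f w - f u) / (w - u)%:C.

(** Neither point has to be x: convergence of the slopes over such pairs is strict
    differentiability, which is stable under moving x. *)
Definition near_pair (x d u w : R) :=
  [/\ 0 <= u, u < w, w <= c, `|u - x| < d & `|w - x| < d].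

Lemma near_pair_le x d d' u w : d <= d' -> near_pair x d u w -> near_pair x d' u w.
Proof. by move=> dd' [? ? ? /lt_le_trans ux /lt_le_trans wx]; split=> //; [exact: ux|exact: wx]. Qed.

Lemma near_pair_exists x d : 0 <= x <= c -> 0 < d -> exists u w, near_pair x d u w.
Proof.
move=> /andP[x0 xc] d0; have d2 : 0 < d / 2 by rewrite divr_gt0.
have dd : d / 2 < d by lra.
have [xltc|cx] := ltP x c.
  exists x, (Num.min c (x + d / 2)).
  have lt1 : x < Num.min c (x + d / 2) by rewrite lt_min xltc; lra.
  have le1 : Num.min c (x + d / 2) <= x + d / 2 by rewrite ge_min lexx orbT.
  split=> //; first by rewrite ge_min lexx.
    by rewrite subrr normr0.
  by rewrite ger0_norm; lra.
have xp : 0 < x := lt_le_trans c0 cx.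
exists (Num.max 0 (x - d / 2)), x.
have lt1 : Num.max 0 (x - d / 2) < x by rewrite gt_max; apply/andP; split; lra.
have le1 : x - d / 2 <= Num.max 0 (x - d / 2) by rewrite le_max lexx orbT.
split=> //; first by rewrite le_max lexx.
  by rewrite ltr0_norm; lra.
by rewrite subrr normr0.
Qed.

Hypothesis slope_cauchy : forall x e, 0 <= x <= c -> 0 < e ->
  exists2 d, 0 < d & forall u u' w w', near_pair x d u u' -> near_pair x d w w' ->
    nm (slope u u' - slope w w') <= e.

Lemma slope_limit x : 0 <= x <= c -> exists l, forall e, 0 < e ->
  exists2 d, 0 < d & forall u w, near_pair x d u w -> nm (slope u w - l) <= e.
Proof.
move=> xc; have p2 n : 0 < ((2 : R) ^+ n)^-1 by rewrite invr_gt0 exprn_gt0.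
have /choice[d Hd] n : exists d, 0 < d /\
    forall u u' w w', near_pair x d u u' -> near_pair x d w w' ->
      nm (slope u u' - slope w w') <= (2 ^+ n)^-1.
  by have [d d0 Hd] := slope_cauchy xc (p2 n); exists d.
(* The n-th pair is close for both d n and d n.+1, so that consecutive slopes can be compared. *)
have /choice[p Hp] n : exists p : R * R,
    near_pair x (Num.min (d n) (d n.+1)) p.1 p.2.
  have d0 : 0 < Num.min (d n) (d n.+1) by rewrite lt_min (Hd n).1 (Hd n.+1).1.
  by have [u [w uw]] := near_pair_exists xc d0; exists (u, w).
have Hp1 n : near_pair x (d n) (p n).1 (p n).2.
  by apply: near_pair_le (Hp n); rewrite ge_min lexx.
have Hp2 n : near_pair x (d n.+1) (p n).1 (p n).2.
  by apply: near_pair_le (Hp n); rewrite ge_min lexx orbT.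
have [l Hl] : exists l, forall n : nat,
    nm (slope (p n).1 (p n).2 - l) <= 4 * 1 / 2 ^+ n.
  apply: geometric_cauchy => n.
  apply: le_trans ((Hd n.+1).2 _ _ _ _ (Hp1 n.+1) (Hp2 n)) _.
  by rewrite div1r lef_pV2 ?posrE ?exprn_gt0 // ler_weXn2l // ler1n.
exists l => e e0; have [n Hn] := geometric_lt 5 e0.
exists (d n); first exact: (Hd n).1.
move=> u w uw; have h1 := (Hd n).2 _ _ _ _ uw (Hp1 n); have h2 := Hl n.
apply: le_trans (nm_tri (slope (p n).1 (p n).2) _ _) _; lra.
Qed.

(** A pair close to y is also a pair close to x when y is close to x. One slope thus approximates
    both derivatives, which makes the derivative continuous. *)
Lemma slope_cauchy_C1 : C1_within `[0, c] f.
Proof.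
have /choice[df Hdf] x : exists l, 0 <= x <= c -> forall e, 0 < e ->
    exists2 d, 0 < d & forall u w, near_pair x d u w -> nm (slope u w - l) <= e.
  have [/slope_limit[l Hl]|nx] := pselect (0 <= x <= c); first by exists l.
  by exists 0.
exists df; split.
  move=> x; rewrite /= in_itv /= => xc; apply/derivative_withinP => e e0.
  have [d d0 Hd] := Hdf x xc e e0; have /andP[x0 xc'] := xc.
  have incr s s' : s < s' ->
      f s' - f s - (s' - s)%:C * df x = (s' - s)%:C * (slope s s' - df x).
    move=> ss'; have : (s' - s)%:C != 0 :> R[i].
      by apply/eqP => -[/eqP]; rewrite subr_eq0 gt_eqF.
    by move=> ne0; rewrite /slope mulrBr mulrCA divff // mulr1.
  exists d => // s; rewrite /= in_itv /= => /andP[s0 sc] sx.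
  have xx : `|x - x| < d by rewrite subrr normr0.
  have [sltx|xlts|->] := ltgtP s x.
  - have -> : f s - f x - (s - x)%:C * df x = - (f x - f s - (x - s)%:C * df x).
      by rewrite !rmorphB /=; ring.
    by rewrite nmN incr // nmM nm_real distrC mulrC ler_wpM2r // Hd.
  - by rewrite incr // nmM nm_real mulrC ler_wpM2r // Hd.
  - by rewrite !subrr rmorph0 mul0r subr0 nm0 normr0 mulr0.
apply/within_continuousP => x; rewrite /= in_itv /= => xc e e0.
have e2 : 0 < e / 2 by rewrite divr_gt0.
have [d d0 Hd] := Hdf x xc _ e2; exists (d / 2); first by rewrite divr_gt0.
move=> y; rewrite in_itv /= => yc yx; have [d' d'0 Hd'] := Hdf y yc _ e2.
have m0 : 0 < Num.min (d / 2) d' by rewrite lt_min divr_gt0.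
have [u [w uw]] := near_pair_exists yc m0.
have h1 : nm (slope u w - df y) <= e / 2.
  by apply: Hd'; apply: near_pair_le uw; rewrite ge_min lexx orbT.
have h2 : nm (slope u w - df x) <= e / 2.
  apply: Hd; have [u0 ltuw wc] := uw; rewrite !lt_min => /andP[uy _] /andP[wy _].
  by split=> //; [have := ler_distD y u x|have := ler_distD y w x]; lra.
have := nm_tri (slope u w) (df y) (df x); rewrite (nmC (df y) (slope u w)).
lra.
Qed.

End slopes.

(** * Square-root time and the conclusion *)

Section square_root_time.
Context {R : realType}.

Lemma sqrt_path_slope (tr : R -> R[i]) (u w : R) : 0 <= u -> u < w ->
  (tr (w ^+ 2) - tr (u ^+ 2)) / (w - u)%:C = 'i * 2 * trace_slope tr (u ^+ 2) (w ^+ 2).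
Proof.
move=> u0 uw; have w0 := le_trans u0 (ltW uw).
rewrite /trace_slope !sqrtr_sqr !ger0_norm // rmorphM /= rmorph_nat.
have ne0 : (w - u)%:C != 0 :> R[i].
  by apply/eqP => -[/eqP]; rewrite subr_eq0 gt_eqF.
have i0 : 'i != 0 :> R[i] by rewrite -nm_gt0 nm_i.
by move: (w - u)%:C ne0 => D ne0; field; rewrite ne0 i0.
Qed.

End square_root_time.

Theorem theorem1p3 (R : realType) (T : R) (U : R -> R) (gamma : R -> R[i])
    (T_gt0 : 0 < T) (U_BV_LR : BV_LR T U)
    (U_small : uniformly_small_integral T U)
    (gamma_trace : is_loewner_trace T U gamma) :
  C1_within `[0, Num.sqrt T] (fun t => gamma (t ^+ 2)).
Proof.
have cU := driver_cts U_BV_LR; have vU := variation_function_dominates T_gt0 U_BV_LR.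
have small_int := uniformly_small_small_integral T_gt0 U_BV_LR U_small.
(* 1/10 fixes the scale eps0 below which the paths lie in the cone; smaller eta are taken later from
   [small_int]. *)
have tenth : 0 < 1 / 10 :> R by rewrite divr_gt0.
have [eps0 eps0_gt0 /small_integral_variation small0] := small_int _ tenth.
have /choice[G HG] b : exists g, 0 < b <= T -> tip_flow U b g.
  have [/andP[b0 bT]|nb] := pselect (0 < b <= T); last by exists (fun=> 0).
  by have [g Hg] := tip_flow_exists cU vU eps0_gt0 small0 b0 bT; exists g.
have tr := trace_tip cU vU eps0_gt0 small0 HG gamma_trace T_gt0.
have U0 : U 0 = 0 by case: U_BV_LR.
have sT0 : 0 < Num.sqrt T by rewrite sqrtr_gt0.
apply: slope_cauchy_C1 => // x e /andP[x0 xT] e0.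
have sqT y : 0 <= y -> y <= Num.sqrt T -> y ^+ 2 <= T.
  by move=> y0 yT; rewrite -(sqr_sqrtr (ltW T_gt0)) ler_pXn2r ?nnegrE ?sqrtr_ge0.
(* The half absorbs the factor |2i| of [sqrt_path_slope]. *)
have e2 : 0 < e / 2 by rewrite divr_gt0.
have [d d0 Hd] := trace_slope_cauchy cU vU (variation_function_cts T_gt0 U_BV_LR)
  eps0_gt0 small0 small_int U0 T_gt0 tr (sqr_ge0 x) (sqT x x0 xT) e2.
exists (d / (2 * Num.sqrt T)); first by rewrite divr_gt0 // mulr_gt0.
have near_sq y : 0 <= y -> y <= Num.sqrt T -> `|y - x| < d / (2 * Num.sqrt T) ->
    `|y ^+ 2 - x ^+ 2| < d.
  move=> y0 yT; rewrite ltr_pdivlMr ?mulr_gt0 // => yx.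
  rewrite subr_sqr normrM (le_lt_trans _ yx) // ler_wpM2l // ger0_norm; lra.
move=> u u' w w' [u0 uu' u'T ux u'x] [w0 ww' w'T wx w'x].
have u'0 := ltW (le_lt_trans u0 uu'); have w'0 := ltW (le_lt_trans w0 ww').
rewrite !sqrt_path_slope // -mulrBr !nmM nm_i nm_nat mul1r mulrC -ler_pdivlMr //.
have lt_sq (a b : R) : 0 <= a -> a < b -> a ^+ 2 < b ^+ 2.
  by move=> a0 ab; rewrite ltr_pXn2r ?nnegrE // (ltW (le_lt_trans a0 ab)).
apply: Hd; rewrite ?sqr_ge0 ?lt_sq ?sqT ?near_sq //.
- exact: ltW (lt_le_trans uu' u'T).
- exact: ltW (lt_le_trans ww' w'T).
Qed.
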